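(* Let $p\in(1,2)$ and $q\in(p,\infty)$. Suppose $X$ is a real Banach space containing a complemented copy of $\ell_p$, and a copy of either $\ell_q$ or $c_0$ (which need not be complemented). Then $\mathcal{L}(X)$ and $\mathcal{L}(X_{\mathbb{C}})$ each admit a chain (with respect to inclusion), with cardinality of the continuum, of closed ideals contained in $\mathcal{FSS}(X)$ and $\mathcal{FSS}(X_{\mathbb{C}})$, respectively. Furthermore, $\mathcal{L}(X^* )$ and $\mathcal{L}(X_{\mathbb{C}}^* )$ each admit a chain, with cardinality of the continuum, of closed ideals contained in $\mathcal{SSCS}(X^* )$ and $\mathcal{SSCS}(X_{\mathbb{C}}^* )$, respectively.
   Context: Operators are continuous linear operators between normed spaces; $\mathcal{L}(X,Y)$ is the space of operators from $X$ to $Y$ and $\mathcal{L}(X)=\mathcal{L}(X,X)$. A closed ideal of $\mathcal{L}(X)$ is a norm-closed linear subspace $\mathcal{J}$ with $BTA\in\mathcal{J}$ whenever $T\in\mathcal{J}$ and $A,B\in\mathcal{L}(X)$. A copy of a Banach space $Z$ in $X$ is a closed subspace of $X$ isomorphic to $Z$; it is complemented if it is the range of a bounded projection on $X$. The complexification of a real Banach space $X$ is $X_{\mathbb{C}}=X\oplus iX$ with the usual complex vector space operations and norm $\|x+iy\|_{X_{\mathbb{C}}}=\sup_{\phi\in[0,2\pi]}\|x\cos\phi+y\sin\phi\|_X$. Here $X_{\mathbb{C}}^*$ denotes the dual of $X_{\mathbb{C}}$ (canonically isomorphic to the complexification of $X^*$). $T\in\mathcal{L}(X,Y)$ is finitely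 strictly singular ($T\in\mathcal{FSS}(X,Y)$) if for every $\epsilon>0$ there is $n\in\mathbb{Z}^+$ such that every $n$-dimensional subspace $E\subseteq X$ contains a nonzero vector $x$ with $\|Tx\|<\epsilon\|x\|$. $T$ is superstrictly cosingular ($T\in\mathcal{SSCS}(X,Y)$) if and only if $T^*\in\mathcal{FSS}(Y^*,X^* )$. Write $\mathcal{FSS}(X)=\mathcal{FSS}(X,X)$ and $\mathcal{SSCS}(X)=\mathcal{SSCS}(X,X)$. *)

(* Defs.v *)
From HB Require Import structures.
From mathcomp Require Import all_boot all_order all_algebra.
From mathcomp Require Import complex ring.
From mathcomp Require Import all_classical all_reals all_analysis.

Set Implicit Arguments.
Unset Strict Implicit.
Unset Printing Implicit Defensive.

Import Order.TTheory GRing.Theory Num.Theory.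
Import numFieldNormedType.Exports.

Local Open Scope classical_set_scope.
Local Open Scope card_scope.
Local Open Scope ring_scope.

(* The operator norm is a supremum taken in the scalar field [K]; it is a norm
   only when sets of norms bounded above have a least upper bound in [K].  The
   class singles out such fields and is inhabited below by every [realType] and
   by its complex extension [R[i]] (where [<=] is partial but the elements
   [>= 0] are the nonnegative reals). *)
Class nneg_sup_complete (K : numFieldType) : Prop :=
  nneg_supremums : forall A : set K, A `<=` [set x | 0 <= x] ->
    A !=set0 -> ubound A !=set0 -> supremums A !=set0.

#[global] Instance real_nneg_sup_complete (R : realType) :
  nneg_sup_complete R.
Proof.
move=> A _ A0 Aub; have hA : has_sup A by [].
exists (sup A); split; first exact: sup_upper_bound.
by move=> b Ab; exact: ge_sup.
Qed.

#[global] Instance complex_nneg_sup_complete (R : realType) :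
  nneg_sup_complete (R[i] : numFieldType).
Proof.
move=> A Age [a Aa] [b Ab].
have ImA x : A x -> complex.Im x = 0.
  by move=> /Age /=; rewrite lecE => /andP[/eqP ->].
have hB : has_sup [set complex.Re x | x in A].
  split; first by exists (complex.Re a), a.
  by exists (complex.Re b) => _ [x Ax <-]; have := Ab _ Ax; rewrite lecE => /andP[].
exists ((sup [set complex.Re x | x in A])%:C)%C; split.
  move=> x Ax; rewrite lecE /= (ImA _ Ax) eqxx /=.
  by apply: sup_upper_bound => //; exists x.
move=> c Ac; have := Ac _ Aa; rewrite !lecE /= (ImA _ Aa) => /andP[-> _] /=.
apply: ge_sup; first exact: hB.1.
by move=> _ [x Ax <-]; have := Ac _ Ax; rewrite lecE => /andP[].
Qed.

Section operators.
Context {K : numFieldType} {hK : nneg_sup_complete K}.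

(* [hK] is recorded in the type so that the normed structure on [op X Y] below
   can be inferred. *)
Definition op_pred of nneg_sup_complete K := fun X Y : normedModType K =>
  fun f : X -> Y => `[< linear f /\ continuous f >].

Record op (X Y : normedModType K) :=
  Op { op_fun :> X -> Y ; _ : op_fun \in op_pred hK (X := X) (Y := Y) }.

Section space.
Variables X Y : normedModType K.
Implicit Types T : op X Y.

HB.instance Definition _ := [isSub for @op_fun X Y].
HB.instance Definition _ := gen_eqMixin (op X Y).
HB.instance Definition _ := [Choice of op X Y by <:].

Lemma op_linear T : linear T.
Proof. by have := valP T; rewrite unfold_in => /asboolP[]. Qed.

Lemma op_continuous T : continuous T.
Proof. by have := valP T; rewrite unfold_in => /asboolP[]. Qed.

HB.instance Definition _ T := GRing.isLinear.Build K X Y *:%R T (op_linear T).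

Lemma op_submod_closed : submod_closed (op_pred hK (X := X) (Y := Y)).
Proof.
split.
  rewrite unfold_in; apply/asboolP; split => [a u v|x].
    by rewrite /= scaler0 addr0.
  exact: cst_continuous.
move=> a f g; rewrite !unfold_in => /asboolP[lf cf] /asboolP[lg cg].
apply/asboolP; split => [b u v|x].
  rewrite /= !fctE lf lg !scalerDr !scalerA mulrC.
  by rewrite -!addrA; congr (_ + _); rewrite addrCA.
by apply: cvgD; [apply: cvgZr; exact: cf|exact: cg].
Qed.

HB.instance Definition _ := GRing.isSubmodClosed.Build K (X -> Y)
  (op_pred hK (X := X) (Y := Y)) op_submod_closed.
HB.instance Definition _ := [SubChoice_isSubLmodule of op X Y by <:].

Definition opnorm T : K :=
  supremum 0 [set `|T x| | x in [set x | `|x| <= 1]].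

Lemma opnorm_has_sup T :
  supremums [set `|T x| | x in [set x : X | `|x| <= 1]] !=set0.
Proof.
apply: hK.
- by move=> _ [x _ <-] /=.
- by exists `|T 0|, 0 => //=; rewrite normr0.
- have /linear_bounded_continuous/bounded_funP/(_ 1)[M hM] :=
    @op_continuous T.
  by exists M => _ [x x1 <-]; exact: hM.
Qed.

Lemma opnormP T :
  supremums [set `|T x| | x in [set x : X | `|x| <= 1]] (opnorm T).
Proof.
have [s hs] := opnorm_has_sup T; rewrite /opnorm /supremum; case: ifPn.
  by move=> /eqP/seteqP[/(_ `|T 0|) + _] => []; case; exists 0; rewrite //= normr0.
by move=> _; apply: (xgetPex 0); exists s.
Qed.

Lemma opnorm_ge0 T : 0 <= opnorm T.
Proof.
apply: le_trans (normr_ge0 (T 0)) _.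
by apply: (opnormP T).1; exists 0 => //=; rewrite normr0.
Qed.

Lemma opnorm_bound T x : `|T x| <= opnorm T * `|x|.
Proof.
have [->|x0] := eqVneq x 0; first by rewrite linear0 !normr0 mulr0.
have x_gt0 : 0 < `|x| by rewrite normr_gt0.
rewrite -ler_pdivrMr// mulrC.
suff : `|T (`|x|^-1 *: x)| <= opnorm T.
  by rewrite linearZ /= normrZ ger0_norm ?invr_ge0.
apply: (opnormP T).1; exists (`|x|^-1 *: x) => //=.
by rewrite normrZ ger0_norm ?invr_ge0// mulVf ?gt_eqF.
Qed.

Lemma opnorm_le T c : (forall x, `|x| <= 1 -> `|T x| <= c) -> opnorm T <= c.
Proof. by move=> h; apply: (opnormP T).2 => _ [x /h ? <-]. Qed.

Lemma opnormD S T : opnorm (S + T) <= opnorm S + opnorm T.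
Proof.
apply: opnorm_le => x x1; apply: le_trans (ler_normD _ _) _.
by apply: lerD; apply: (opnormP _).1; exists x.
Qed.

Lemma opnormZ a T : opnorm (a *: T) = `|a| * opnorm T.
Proof.
have le_ b S : opnorm (b *: S) <= `|b| * opnorm S.
  apply: opnorm_le => x x1; rewrite [(b *: S) x]/(b *: S x) normrZ.
  by apply: ler_wpM2l => //; apply: (opnormP S).1; exists x.
apply/eqP; rewrite eq_le le_ /=.
have [->|a0] := eqVneq a 0; first by rewrite normr0 mul0r opnorm_ge0.
rewrite mulrC -ler_pdivlMr ?normr_gt0// mulrC -normfV.
by apply: le_trans (le_ a^-1 (a *: T)); rewrite scalerA mulVf// scale1r.
Qed.

Lemma opnorm_eq0 T : opnorm T = 0 -> T = 0.
Proof.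
move=> T0; apply/val_inj/funext => x /=.
by apply/eqP; rewrite -normr_le0 (le_trans (opnorm_bound T x))// T0 mul0r.
Qed.

HB.instance Definition _ := Lmodule_isNormed.Build K (op X Y)
  opnormD opnormZ opnorm_eq0.

End space.

Section composition.
Variables (X Y Z : normedModType K) (B : op Y Z) (A : op X Y).

Lemma op_comp_subproof :
  (fun x => B (A x)) \in op_pred hK (X := X) (Y := Z).
Proof.
rewrite unfold_in; apply/asboolP; split => [a u v|x].
  by rewrite !op_linear.
by apply: (@continuous_comp _ _ _ A B); exact: op_continuous.
Qed.

Definition op_comp : op X Z := Op op_comp_subproof.

End composition.

Definition dual (X : normedModType K) : normedModType K := op X K^o.

Section adjoint.
Variables (X Y : normedModType K) (T : op X Y).

Lemma adjoint_subproof :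
  (fun f : dual Y => op_comp f T : dual X) \in
    op_pred hK (X := dual Y) (Y := dual X).
Proof.
rewrite unfold_in; apply/asboolP.
have lin : linear (fun f : dual Y => op_comp f T : dual X).
  by move=> a f g; apply/val_inj/funext.
split=> //.
pose F : {linear dual Y -> dual X} := HB.pack (fun f : dual Y => op_comp f T : dual X)
  (GRing.isLinear.Build K (dual Y) (dual X) *:%R _ lin).
apply: (@bounded_linear_continuous _ _ _ F).
apply/bounded_funP => r; exists (r * opnorm T) => f fr.
apply: opnorm_le => x x1 /=.
apply: le_trans (opnorm_bound f (T x)) _.
apply: ler_pM => //; first exact: opnorm_ge0.
by apply: (opnormP T).1; exists x.
Qed.

Definition adjoint : op (dual Y) (dual X) := Op adjoint_subproof.

End adjoint.

Definition has_dim (X : normedModType K) (n : nat) (E : set X) :=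
  exists e : 'I_n -> X,
    (forall c : 'I_n -> K, \sum_i c i *: e i = 0 -> forall i, c i = 0) /\
    E = [set \sum_i c i *: e i | c in [set: 'I_n -> K]].

(* For [K := R[i]], [0 < eps] forces [eps] to be real. *)
Definition FSS (X Y : normedModType K) : set (op X Y) :=
  [set T | forall eps : K, 0 < eps -> exists2 n : nat, (0 < n)%N &
     forall E : set X, has_dim n E ->
       exists x, [/\ E x, x != 0 & `|T x| < eps * `|x| ] ].

Definition SSCS (X Y : normedModType K) : set (op X Y) :=
  [set T | FSS (adjoint T)].

Definition closed_ideal (X : normedModType K) (J : set (op X X)) :=
  [/\ closed J,
      J 0,
      forall (a : K) S T, J S -> J T -> J (a *: S + T) &
      forall A B T, J T -> J (op_comp B (op_comp T A)) ].

(* The cardinality of the continuum is that of a type of real numbers [R]; [R]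
   is unrelated to [K], which may be [R[i]]. *)
Definition admits_continuum_chain (R : realType) (X : normedModType K)
    (I : set (op X X)) :=
  exists C : set (set (op X X)),
    [/\ total_on C subset, C #= [set: R] &
        forall J, C J -> closed_ideal J /\ J `<=` I].

Definition is_copy (Z X : normedModType K) (F : set X) :=
  closed F /\
  exists (J : op Z X) (g : X -> Z),
    [/\ range J = F, cancel J g & {within F, continuous g} ].

Definition contains_copy (Z X : normedModType K) :=
  exists F : set X, is_copy Z F.

Definition contains_complemented_copy (Z X : normedModType K) :=
  exists2 F : set X, is_copy Z F &
    exists2 P : op X X, op_comp P P = P & range P = F.

End operators.

Arguments dual {K hK} X.
Arguments admits_continuum_chain {K hK} R X I.
Arguments FSS {K hK X Y}.
Arguments SSCS {K hK X Y}.
Arguments contains_copy {K hK} Z X.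
Arguments contains_complemented_copy {K hK} Z X.

Lemma lee1_fin (R : realType) (p : R) : 1 <= p -> (1 <= p%:E)%E.
Proof. by rewrite lee_fin. Qed.

Section ell.
Context {R : realType}.
Variables (p : R) (p1 : 1 <= p).

(* [LfunType] is the space of p-integrable functions, before the quotient by
   a.e. equality; for the counting measure that equality is pointwise. *)
Definition ell : Type := LfunType (@counting nat R) (lee1_fin p1).

HB.instance Definition _ := GRing.Lmodule.on ell.

Definition ell_val (u : ell) : nat -> R := (u : LfunType (@counting nat R) (lee1_fin p1)).

Definition ell_norm (u : ell) : R :=
  fine ('N[@counting nat R]_(p%:E) [EFin \o ell_val u])%E.

Lemma ell_normE (u : ell) : (ell_norm u)%:E =
  ((\sum_(k <oo) (`|ell_val u k| `^ p)%:E) `^ p^-1)%E.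
Proof.
rewrite [LHS](@finite_norm_fine _ _ _ (@counting nat R) _ (lee1_fin p1) u).
by rewrite Lnorm_counting ?(lt_le_trans ltr01).
Qed.

Lemma ell_normD (u v : ell) : ell_norm (u + v) <= ell_norm u + ell_norm v.
Proof. exact: (@ler_LnormD _ _ _ (@counting nat R) _ (lee1_fin p1)). Qed.

Lemma ell_normZ (a : R) (u : ell) : ell_norm (a *: u) = `|a| * ell_norm u.
Proof.
rewrite /ell_norm.
have := @LnormZ _ _ _ (@counting nat R) _ (lee1_fin p1) u a => /(congr1 fine).
rewrite -(@finite_norm_fine _ _ _ (@counting nat R) _ (lee1_fin p1) u) -EFinM /= => <-.
by [].
Qed.

Lemma ell_norm0_eq0 (u : ell) : ell_norm u = 0 -> u = 0.
Proof.
move=> /(@fine_Lnormr_eq0 _ _ _ (@counting nat R) _ (lee1_fin p1) u) [N [mN N0 uN]].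
apply/LfuneqP => k; apply: contrapT => uk.
have Nk : N k by apply: uN => /= /(_ Logic.I).
have : (counting [set k] <= (counting N : \bar R))%E.
  apply: (@le_measure _ _ _ (@counting nat R)); rewrite ?inE//.
  by move=> _ ->.
by rewrite N0 /counting asboolT// fset_set1 finmap.cardfs1 lee_fin ler10.
Qed.

HB.instance Definition _ :=
  Lmodule_isNormed.Build R ell ell_normD ell_normZ ell_norm0_eq0.

End ell.

Section c0.
Variable R : realType.

Definition c0_pred := fun u : nat -> R => `[< u @ \oo --> (0 : R) >].

Record c0 := C0 { c0_fun :> nat -> R ; _ : c0_fun \in c0_pred }.

HB.instance Definition _ := [isSub for c0_fun].
HB.instance Definition _ := gen_eqMixin c0.
HB.instance Definition _ := [Choice of c0 by <:].

Lemma c0_cvg (u : c0) : u @ \oo --> (0 : R).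
Proof. by have := valP u; rewrite unfold_in => /asboolP. Qed.

Lemma c0_submod_closed : submod_closed c0_pred.
Proof.
split; first by rewrite unfold_in; apply/asboolP; exact: cvg_cst.
move=> a u v; rewrite !unfold_in => /asboolP cu /asboolP cv; apply/asboolP.
suff : a *: u + v @ \oo --> a * 0 + 0 by rewrite mulr0 addr0.
by apply: cvgD => //; apply: cvgM => //; exact: cvg_cst.
Qed.

HB.instance Definition _ :=
  GRing.isSubmodClosed.Build R (nat -> R) c0_pred c0_submod_closed.
HB.instance Definition _ := [SubChoice_isSubLmodule of c0 by <:].

Definition c0_norm (u : c0) : R := sup (range (fun k => `|u k|)).

Lemma c0_has_sup (u : c0) : has_sup (range (fun k => `|u k|)).
Proof.
split; first by exists `|u 0|, 0.
have /cvg_seq_bounded [M [_ hM]] : cvgn (u : nat -> R).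
  by apply/cvg_ex; exists 0; exact: c0_cvg.
by exists (M + 1) => _ [k _ <-]; apply: hM => //; rewrite ltrDl.
Qed.

Lemma c0_norm_ub (u : c0) k : `|u k| <= c0_norm u.
Proof. by apply: sup_upper_bound; [exact: c0_has_sup|exists k]. Qed.

Lemma c0_norm_le (u : c0) M : (forall k, `|u k| <= M) -> c0_norm u <= M.
Proof.
move=> h; apply: ge_sup; first exact: (c0_has_sup u).1.
by move=> _ [k _ <-].
Qed.

Lemma c0_normD (u v : c0) : c0_norm (u + v) <= c0_norm u + c0_norm v.
Proof.
apply: c0_norm_le => k; apply: le_trans (ler_normD _ _) _.
by apply: lerD; exact: c0_norm_ub.
Qed.

Lemma c0_normZ (a : R) (u : c0) : c0_norm (a *: u) = `|a| * c0_norm u.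
Proof.
have le_ b v : c0_norm (b *: v) <= `|b| * c0_norm v.
  apply: c0_norm_le => k; rewrite [(b *: v) k]/(b * v k) normrM.
  by apply: ler_wpM2l => //; exact: c0_norm_ub.
apply/eqP; rewrite eq_le le_ /=.
have [->|a0] := eqVneq a 0.
  by rewrite normr0 mul0r; apply: le_trans (c0_norm_ub _ 0).
rewrite mulrC -ler_pdivlMr ?normr_gt0// mulrC -normfV.
by apply: le_trans (le_ a^-1 (a *: u)); rewrite scalerA mulVf// scale1r.
Qed.

Lemma c0_norm_eq0 (u : c0) : c0_norm u = 0 -> u = 0.
Proof.
move=> u0; apply/val_inj/funext => k /=.
by apply/eqP; rewrite -normr_le0 (le_trans (c0_norm_ub u k))// u0.
Qed.

HB.instance Definition _ :=
  Lmodule_isNormed.Build R c0 c0_normD c0_normZ c0_norm_eq0.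

End c0.

Section complexification.
Context {R : realType}.
Variable X : normedModType R.

(* [Complexified x y] is x + iy. *)
Record complexification := Complexified { cre : X ; cim : X }.

HB.instance Definition _ := gen_eqMixin complexification.
HB.instance Definition _ := gen_choiceMixin complexification.

Implicit Types (z w : complexification) (a b : R[i]).

Definition cadd z w := Complexified (cre z + cre w) (cim z + cim w).
Definition copp z := Complexified (- cre z) (- cim z).

Lemma caddA : associative cadd.
Proof. by move=> z w v; rewrite /cadd /= !addrA. Qed.

Lemma caddC : commutative cadd.
Proof. by move=> z w; rewrite /cadd addrC [cim z + _]addrC. Qed.

Lemma cadd0 : left_id (Complexified 0 0) cadd.
Proof. by case=> x y; rewrite /cadd /= !add0r. Qed.

Lemma caddN : left_inverse (Complexified 0 0) copp cadd.
Proof. by move=> z; rewrite /cadd /= !addNr. Qed.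

HB.instance Definition _ :=
  GRing.isZmodule.Build complexification caddA caddC cadd0 caddN.

Definition cscale a z :=
  Complexified (complex.Re a *: cre z - complex.Im a *: cim z)
               (complex.Re a *: cim z + complex.Im a *: cre z).

Lemma cscaleA a b z : cscale a (cscale b z) = cscale (a * b) z.
Proof.
case: a b z => [ar ai] [br bi] [x y]; congr Complexified => /=.
  rewrite !(scalerBr, scalerDr, scalerBl, scalerDl, scalerA, opprD).
  by rewrite -!addrA; congr (_ + _); rewrite [RHS]addrC -addrA.
rewrite !(scalerBr, scalerDr, scalerBl, scalerDl, scalerA).
by rewrite -!addrA; congr (_ + _); rewrite [RHS]addrC -addrA.
Qed.

Lemma cscale1 : left_id 1 cscale.
Proof.
by case=> x y; congr Complexified => /=; rewrite scale1r scale0r ?subr0 ?addr0.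
Qed.

Lemma cscaleDr : right_distributive cscale +%R.
Proof.
move=> [ar ai] [x y] [x' y']; congr Complexified => /=; rewrite !scalerDr.
  by rewrite opprD addrACA.
by rewrite addrACA.
Qed.

Lemma cscaleDl z : {morph cscale^~ z : a b / a + b}.
Proof.
case: z => x y [ar ai] [br bi]; congr Complexified => /=; rewrite !scalerDl.
  by rewrite opprD addrACA.
by rewrite addrACA.
Qed.

HB.instance Definition _ := GRing.Zmodule_isLmodule.Build R[i] complexification
  cscaleA cscale1 cscaleDr cscaleDl.

Definition real_cnorm z : R :=
  sup [set `|cos t *: cre z + sin t *: cim z| | t in `[0, 2 * pi]].

Lemma circle_param (c s : R) : c ^+ 2 + s ^+ 2 = 1 ->
  exists2 t : R, t \in `[0, 2 * pi] & cos t = c /\ sin t = s.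
Proof.
move=> cs1; have c1 : -1 <= c <= 1.
  by rewrite -ler_norml -(@expr_le1 _ 2)// real_normK ?num_real// -cs1 lerDl sqr_ge0.
have [a0 api] := (acos_ge0 c1, acos_lepi c1).
have ca : cos (acos c) = c by rewrite acosK// in_itv.
have sa : sin (acos c) = `|s|.
  by rewrite sin_acos// -cs1 addrAC subrr add0r sqrtr_sqr.
have [s0|s0] := leP 0 s.
  exists (acos c); last by rewrite ca sa ger0_norm.
  by rewrite in_itv /= a0 (le_trans api)// ler_peMl ?pi_ge0// ler1n.
exists (2 * pi - acos c).
  rewrite in_itv /= lerBlDr lerDl a0 andbT subr_ge0 (le_trans api)//.
  by rewrite ler_peMl ?pi_ge0// ler1n.
by rewrite mulr_natl addrC cosD2pi sinD2pi cosN sinN ca sa ltr0_norm ?opprK.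
Qed.

Lemma real_cnorm_has_sup z :
  has_sup [set `|cos t *: cre z + sin t *: cim z| | t in `[0, 2 * pi]].
Proof.
split; first by exists `|cos 0 *: cre z + sin 0 *: cim z|, 0 => //=; rewrite in_itv /= lexx mulr_ge0// pi_ge0.
exists (`|cre z| + `|cim z|) => _ [t _ <-].
apply: le_trans (ler_normD _ _) _; rewrite !normrZ.
by apply: lerD; rewrite ler_piMl// ler_norml ?cos_geN1 ?cos_le1 ?sin_geN1 ?sin_le1.
Qed.

Lemma real_cnorm_ub z (c s : R) : c ^+ 2 + s ^+ 2 = 1 ->
  `|c *: cre z + s *: cim z| <= real_cnorm z.
Proof.
move=> /circle_param[t t2pi [<- <-]].
by apply: sup_upper_bound; [exact: real_cnorm_has_sup|exists t].
Qed.

Lemma real_cnorm_le z (M : R) :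
  (forall c s : R, c ^+ 2 + s ^+ 2 = 1 -> `|c *: cre z + s *: cim z| <= M) ->
  real_cnorm z <= M.
Proof.
move=> h; apply: ge_sup; first exact: (real_cnorm_has_sup z).1.
by move=> _ [t _ <-]; apply: h; rewrite cos2Dsin2.
Qed.

Definition cnorm z : R[i] := ((real_cnorm z)%:C)%C.

Lemma cnormD z w : cnorm (z + w) <= cnorm z + cnorm w.
Proof.
rewrite /cnorm -rmorphD lecR; apply: real_cnorm_le => c s cs1.
rewrite !scalerDr addrACA; apply: le_trans (ler_normD _ _) _.
by apply: lerD; exact: real_cnorm_ub.
Qed.

Lemma cnormZ a z : cnorm (a *: z) = `|a| * cnorm z.
Proof.
have le_ b v : cnorm (b *: v) <= `|b| * cnorm v.
  rewrite normc_def /cnorm -rmorphM lecR.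
  set r := Num.sqrt _.
  have r2 : r ^+ 2 = complex.Re b ^+ 2 + complex.Im b ^+ 2.
    by rewrite sqr_sqrtr// addr_ge0 ?sqr_ge0.
  have [b0|b0] := eqVneq b 0.
    apply: real_cnorm_le => c s _; rewrite b0 scale0r /= !scaler0 addr0 normr0.
    rewrite mulr_ge0 ?sqrtr_ge0//.
    have c01 : (1 : R) ^+ 2 + 0 ^+ 2 = 1 by rewrite expr1n expr0n addr0.
    exact: le_trans (real_cnorm_ub v c01).
  have r0 : 0 < r.
    rewrite lt_neqAle sqrtr_ge0 andbT eq_sym; apply: contra b0 => /eqP r0.
    move: r2; rewrite r0 expr0n /= => /esym/eqP.
    rewrite paddr_eq0 ?sqr_ge0// !sqrf_eq0 => /andP[/eqP h1 /eqP h2].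
    by apply/eqP; rewrite [b]complexE h1 h2 mulr0 addr0.
  apply: real_cnorm_le => c s cs1.
  have -> : c *: cre (b *: v) + s *: cim (b *: v) =
      r *: (((c * complex.Re b + s * complex.Im b) / r) *: cre v +
            ((s * complex.Re b - c * complex.Im b) / r) *: cim v).
    rewrite [RHS]scalerDr 2![in RHS]scalerA ![r * _]mulrC !divfK ?gt_eqF//=.
    rewrite !(scalerBr, scalerDr, scalerBl, scalerDl, scalerA).
    rewrite -!addrA; congr (_ + _).
    by rewrite addrC -addrA addrCA.
  rewrite normrZ gtr0_norm//; apply: ler_wpM2l; first exact: ltW.
  apply: real_cnorm_ub.
  rewrite !expr_div_n -mulrDl.
  rewrite (_ : _ ^+ 2 + _ ^+ 2 = (c ^+ 2 + s ^+ 2) * (r ^+ 2)); last first.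
    by rewrite r2; ring.
  by rewrite cs1 mul1r divff// expf_neq0// gt_eqF.
apply/eqP; rewrite eq_le le_ /=.
have [->|a0] := eqVneq a 0.
  rewrite normr0 mul0r /cnorm (_ : 0 = (0 : R)%:C%C)// lecR.
  have c01 : (1 : R) ^+ 2 + 0 ^+ 2 = 1 by rewrite expr1n expr0n addr0.
  exact: le_trans (real_cnorm_ub _ c01).
rewrite mulrC -ler_pdivlMr ?normr_gt0// mulrC -normfV.
by apply: le_trans (le_ a^-1 (a *: z)); rewrite scalerA mulVf// scale1r.
Qed.

Lemma cnorm0_eq0 z : cnorm z = 0 -> z = 0.
Proof.
move=> /(congr1 (@complex.Re R)) /= z0.
have c01 : (1 : R) ^+ 2 + 0 ^+ 2 = 1 by rewrite expr1n expr0n addr0.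
have := real_cnorm_ub z c01; have := @real_cnorm_ub z 0 1.
rewrite addrC => /(_ c01); rewrite z0 !scale1r !scale0r add0r addr0 !normr_le0.
by case: z {z0} => x y /= /eqP -> /eqP ->.
Qed.

HB.instance Definition _ := Lmodule_isNormed.Build R[i] complexification
  cnormD cnormZ cnorm0_eq0.

End complexification.

(* Main.v *)
(* Let 1/p = 1/2 + c.  For 0 < alpha < 1 split the basis of l_p into pieces on
   which one realizes, for every m, a block of k_m = m! independent symmetric
   variables v with values 1, -1, 0 and P(v <> 0) = s = k_m^(- alpha).  Normalized
   in l_p they give vectors x_{m,i}, normalized in the dual space functionals
   a_{m,i}, biorthogonal to each other.  Let (z_{m,i}) be the unit vectors of the
   copy of l_q or c_0, and T_alpha w = sum a_{m,i}(w) z_{m,i}.  The vectors x_{n,i}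
   satisfy an upper l_p-estimate and an upper l_2-estimate with constant
   k_n^(alpha c).  By a Rosenthal inequality the functionals of the blocks m >= n
   satisfy an upper estimate by the norm of l_p' plus k_n^(- alpha c) times the
   norm of l_2; when alpha is close to 1 this also gives an upper l_Q-estimate with
   Q > 2, whose dual exponent q0 = Q' satisfies q0 < q.

   The upper l_Q-estimate makes the sequence (a_v(w)) lie in l_q0 with q0 < min(2, q)
   for all w, so T_alpha is dominated: |T_alpha w| <= e |w| + D sup_v |a_v(w)|, with
   square-summable a_v, up to small perturbations.  A subspace of large dimension
   contains flat vectors for a square-summable family, hence dominated operators are
   finitely strictly singular.  The same estimate holds for the bidual of T_alpha, so
   that the adjoint of T_alpha is superstrictly cosingular.

   Let f_{n,i} be bounded functionals with f_{n,i}(z_{n,i}) = 1, and consider the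
   averages k_n^(-1) sum_i |f_{n,i}(S x_{n,i})|, where x is built from alpha.  They
   are equal to 1 for S = T_alpha.  If alpha < alpha' and S = B T_alpha' A, they
   tend to 0: by domination it suffices to bound sum_i |a'_{j(i)}(A x_{n,i})| for
   arbitrary maps j.  Indices sharing the same j(i) are handled by the l_p-estimate
   of the x_{n,i} if they are many; the other ones with j(i) in a block m < n are
   few; for the rest, signs turn the diagonal sum into the pairing of a functional
   and a vector satisfying the estimates above, which is of order
   k_n^(1 - c (alpha' - alpha)) + k_n^(1 - c (1 - alpha)).  Hence the dominated
   operators S such that the averages of B S A tend to 0 for all A, B and all
   exponents up to alpha form a closed ideal, strictly decreasing in alpha.

   For complex scalars all these systems are extended from X to X + iX. *)

Require Import Defs.
From HB Require Import structures.
From mathcomp Require Import all_boot all_order all_algebra.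
From mathcomp Require Import complex ring lra.
From mathcomp Require Import all_classical all_reals all_analysis.

Set Implicit Arguments.
Unset Strict Implicit.
Unset Printing Implicit Defensive.

Import Order.TTheory GRing.Theory Num.Theory.
Import numFieldNormedType.Exports.

Local Open Scope classical_set_scope.
Local Open Scope ring_scope.

(** * Powers and p-norms *)

Section powers.
Context {R : realType}.
Implicit Types (x y t a b p q : R).

Lemma le_powR p x y : 0 <= p -> 0 <= x -> x <= y -> x `^ p <= y `^ p.
Proof.
move=> p0 x0 xy; apply: ge0_ler_powR => //; rewrite nnegrE//.
exact: le_trans xy.
Qed.

Lemma powRVK p x : p != 0 -> 0 <= x -> (x `^ p^-1) `^ p = x.
Proof. by move=> p0 x0; rewrite -powRrM mulVf// powRr1. Qed.

Lemma powRKV p x : p != 0 -> 0 <= x -> (x `^ p) `^ p^-1 = x.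
Proof. by move=> p0 x0; rewrite -powRrM mulfV// powRr1. Qed.

Lemma powR_le_swap p x y : 0 < p -> 0 <= x -> 0 <= y ->
  x `^ p <= y `^ p -> x <= y.
Proof.
move=> p0 x0 y0 h; rewrite -(powRKV (lt0r_neq0 p0) x0) -(powRKV (lt0r_neq0 p0) y0).
by apply: le_powR; rewrite ?invr_ge0 ?powR_ge0// ltW.
Qed.

Lemma powRDE x p q : 0 <= x -> 0 < p + q -> x `^ (p + q) = x `^ p * x `^ q.
Proof. by move=> x0 pq; rewrite powRD// gt_eqF. Qed.

Lemma powRBE x p q : 0 <= x -> 0 < p -> x `^ p = x `^ (p - q) * x `^ q.
Proof. by move=> x0 p0; rewrite -powRDE// subrK. Qed.

Lemma powR_div x y p : 0 <= x -> 0 <= y -> (x / y) `^ p = x `^ p / y `^ p.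
Proof.
move=> x0 y0; rewrite powRM ?invr_ge0//; congr (_ * _).
by rewrite -[y^-1]powR_inv1// -powRrM mulN1r powRN.
Qed.

Lemma powR2 x : 0 <= x -> x `^ 2 = x ^+ 2.
Proof. by move=> x0; rewrite -powR_mulrn. Qed.

Lemma powR_normr x : `|x| `^ 2 = x ^+ 2.
Proof. by rewrite powR2// real_normK// num_real. Qed.

(** The first term suffices for [x <= t], the second for [x > t]. With [t] of the typical size of
    [x], one moment is traded for another. *)
Lemma powR_split p q x t : 0 <= p -> p <= q -> 0 <= x -> 0 < t ->
  x `^ p <= t `^ p + t `^ (p - q) * x `^ q.
Proof.
move=> p0 pq x0 t0; have [xt|tx] := leP x t.
  by apply: le_trans (le_powR p0 x0 xt) _; rewrite lerDl mulr_ge0 ?powR_ge0.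
have x1 : 0 < x by exact: lt_trans tx.
apply: (@le_trans _ _ (t `^ (p - q) * x `^ q)); last by rewrite lerDr powR_ge0.
have -> : x `^ p = x `^ (p - q) * x `^ q.
  by rewrite -powRD ?subrK// (gt_eqF x1) implybT.
apply: ler_wpM2r; first exact: powR_ge0.
rewrite -(opprB q p) !powRN lef_pV2 ?posrE ?powR_gt0//.
by apply: le_powR; rewrite ?subr_ge0 ?(ltW t0) ?(ltW tx).
Qed.

(** The fractions x/(x+y) and y/(x+y) lie in [0,1], hence are at most their p-th powers, and they
    add up to 1. *)
Lemma ger0_powRD_sub p x y : 0 <= p -> p <= 1 -> 0 <= x -> 0 <= y ->
  (x + y) `^ p <= x `^ p + y `^ p.
Proof.
move=> p0 p1 x0 y0.
have [xy0|xy0] := eqVneq (x + y) 0.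
  have -> : x = 0 by lra.
  have -> : y = 0 by lra.
  by rewrite addr0 lerDl powR_ge0.
have S0 : 0 < x + y by rewrite lt_neqAle eq_sym xy0 addr_ge0.
have E z : 0 <= z -> z <= x + y -> (x + y) `^ p * (z / (x + y)) <= z `^ p.
  move=> z0 zS; have [->|zn] := eqVneq z 0; first by rewrite mul0r mulr0 powR_ge0.
  have zp : 0 < z by rewrite lt_neqAle eq_sym zn.
  have -> : z `^ p = (x + y) `^ p * (z / (x + y)) `^ p.
    by rewrite -powRM// ?divr_ge0 ?(ltW S0)// mulrCA divff// mulr1.
  apply: ler_wpM2l; first exact: powR_ge0.
  by apply: ger1_powR => //; rewrite divr_gt0//= ler_pdivrMr// mul1r.
apply: le_trans (lerD (E x x0 _) (E y y0 _)); rewrite ?lerDl ?lerDr//.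
by rewrite -mulrDr -mulrDl divff// mulr1.
Qed.

End powers.

(* Locked: unfolding [powR] makes unification very slow. *)
HB.lock Definition lnorm {R : realType} {I : eqType} (p : R) (r : seq I)
    (u : I -> R) : R :=
  (\sum_(i <- r) `|u i| `^ p) `^ p^-1.

Section lnorm.
Context {R : realType} {I : eqType}.
Implicit Types (p q e t A D : R) (r : seq I) (u v c : I -> R).

Lemma lnormE p r u : lnorm p r u = (\sum_(i <- r) `|u i| `^ p) `^ p^-1.
Proof. by rewrite lnorm.unlock. Qed.

Lemma sum_powR_ge0 p r u : 0 <= \sum_(i <- r) `|u i| `^ p.
Proof. by apply: sumr_ge0 => i _; exact: powR_ge0. Qed.

Lemma lnorm_ge0 p r u : 0 <= lnorm p r u.
Proof. by rewrite lnormE powR_ge0. Qed.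

Lemma lnorm_powR p r u : 0 < p -> lnorm p r u `^ p = \sum_(i <- r) `|u i| `^ p.
Proof. by move=> p0; rewrite lnormE powRVK ?sum_powR_ge0// gt_eqF. Qed.

Lemma lnorm_ub p r u i : 0 < p -> i \in r -> `|u i| <= lnorm p r u.
Proof.
move=> p0 ir; apply: (powR_le_swap p0) => //; first exact: lnorm_ge0.
rewrite lnorm_powR// (perm_big _ (perm_to_rem ir)) /= big_cons lerDl.
by apply: sumr_ge0 => j _; exact: powR_ge0.
Qed.

Lemma lnorm_le_powR p r u t : 0 < p -> 0 <= t ->
  \sum_(i <- r) `|u i| `^ p <= t `^ p -> lnorm p r u <= t.
Proof.
move=> p0 t0 h; apply: (powR_le_swap p0) => //; first exact: lnorm_ge0.
by rewrite lnorm_powR.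
Qed.

Lemma lnorm_anti p q r u : 0 < p -> p <= q -> lnorm q r u <= lnorm p r u.
Proof.
move=> p0 pq; have q0 : 0 < q by exact: lt_le_trans pq.
apply: lnorm_le_powR => //; first exact: lnorm_ge0.
have -> : lnorm p r u `^ q = \sum_(i <- r) (`|u i| `^ p * lnorm p r u `^ (q - p)).
  rewrite -mulr_suml -(lnorm_powR _ _ p0) mulrC -powRBE//; exact: lnorm_ge0.
rewrite big_seq [leRHS]big_seq; apply: ler_sum => i ir.
rewrite (@powRBE _ _ q p)// mulrC; apply: ler_wpM2l; first exact: powR_ge0.
by apply: le_powR; rewrite ?subr_ge0//; exact: lnorm_ub.
Qed.

Lemma lnorm_eq0 p r u i : 0 < p -> lnorm p r u = 0 -> i \in r -> u i = 0.
Proof.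
move=> p0 h ir; apply/eqP; rewrite -normr_le0 -h; exact: lnorm_ub.
Qed.

(** Young's inequality [conjugate_powR] is summed over the two families after normalizing them to
    norm 1. *)
Lemma lnorm_hoelder p q r u v : 0 < p -> 0 < q -> p^-1 + q^-1 = 1 ->
  \sum_(i <- r) `|u i| * `|v i| <= lnorm p r u * lnorm q r v.
Proof.
move=> p0 q0 pq.
have [U0|U0] := eqVneq (lnorm p r u) 0.
  rewrite U0 mul0r big_seq big1// => i ir.
  by rewrite (lnorm_eq0 p0 U0 ir) normr0 mul0r.
have [V0|V0] := eqVneq (lnorm q r v) 0.
  rewrite V0 mulr0 big_seq big1// => i ir.
  by rewrite (lnorm_eq0 q0 V0 ir) normr0 mulr0.
have U1 : 0 < lnorm p r u by rewrite lt_neqAle eq_sym U0 lnorm_ge0.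
have V1 : 0 < lnorm q r v by rewrite lt_neqAle eq_sym V0 lnorm_ge0.
have unit (s : R) (w : I -> R) : 0 < s -> 0 < lnorm s r w ->
    \sum_(i <- r) (`|w i| / lnorm s r w) `^ s = 1.
  move=> s0 w0; transitivity (\sum_(i <- r) `|w i| `^ s / lnorm s r w `^ s).
    by apply: eq_bigr => i _; rewrite powR_div ?lnorm_ge0.
  by rewrite -mulr_suml -lnorm_powR// divff// gt_eqF// powR_gt0.
have uU := unit p u p0 U1; have uV := unit q v q0 V1.
move: uU uV U0 V0 U1 V1; move: (lnorm p r u) (lnorm q r v) => U V {unit} uU uV U0 V0 U1 V1.
have -> : \sum_(i <- r) `|u i| * `|v i| =
    U * V * \sum_(i <- r) (`|u i| / U) * (`|v i| / V).
  rewrite mulr_sumr; apply: eq_bigr => i _.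
  by field; rewrite U0 V0.
rewrite -[X in _ <= X]mulr1.
apply: ler_wpM2l; first by rewrite mulr_ge0// ltW.
have le1 : \sum_(i <- r) (`|u i| / U) * (`|v i| / V) <= \sum_(i <- r)
    ((`|u i| / U) `^ p / p + (`|v i| / V) `^ q / q).
  by apply: ler_sum => i _; apply: conjugate_powR => //; rewrite divr_ge0// ltW.
by apply: le_trans le1 _; rewrite big_split /= -!mulr_suml uU uV !mul1r pq.
Qed.

Lemma sqr_lnorm2 r u : lnorm 2 r u ^+ 2 = \sum_(i <- r) u i ^+ 2.
Proof.
rewrite -powR2 ?lnorm_ge0// lnorm_powR//.
by apply: eq_bigr => i _; rewrite powR_normr.
Qed.

(** [powR_split] is used at the modulus [t] of a constant family with the same q-norm. Each of its
    two terms then contributes at most n t^2, which explains the non-sharp factor 2. *)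
Lemma lnorm2_le q r u : 2 <= q ->
  lnorm 2 r u <= 2 * (size r)%:R `^ (2^-1 - q^-1) * lnorm q r u.
Proof.
move=> q2; have q0 : 0 < q by lra.
have [L0|L0] := eqVneq (lnorm q r u) 0.
  rewrite L0 mulr0 lnormE big_seq big1 ?powR0// ?invr_eq0// => i ir.
  by rewrite (lnorm_eq0 q0 L0 ir) normr0 powR0.
have L1 : 0 < lnorm q r u by rewrite lt_neqAle eq_sym L0 lnorm_ge0.
have r0 : 0 < (size r)%:R :> R.
  rewrite ltr0n lt0n; apply/eqP => /size0nil r0; case/eqP: L0.
  by rewrite r0 lnormE big_nil powR0// invr_eq0 gt_eqF.
set L := lnorm q r u in L0 L1 *; set n : R := (size r)%:R in r0 *.
pose t := L * n `^ (- q^-1); have t0 : 0 < t := mulr_gt0 L1 (powR_gt0 _ r0).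
apply: lnorm_le_powR; rewrite ?mulr_ge0 ?powR_ge0 ?(ltW L1)//.
have gh : (n `^ (2^-1 - q^-1)) ^+ 2 = n * (n `^ (- q^-1)) ^+ 2.
  rewrite powRD ?(gt_eqF r0) ?implybT// exprMn -[(n `^ 2^-1) ^+ 2]powR2 ?powR_ge0//.
  by rewrite powRVK ?(ltW r0).
have -> : (2 * n `^ (2^-1 - q^-1) * L) `^ 2 = 4 * (n * t ^+ 2).
  rewrite powR2 ?mulr_ge0 ?powR_ge0 ?(ltW L1)// !exprMn gh /t; ring.
have -> : 4 * (n * t ^+ 2) = n * t ^+ 2 + n * t ^+ 2 + 2 * (n * t ^+ 2) by ring.
have nt : 0 <= n * t ^+ 2 by rewrite mulr_ge0 ?(ltW r0)// sqr_ge0.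
apply: (@le_trans _ _ (n * t ^+ 2 + n * t ^+ 2)); last by rewrite lerDl mulr_ge0.
apply: (@le_trans _ _ (\sum_(i <- r) (t `^ 2 + t `^ (2 - q) * `|u i| `^ q))).
  by apply: ler_sum => i _; apply: powR_split.
rewrite big_split /= -mulr_sumr -lnorm_powR// -/L big_const_seq count_predT iter_addr_0.
rewrite -[t `^ 2 *+ size r]mulr_natl -/n powR2 ?(ltW t0)// lerD2l.
have -> : L `^ q = t `^ q * n.
  rewrite powRM ?powR_ge0 ?(ltW L1)// -powRrM mulNr mulVf ?gt_eqF//.
  by rewrite powRN powRr1 ?(ltW r0)// divfK// gt_eqF.
by rewrite mulrA -powRD ?subrK ?(gt_eqF t0) ?implybT// powR2 ?(ltW t0)// mulrC.
Qed.

(** The hypothesis is tested on the extremal family of Hoelder's inequality, with entries sg(u_i)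
    |u_i|^(q-1), and divided by the (q-1)-st power of the norm. *)
Lemma lnorm_dual p q r u D : 0 < p -> 1 < q -> p^-1 + q^-1 = 1 -> 0 <= D ->
  (forall c, \sum_(i <- r) c i * u i <= D * lnorm p r c) -> lnorm q r u <= D.
Proof.
move=> p0 q1 pq D0 h; have q0 : 0 < q by lra.
pose c i := Num.sg (u i) * `|u i| `^ (q - 1).
have L0 := lnorm_ge0 q r u.
have qp : (q - 1) * p = q.
  by have -> : q - 1 = q * p^-1; [rewrite -[p^-1](addrK q^-1) pq; field; lra|field; lra].
have cL : lnorm p r c <= lnorm q r u `^ (q - 1).
  apply: lnorm_le_powR => //; first exact: powR_ge0.
  rewrite -powRrM qp lnorm_powR//; apply: ler_sum => i _.
  have -> : `|u i| `^ q = (`|u i| `^ (q - 1)) `^ p by rewrite -powRrM qp.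
  apply: le_powR => //; first exact: ltW.
  rewrite normrM [`|_ `^ _|]ger0_norm ?powR_ge0// ler_piMl ?powR_ge0//.
  by rewrite normr_sg; case: (_ != 0).
have := h c.
have -> : \sum_(i <- r) c i * u i = lnorm q r u * lnorm q r u `^ (q - 1).
  rewrite mulr_powRB1// lnorm_powR//; apply: eq_bigr => i _; rewrite /c.
  rewrite -(@mulr_powRB1 _ `|u i| q)//; set w := _ `^ _.
  by rewrite [in RHS]normrEsg; ring.
move=> hL; have [->//|Ln0] := eqVneq (lnorm q r u) 0.
have L1 : 0 < lnorm q r u by rewrite lt_neqAle eq_sym Ln0.
rewrite -(ler_pM2r (powR_gt0 (q - 1) L1)); apply: le_trans hL _.
exact: ler_wpM2l.
Qed.

(* Splitting according to whether [t] is small compared with [A]. *)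
Lemma lnorm_interpolate p q (e : R) : 0 < p -> p < q -> 0 < e ->
  exists2 C : R, 0 <= C & forall r u A t, lnorm p r u <= A -> 0 <= t ->
    (forall i, i \in r -> `|u i| <= t) -> lnorm q r u <= e * A + C * t.
Proof.
move=> p0 pq e0; have q0 : 0 < q by lra.
have d0 : 0 < q - p by lra.
(* Chosen so that h^(q-p) = e^q. If t <= h A, then (h A)^(q-p) A^p = (e A)^q; otherwise A < t/h. *)
pose h := e `^ (q / (q - p)); have h0 : 0 < h := powR_gt0 _ e0.
exists h^-1; first by rewrite invr_ge0 ltW.
move=> r u A t uA t0 ut.
have A0 : 0 <= A := le_trans (lnorm_ge0 _ _ _) uA.
have [tA|At] := leP t (h * A); last first.
  apply: le_trans (lnorm_anti _ _ p0 (ltW pq)) _; apply: le_trans uA _.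
  apply: (@le_trans _ _ (h^-1 * t)); first by rewrite ler_pdivlMl// ltW.
  by rewrite lerDr mulr_ge0// ltW.
apply: (@le_trans _ _ (e * A)); last by rewrite lerDl mulr_ge0// invr_ge0 ltW.
apply: lnorm_le_powR => //; first by rewrite mulr_ge0// ltW.
have -> : (e * A) `^ q = (h * A) `^ (q - p) * A `^ p.
  rewrite !powRM ?(ltW e0) ?(ltW h0)// -mulrA -powRDE ?subrK//.
  by rewrite /h -powRrM divfK ?gt_eqF.
apply: (@le_trans _ _ (\sum_(i <- r) (h * A) `^ (q - p) * `|u i| `^ p)).
  rewrite big_seq [leRHS]big_seq; apply: ler_sum => i ir.
  rewrite (@powRBE _ _ q p)//; apply: ler_wpM2r; first exact: powR_ge0.
  by apply: le_powR; rewrite ?(ltW d0)//; apply: le_trans (ut _ ir) tA.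
rewrite -mulr_sumr; apply: ler_wpM2l; first exact: powR_ge0.
rewrite -lnorm_powR//; apply: le_powR => //; [exact: ltW|exact: lnorm_ge0].
Qed.

End lnorm.

(** * A Rosenthal inequality for sparse signs *)

Section parallelogram.
Context {R : realType}.

(** The terms linear in [y] cancel and leave a second-order remainder. If |y| <= |x|, homogeneity
    reduces the claim to (1+t)^p + (1-t)^p <= 2 + C t^2 for t in [0,1]; if |y| > |x|, both |x+y| and
    |x-y| are at most 2|y|. *)
Lemma powR_parallelogram (p : R) : 2 <= p -> exists2 C : R, 0 <= C & forall x y : R,
  `|x + y| `^ p + `|x - y| `^ p <=
  2 * `|x| `^ p + C * (`|x| `^ (p - 2) * y ^+ 2 + `|y| `^ p).
Proof.
move=> p2; have p0 : 0 < p by lra.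
(* With z = e^(y/2), the left side minus 2 is (z - 1/z)^2, and z - 1/z <= z y follows from 1 - y <=
   e^(-y). *)
have cosh_le (y : R) : 0 <= y -> expR y + expR (- y) <= 2 + y ^+ 2 * expR y.
  move=> y0; pose z := expR (y / 2); have z0 : z != 0 by rewrite gt_eqF// expR_gt0.
  have zE : expR y = z ^+ 2 by rewrite expr2 -expRD -splitr.
  have : z - z^-1 <= z * y.
    have : 1 - y <= expR (- y) by exact: expR_ge1Dx.
    rewrite expRN zE => h; have := ler_wpM2l (expR_ge0 (y / 2)) h; rewrite -/z.
    rewrite expr2 invfM mulVKf// mulrBr mulr1; lra.
  have zi : 0 <= z - z^-1.
    by rewrite subr_ge0 -expRN ler_expR; lra.
  move=> h; have := ler_pM zi zi h h.
  rewrite expRN zE.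
  have -> : (z - z^-1) * (z - z^-1) = z ^+ 2 + (z ^+ 2)^-1 - 2 by field.
  have -> : z * y * (z * y) = y ^+ 2 * z ^+ 2 by ring.
  by lra.
exists (p ^+ 2 * expR p + 2 * 2 `^ p).
  apply: addr_ge0; apply: mulr_ge0; rewrite ?sqr_ge0 ?expR_ge0 ?powR_ge0//.
have key (x y : R) : 0 <= y -> y <= x -> (x + y) `^ p + (x - y) `^ p <=
    2 * x `^ p + p ^+ 2 * expR p * (x `^ (p - 2) * y ^+ 2).
  move=> y0 yx; have [x0|xn] := eqVneq x 0.
    have -> : y = 0 by lra.
    by rewrite x0 addr0 subr0 powR0 ?gt_eqF// expr0n !mulr0 addr0.
  have x0 : 0 < x by lra.
  pose t := y / x; have yE : y = x * t by rewrite mulrC divfK.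
  have t0 : 0 <= t by rewrite divr_ge0// ltW.
  have t1 : t <= 1 by rewrite ler_pdivrMr// mul1r.
  have -> : x + y = x * (1 + t) by rewrite mulrDr mulr1 -yE.
  have -> : x - y = x * (1 - t) by rewrite mulrBr mulr1 -yE.
  have -> : x `^ (p - 2) * y ^+ 2 = x `^ p * t ^+ 2.
    rewrite yE exprMn mulrA -(powR2 (ltW x0)) -powRD ?subrK//.
    by rewrite xn implybT.
  rewrite !powRM ?(ltW x0)//; [|lra|lra].
  have e1 : (1 + t) `^ p <= expR (t * p).
    by rewrite expRM; apply: le_powR; rewrite ?expR_ge1Dx//; lra.
  have e2 : (1 - t) `^ p <= expR (- (t * p)).
    by rewrite -[- (t * p)]mulNr expRM; apply: le_powR; rewrite ?expR_ge1Dx//; lra.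
  have tp0 : 0 <= t * p by rewrite mulr_ge0// ltW.
  have e3 := cosh_le _ tp0.
  have e4 : (t * p) ^+ 2 * expR (t * p) <= (t * p) ^+ 2 * expR p.
    by apply: ler_wpM2l; rewrite ?sqr_ge0// ler_expR ler_piMl// ltW.
  have : x `^ p * ((1 + t) `^ p + (1 - t) `^ p) <=
      x `^ p * (2 + (t * p) ^+ 2 * expR p).
    by apply: ler_wpM2l; rewrite ?powR_ge0//; lra.
  by rewrite exprMn; lra.
move=> x y; have x0 := normr_ge0 x; have y0 := normr_ge0 y.
have N0 : 0 <= `|x| `^ (p - 2) * y ^+ 2 by rewrite mulr_ge0 ?powR_ge0 ?sqr_ge0.
have [yx|xy] := leP `|y| `|x|.
  have -> : `|x + y| `^ p + `|x - y| `^ p =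
      (`|x| + `|y|) `^ p + (`|x| - `|y|) `^ p.
    have [xp|xn] := leP 0 x; have [yp|yn] := leP 0 y;
      rewrite ?(ger0_norm xp) ?(ltr0_norm xn) ?(ger0_norm yp) ?(ltr0_norm yn) in yx *.
    - by rewrite !ger0_norm//; lra.
    - by rewrite !ger0_norm ?opprK 1?addrC//; lra.
    - rewrite ler0_norm ?[`|x - y|]ler0_norm; [|lra|lra].
      by rewrite addrC; congr (_ `^ _ + _ `^ _); ring.
    - rewrite ler0_norm ?[`|x - y|]ler0_norm; [|lra|lra].
      by congr (_ `^ _ + _ `^ _); ring.
  apply: le_trans (key _ _ y0 yx) _; rewrite real_normK ?num_real//.
  rewrite lerD2l; apply: ler_pM.
  - by rewrite mulr_ge0 ?sqr_ge0 ?expR_ge0.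
  - exact: N0.
  - by rewrite lerDl mulr_ge0 ?powR_ge0.
  - by rewrite lerDl powR_ge0.
have le2 (z : R) : `|z| <= 2 * `|y| -> `|z| `^ p <= 2 `^ p * `|y| `^ p.
  by move=> h; rewrite -powRM//; apply: le_powR => //; exact: ltW.
have t1 : `|x + y| <= 2 * `|y| by have := ler_normD x y; lra.
have t2 : `|x - y| <= 2 * `|y| by have := ler_normB x y; lra.
have h1 := le2 _ t1; have h2 := le2 _ t2.
have Px : 0 <= `|x| `^ p := powR_ge0 _ _.
have Py : 0 <= `|y| `^ p := powR_ge0 _ _.
have h3 : 2 * 2 `^ p * `|y| `^ p <= (p ^+ 2 * expR p + 2 * 2 `^ p) *
    (`|x| `^ (p - 2) * y ^+ 2 + `|y| `^ p).
  apply: ler_pM; rewrite ?mulr_ge0 ?powR_ge0//; first by rewrite lerDr mulr_ge0 ?sqr_ge0 ?expR_ge0.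
  by rewrite lerDr.
by lra.
Qed.

End parallelogram.

Section sparse_signs.
Context {R : realType}.
Variable s : R.
Hypotheses (s0 : 0 < s) (s1 : s <= 1).
Implicit Types (k : nat) (v a b : nat -> R) (F G : (nat -> R) -> R).

Definition upd v k (x : R) : nat -> R := fun i => if i == k then x else v i.

(* The law of [k] independent variables with values [1], [-1], [0] of
   probabilities [s/2], [s/2], [1 - s], as a list of weighted points. *)
Fixpoint points k : seq (R * (nat -> R)) :=
  if k is k'.+1 then flatten [seq [:: ((1 - s) * w.1, upd w.2 k' 0);
    (s / 2 * w.1, upd w.2 k' 1); (s / 2 * w.1, upd w.2 k' (- 1))]
    | w <- points k'] else [:: (1, fun=> 0)].

Definition mean k F : R := \sum_(w <- points k) w.1 * F w.2.

Definition lin k b v : R := \sum_(i < k) b i * v i.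

Lemma mean0 F : mean 0 F = F (fun=> 0).
Proof. by rewrite /mean /= big_seq1 mul1r. Qed.

(** Conditioning on the first [k] variables; the moment estimates below are inductions based on this
    recursion. *)
Lemma meanS k F : mean k.+1 F = mean k (fun v =>
  (1 - s) * F (upd v k 0) + s / 2 * (F (upd v k 1) + F (upd v k (- 1)))).
Proof.
rewrite /mean /= big_flatten big_map; apply: eq_bigr => w _ /=.
by rewrite !big_cons big_nil /=; ring.
Qed.

Lemma lin_upd k b v x : lin k.+1 b (upd v k x) = lin k b v + b k * x.
Proof.
rewrite /lin big_ord_recr /= /upd eqxx; congr (_ + _).
by apply: eq_bigr => i _; rewrite ltn_eqF.
Qed.

Lemma points_ge0 k w : List.In w (points k) -> 0 <= w.1.
Proof.
elim: k w => [|k IH] w /=; first by case=> // <-.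
elim: (points k) IH => //= w' l IHl IH.
have w'0 : 0 <= w'.1 by apply: IH; left.
have s2 : 0 <= s / 2 by rewrite divr_ge0// ltW.
case=> [<-|[<-|[<-|h]]] /=; rewrite ?mulr_ge0 ?subr_ge0 ?(ltW s0)//.
by apply: IHl => // x hx; apply: IH; right.
Qed.

Lemma le_mean k F G : (forall v, F v <= G v) -> mean k F <= mean k G.
Proof.
rewrite /mean => h; elim: (points k) (@points_ge0 k) => [|w l IH] l0.
  by rewrite !big_nil.
rewrite !big_cons; apply: lerD.
  by apply: ler_wpM2l => //; apply: l0; left.
by apply: IH => x hx; apply: l0; right.
Qed.

Lemma eq_mean k F G : (forall v, F v = G v) -> mean k F = mean k G.
Proof. by move=> h; apply: eq_bigr => w _; rewrite h. Qed.

Lemma meanD k F G : mean k (fun v => F v + G v) = mean k F + mean k G.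
Proof. by rewrite /mean -big_split; apply: eq_bigr => w _; rewrite mulrDr. Qed.

Lemma meanZ k c F : mean k (fun v => c * F v) = c * mean k F.
Proof. by rewrite /mean mulr_sumr; apply: eq_bigr => w _; rewrite mulrCA. Qed.

Lemma mean_cst k c : mean k (fun=> c) = c.
Proof.
elim: k => [|k IH]; first by rewrite mean0.
rewrite meanS -[RHS]IH; apply: eq_mean => v.
by field.
Qed.

Lemma mean_ge0 k F : (forall v, 0 <= F v) -> 0 <= mean k F.
Proof. by move=> F0; rewrite -(mean_cst k 0); exact: le_mean. Qed.

Lemma mean_lin2 k a b : mean k (fun v => lin k a v * lin k b v) =
  s * \sum_(i < k) a i * b i.
Proof.
elim: k => [|k IH]; first by rewrite mean0 /lin !big_ord0 !mulr0.
rewrite meanS; under eq_mean => v.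
  rewrite !lin_upd.
  rewrite (_ : _ + _ = lin k a v * lin k b v + s * (a k * b k)); last by field.
  over.
by rewrite meanD mean_cst IH big_ord_recr /= mulrDr.
Qed.

(** Induction on the variables by the two-point inequality [step]: Hoelder with exponent 2/p leads
    to the parallelogram identity, and t^(p/2) is subadditive. A new variable is nonzero only with
    probability [s]. *)
Lemma mean_powR_le (p : R) k b : 0 < p -> p < 2 ->
  mean k (fun v => `|lin k b v| `^ p) <= s * \sum_(i < k) `|b i| `^ p.
Proof.
move=> p0 p2; have h2 : 0 < 2 / p by rewrite divr_gt0.
have h0 : 0 < (1 - p / 2)^-1 by rewrite invr_gt0; lra.
have sqrE (x : R) : (x ^+ 2) `^ (p / 2) = `|x| `^ p.
  by rewrite -powR_normr -powRrM mulrC divfK.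
have step (x y : R) : `|x + y| `^ p + `|x - y| `^ p <= 2 * (`|x| `^ p + `|y| `^ p).
  have /= := @hoelder2 R (`|x + y| `^ p) (`|x - y| `^ p) 1 1 _ _
    (powR_ge0 _ _) (powR_ge0 _ _) ler01 ler01 h2 h0.
  rewrite invrK invf_div [_ + (1 - _)]addrC subrK => /(_ erefl).
  have e2 : p * (2 / p) = 2 by rewrite mulrC divfK// gt_eqF.
  rewrite !mulr1 -!powRrM e2 !powR_normr !powR1.
  have -> : (x + y) ^+ 2 + (x - y) ^+ 2 = 2 * (x ^+ 2 + y ^+ 2) by ring.
  move=> /le_trans; apply; rewrite powRM ?addr_ge0 ?sqr_ge0//.
  rewrite mulrAC -powRD ?pnatr_eq0 ?implybT// [_ + (1 - _)]addrC subrK powRr1//.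
  apply: ler_wpM2l => //; rewrite -!sqrE; apply: ger0_powRD_sub; rewrite ?sqr_ge0//; lra.
elim: k => [|k IH].
  by rewrite mean0 /lin !big_ord0 normr0 powR0 ?gt_eqF// mulr0.
rewrite meanS big_ord_recr /= mulrDr.
apply: (@le_trans _ _ (mean k (fun v => `|lin k b v| `^ p + s * `|b k| `^ p))).
  apply: le_mean => v; rewrite !lin_upd mulr0 addr0 mulr1 mulrN1.
  have : s / 2 * (`|lin k b v + b k| `^ p + `|lin k b v - b k| `^ p) <=
      s / 2 * (2 * (`|lin k b v| `^ p + `|b k| `^ p)).
    by apply: ler_wpM2l; rewrite ?divr_ge0 ?(ltW s0).
  by lra.
by rewrite meanD mean_cst lerD2r.
Qed.

(** Splitting at the standard deviation [l] by [powR_split] reduces the p-th moment to the second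
    one. *)
Lemma mean_powR_le2 (p : R) k b : 0 < p -> p < 2 ->
  mean k (fun v => `|lin k b v| `^ p) <=
  2 * (s * \sum_(i < k) b i ^+ 2) `^ (p / 2).
Proof.
move=> p0 p2; set V := s * _.
have V0 : 0 <= V by rewrite mulr_ge0 ?(ltW s0)// sumr_ge0// => i _; rewrite sqr_ge0.
have [Vz|Vn] := eqVneq V 0.
  apply: (@le_trans _ _ 0); last by rewrite mulr_ge0 ?powR_ge0.
  rewrite -(mean_cst k 0); apply: le_mean => v; rewrite /lin big1 ?normr0 ?powR0 ?gt_eqF//.
  move=> i _; move/eqP: Vz; rewrite mulf_eq0 gt_eqF//= psumr_eq0//; last first.
    by move=> j _; rewrite sqr_ge0.
  by move=> /allP /(_ i (mem_index_enum _)) /=; rewrite sqrf_eq0 => /eqP ->; rewrite mul0r.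
have V1 : 0 < V by rewrite lt_neqAle eq_sym Vn.
pose l := V `^ 2^-1; have l0 : 0 < l := powR_gt0 _ V1.
apply: (@le_trans _ _ (mean k (fun v => l `^ p + l `^ (p - 2) * (lin k b v * lin k b v)))).
  apply: le_mean => v; rewrite -expr2 -powR_normr.
  by apply: powR_split => //; exact: ltW.
rewrite meanD mean_cst meanZ mean_lin2.
under eq_bigr do rewrite -expr2.
rewrite -/V /l -!powRrM ![2^-1 * _]mulrC mulrBl divff//.
rewrite -{3}(powRr1 V0) -powRD ?Vn ?implybT// subrK.
by rewrite mulr_natl mulr2n.
Qed.

(** Averaging [hC] over the sign of the j-th variable bounds the new moment by (1 + C tau_j) M + C
    B_j, where M is the old one. Iterating this yields a product of factors 1 + C tau_j, which is at
    most e^C. *)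
Lemma mean_powR_rosenthal (p C : R) k b : 2 <= p -> 0 <= C ->
  (forall x y : R, `|x + y| `^ p + `|x - y| `^ p <=
    2 * `|x| `^ p + C * (`|x| `^ (p - 2) * y ^+ 2 + `|y| `^ p)) ->
  mean k (fun v => `|lin k b v| `^ p) <= expR C * C *
    ((s * \sum_(i < k) b i ^+ 2) `^ (p / 2) + s * \sum_(i < k) `|b i| `^ p).
Proof.
move=> p2 C0 hC; have p0 : 0 < p by lra.
set V := s * _.
have V0 : 0 <= V by rewrite mulr_ge0 ?(ltW s0)// sumr_ge0// => i _; rewrite sqr_ge0.
have [Vz|Vn] := eqVneq V 0.
  apply: (@le_trans _ _ 0); last first.
    by apply: mulr_ge0; [rewrite mulr_ge0 ?expR_ge0|rewrite addr_ge0 ?powR_ge0// mulr_ge0 ?sum_powR_ge0 ?(ltW s0)].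
  rewrite -(mean_cst k 0); apply: le_mean => v; rewrite /lin big1 ?normr0 ?powR0 ?gt_eqF//.
  move=> i _; move/eqP: Vz; rewrite mulf_eq0 gt_eqF//= psumr_eq0//; last first.
    by move=> j _; rewrite sqr_ge0.
  by move=> /allP /(_ i (mem_index_enum _)) /=; rewrite sqrf_eq0 => /eqP ->; rewrite mul0r.
have V1 : 0 < V by rewrite lt_neqAle eq_sym Vn.
pose l := V `^ 2^-1; have l0 : 0 < l := powR_gt0 _ V1.
have lp : l `^ p = V `^ (p / 2) by rewrite -powRrM mulrC.
(* The share of the j-th variable in the variance [V]; the shares add up to 1. *)
pose tau j : R := s * b j ^+ 2 / V.
have tau0 j : 0 <= tau j by rewrite divr_ge0// mulr_ge0 ?sqr_ge0 ?(ltW s0).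
pose B j : R := tau j * V `^ (p / 2) + s * `|b j| `^ p.
have B0 j : 0 <= B j.
  by apply: addr_ge0; apply: mulr_ge0; rewrite ?powR_ge0// ltW.
suff main j : mean j (fun v => `|lin j b v| `^ p) <=
    expR (C * \sum_(i < j) tau i) * (C * \sum_(i < j) B i).
  apply: le_trans (main k) _.
  have tau1 : \sum_(i < k) tau i = 1.
    by rewrite -mulr_suml -mulr_sumr -/V divff.
  by rewrite tau1 mulr1 -mulrA /B big_split /= -mulr_suml tau1 mul1r -mulr_sumr.
elim: j => [|j IH].
  by rewrite mean0 /lin !big_ord0 normr0 powR0 ?gt_eqF// !mulr0.
set M := mean j _ in IH.
have step : mean j.+1 (fun v => `|lin j.+1 b v| `^ p) <= (1 + C * tau j) * M + C * B j.
  apply: (@le_trans _ _ (mean j (fun v =>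
      (1 + C * tau j) * `|lin j b v| `^ p + C * B j))); last first.
    by rewrite meanD mean_cst meanZ.
  rewrite meanS; apply: le_mean => v; rewrite !lin_upd mulr0 addr0 mulr1 mulrN1.
  set u := lin j b v; have h := hC u (b j).
  (* The mixed term of [hC] has exponent p - 2. Splitting at the standard deviation replaces it by a
     constant plus a multiple of |u|^p, so that the recursion closes. *)
  have h1 : `|u| `^ (p - 2) <= l `^ (p - 2) + l `^ (p - 2 - p) * `|u| `^ p.
    by apply: powR_split => //; lra.
  have e1 : l `^ (p - 2) = V `^ (p / 2) / V.
    by rewrite powRD ?(gt_eqF l0) ?implybT// lp powRN -[l `^ 2]powRrM mulVf// powRr1.
  have e2 : l `^ (p - 2 - p) = V^-1.
    have -> : p - 2 - p = - 2 by ring.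
    by rewrite powRN -[l `^ 2]powRrM mulVf// powRr1.
  rewrite e1 e2 in h1.
  have h2 := ler_wpM2r (sqr_ge0 (b j)) h1.
  have h3 := ler_wpM2l C0 h2.
  have h4 : s / 2 * (`|u + b j| `^ p + `|u - b j| `^ p) <= s / 2 * (2 * `|u| `^ p +
     C * ((V `^ (p / 2) / V + V^-1 * `|u| `^ p) * b j ^+ 2 + `|b j| `^ p)).
    by apply: ler_wpM2l; [rewrite divr_ge0 ?(ltW s0)|lra].
  have -> : (1 + C * tau j) * `|u| `^ p + C * B j = (1 - s) * `|u| `^ p + s / 2 * (2 * `|u| `^ p +
     2 * C * ((V `^ (p / 2) / V + V^-1 * `|u| `^ p) * b j ^+ 2 + `|b j| `^ p)).
    by rewrite /B /tau; field.
  rewrite lerD2l; apply: le_trans h4 _; apply: ler_wpM2l; first by rewrite divr_ge0 ?(ltW s0).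
  rewrite lerD2l; apply: ler_wpM2r; last by lra.
  apply: addr_ge0; last exact: powR_ge0.
  apply: mulr_ge0; last exact: sqr_ge0.
  by apply: addr_ge0; apply: mulr_ge0; rewrite ?powR_ge0 ?invr_ge0.
apply: le_trans step _; rewrite !big_ord_recr /= !mulrDr expRD.
set S := \sum_(i < j) tau i; set T := \sum_(i < j) B i in IH *.
have M0 : 0 <= M by rewrite -(mean_cst j 0); apply: le_mean => v; exact: powR_ge0.
have E1 : 1 + C * tau j <= expR (C * tau j) := expR_ge1Dx _.
have Ct : 0 <= C * tau j by rewrite mulr_ge0.
have S0 : 0 <= S by apply: sumr_ge0.
apply: lerD.
  have -> : expR (C * S) * expR (C * tau j) * (C * T) =
    expR (C * tau j) * (expR (C * S) * (C * T)) by ring.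
  by apply: ler_pM => //; rewrite addr_ge0.
rewrite -!mulrDr -/(B j) ler_peMl ?mulr_ge0// -expRD.
by apply: le_trans (expR_ge1Dx _); rewrite lerDl addr_ge0// mulr_ge0.
Qed.

End sparse_signs.

(** * Blocks of sparse signs *)

Section blocks.
Variable k : nat -> nat.

Definition blocks M N : seq (nat * nat) :=
  [seq (m, i) | m <- index_iota M N, i <- index_iota 0 (k m)].

Lemma big_blocks (V : nmodType) (F : nat * nat -> V) M N :
  \sum_(j <- blocks M N) F j =
  \sum_(M <= m < N) \sum_(0 <= i < k m) F (m, i).
Proof. by rewrite big_allpairs_dep. Qed.

Lemma mem_blocks M N j : (j \in blocks M N) = (M <= j.1 < N)%N && (j.2 < k j.1)%N.
Proof.
case: j => m i /=; apply/allpairsPdep/andP => [[m' [i' [h1 h2 [-> ->]]]]|[h1 h2]].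
  by rewrite -mem_index_iota h1; rewrite mem_index_iota in h2.
by exists m, i; rewrite !mem_index_iota h1 h2.
Qed.

Lemma uniq_blocks M N : uniq (blocks M N).
Proof.
apply: allpairs_uniq_dep; first exact: iota_uniq.
  by move=> m _; exact: iota_uniq.
by move=> [m i] [m' i'] _ _ [-> ->].
Qed.

End blocks.

Section block_vectors.
Context {R : realType}.
Implicit Types (s p q : R) (k l i j : nat) (c : nat -> R).

(** A sparse sign has norm s^(1/p) in L_p. Divide it by this norm and identify L_p of the finite
    probability space with l_p, scaling each atom by the p-th root of its probability: these are the
    resulting coordinates. *)
Definition weight p s k i l : R :=
  let w := nth (0, fun=> 0) (points s k) l in (w.1 / s) `^ p^-1 * w.2 i.

Lemma sum_weight p s k c : 0 < p -> 0 < s -> s <= 1 ->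
  \sum_(0 <= l < size (points s k))
    `|\sum_(0 <= i < k) c i * weight p s k i l| `^ p =
  s^-1 * mean s k (fun v => `|lin k c v| `^ p).
Proof.
move=> p0 s0 s1; rewrite /mean mulr_sumr (big_nth (0, fun=> 0)).
apply: eq_big_nat => l /andP[_ lk].
rewrite /weight; set w := nth _ _ _.
have w0 : 0 <= w.1.
  apply: (@points_ge0 _ _ s0 s1 k); rewrite /w; move: lk.
  by elim: (points s k) l {w} => [|a t IH] [|l] //= lk; [left|right; exact: IH].
under eq_bigr do rewrite mulrCA.
rewrite -mulr_sumr normrM.
rewrite (@powRM _ _ _ p)// (big_mkord xpredT (fun i => c i * w.2 i)) -/(lin k c w.2).
rewrite ger0_norm ?powR_ge0// powRVK ?gt_eqF//; last by rewrite divr_ge0// ltW.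
by rewrite mulrAC mulrC mulrA.
Qed.

(** For conjugate exponents the two roots multiply to the probability of the atom divided by [s], so
    the sum is the covariance of two variables divided by [s]. *)
Lemma weight_biorthogonal p q s k i j : p^-1 + q^-1 = 1 -> 0 < s -> s <= 1 ->
  (i < k)%N -> (j < k)%N ->
  \sum_(0 <= l < size (points s k)) weight p s k i l * weight q s k j l =
  (i == j)%:R.
Proof.
move=> pq s0 s1 ik jk.
have E : \sum_(0 <= l < size (points s k)) weight p s k i l * weight q s k j l =
    s^-1 * mean s k (fun v => v i * v j).
  rewrite /mean mulr_sumr (big_nth (0, fun=> 0)).
  apply: eq_big_nat => l /andP[_ lk].
  rewrite /weight; set w := nth _ _ _.
  have w0 : 0 <= w.1.
    apply: (@points_ge0 _ _ s0 s1 k); rewrite /w; move: lk.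
    by elim: (points s k) l {w} => [|a t IH] [|l] //= lk; [left|right; exact: IH].
  have ws : 0 <= w.1 / s by rewrite divr_ge0// ltW.
  rewrite mulrACA -powRD; last by rewrite pq oner_eq0.
  by rewrite pq powRr1//; ring.
have lin1 (t : nat) (v : nat -> R) : (t < k)%N -> lin k (fun n => (n == t)%:R) v = v t.
  move=> tk; rewrite /lin (bigD1 (Ordinal tk)) //= eqxx mul1r big1 ?addr0// => n nt.
  by rewrite (_ : (n == t :> nat) = false) ?mul0r//; apply: negbTE.
rewrite E; under eq_mean => v do rewrite -(lin1 i v ik) -(lin1 j v jk).
rewrite mean_lin2 mulKf; last by rewrite gt_eqF.
rewrite (bigD1 (Ordinal ik)) //= eqxx mul1r big1 ?addr0// => n ni.
by rewrite (_ : (n == i :> nat) = false) ?mul0r//; apply: negbTE.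
Qed.

Variables (V : normedModType R) (r C : R) (e : nat * nat -> V).
Hypotheses (r0 : 0 < r) (C0 : 0 <= C).
Hypothesis eP : forall (t : seq (nat * nat)) (u : nat * nat -> R), uniq t ->
  `|\sum_(j <- t) u j *: e j| <= C * lnorm r t u.
Variables (k : nat -> nat) (s : nat -> R).
Hypotheses (s0 : forall m, 0 < s m) (s1 : forall m, s m <= 1).

(** The normalized variable [i] of block [m], with its l-th atom represented by [e (m, l)]: the
    second index of [e] counts atoms, not variables. *)
Definition block_vector (m i : nat) : V :=
  \sum_(0 <= l < size (points (s m) (k m))) weight r (s m) (k m) i l *: e (m, l).

Lemma norm_block_vectors M N (b : nat * nat -> R) :
  `|\sum_(j <- blocks k M N) b j *: block_vector j.1 j.2| <=
  C * (\sum_(M <= m < N) (s m)^-1 *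
       mean (s m) (k m) (fun v => `|lin (k m) (fun i => b (m, i)) v| `^ r)) `^ r^-1.
Proof.
pose u (j : nat * nat) := \sum_(0 <= i < k j.1) b (j.1, i) * weight r (s j.1) (k j.1) i j.2.
pose K m := size (points (s m) (k m)).
have -> : \sum_(j <- blocks k M N) b j *: block_vector j.1 j.2 =
    \sum_(j <- blocks K M N) u j *: e j.
  rewrite !big_blocks; apply: eq_bigr => m _ /=.
  under eq_bigr => i _ do rewrite scaler_sumr.
  rewrite exchange_big /=; apply: eq_bigr => l _.
  by rewrite scaler_suml; apply: eq_bigr => i _; rewrite scalerA.
apply: le_trans (eP _ (uniq_blocks _ _ _)) _; apply: ler_wpM2l => //.
rewrite lnormE big_blocks le_eqVlt; apply/orP; left; apply/eqP; congr (_ `^ _).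
by apply: eq_bigr => m _; rewrite -sum_weight.
Qed.

End block_vectors.

(** The bound of [mean_powR_le2] for the variance s L^2, after division by [s] and an r-th root. *)
Lemma scaled_powR {R : realType} (s L r : R) : 0 < s -> 0 <= L -> 0 < r ->
  (s^-1 * (2 * (s * L ^+ 2) `^ (r / 2))) `^ r^-1 =
  2 `^ r^-1 * (s `^ (2^-1 - r^-1) * L).
Proof.
move=> s0 L0 r0; have rn : r != 0 by rewrite gt_eqF.
have sn : s != 0 by rewrite gt_eqF.
rewrite powRM ?sqr_ge0 ?(ltW s0)//.
have -> : (L ^+ 2) `^ (r / 2) = L `^ r.
  by rewrite -(powR2 L0) -powRrM mulrCA divff// mulr1.
rewrite -[s^-1]powR_inv1 ?(ltW s0)//.
rewrite powRM ?powR_ge0 ?mulr_ge0 ?powR_ge0//.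
rewrite powRM ?powR_ge0 ?mulr_ge0 ?powR_ge0//.
rewrite powRM ?powR_ge0// powRKV//.
rewrite -!powRrM mulrCA; congr (_ * _).
rewrite mulrA -powRD ?sn ?implybT//.
by congr (_ `^ _ * _); field.
Qed.

Section block_estimates.
Context {R : realType}.
Variables (V : normedModType R) (r C : R) (e : nat * nat -> V).
Hypotheses (C0 : 0 <= C).
Hypothesis eP : forall (t : seq (nat * nat)) (u : nat * nat -> R), uniq t ->
  `|\sum_(j <- t) u j *: e j| <= C * lnorm r t u.
Variables (k : nat -> nat) (a : R).
Hypotheses (k0 : forall m, (0 < k m)%N) (a0 : 0 <= a).

Local Notation K m := ((k m)%:R : R).
(* An equation rather than a definition, to keep unification away from [powR]. *)
Variable sparsity : nat -> R.
Hypothesis sparsityE : forall m, sparsity m = K m `^ (- a).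
Local Notation x := (block_vector r e k sparsity).

Let K1 m : 1 <= K m. Proof. by rewrite ler1n. Qed.
Let K0 m : 0 < K m. Proof. exact: lt_le_trans ltr01 (K1 m). Qed.

Lemma sparsity_gt0 m : 0 < sparsity m. Proof. by rewrite sparsityE powR_gt0. Qed.

Lemma sparsity_le1 m : sparsity m <= 1.
Proof.
rewrite sparsityE powRN invf_le1 ?powR_gt0//.
by rewrite -[leLHS](powRr0 (K m)); apply: ler_powR.
Qed.

Let index_iotaE n F : \sum_(0 <= i < n) F i = \sum_(i < n) F i :> R.
Proof. by rewrite big_mkord. Qed.

Section below_two.
Hypotheses (r0 : 0 < r) (r2 : r < 2).

Lemma block_vector_norm1 n (c : nat -> R) :
  `|\sum_(0 <= i < k n) c i *: x n i| <= C * lnorm r (index_iota 0 (k n)) c.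
Proof.
have := norm_block_vectors r0 C0 eP k sparsity_gt0 sparsity_le1 n n.+1 (fun j => c j.2).
rewrite big_blocks !big_nat1 /= => /le_trans; apply; apply: ler_wpM2l => //.
rewrite lnormE; apply: le_powR; first by rewrite invr_ge0 ltW.
  by rewrite mulr_ge0 ?invr_ge0 ?(ltW (sparsity_gt0 n))// mean_ge0 ?sparsity_gt0 ?sparsity_le1.
rewrite ler_pdivrMl ?sparsity_gt0//; apply: le_trans (mean_powR_le _ _ _ _ _ _) _ => //.
- exact: sparsity_gt0.
- exact: sparsity_le1.
- by rewrite index_iotaE.
Qed.

(** For r < 2 the factor s^(1/2 - 1/r) is at least 1; it is the price, as a power of the block size,
    of passing from the l_r-norm to the l_2-norm. *)
Lemma block_vector_norm2 n (c : nat -> R) :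
  `|\sum_(0 <= i < k n) c i *: x n i| <=
  C * 2 `^ r^-1 * (K n `^ (a * (r^-1 - 2^-1)) * lnorm 2 (index_iota 0 (k n)) c).
Proof.
have := norm_block_vectors r0 C0 eP k sparsity_gt0 sparsity_le1 n n.+1 (fun j => c j.2).
rewrite big_blocks !big_nat1 /= => /le_trans; apply; rewrite -mulrA; apply: ler_wpM2l => //.
have s0 := sparsity_gt0 n; have L0 := lnorm_ge0 2 (index_iota 0 (k n)) c.
set L := lnorm 2 _ _ in L0 *.
have -> : K n `^ (a * (r^-1 - 2^-1)) = sparsity n `^ (2^-1 - r^-1).
  by rewrite sparsityE -powRrM; congr (_ `^ _); ring.
rewrite -(scaled_powR s0 L0 r0).
apply: le_powR; first by rewrite invr_ge0 ltW.
  by rewrite mulr_ge0 ?invr_ge0 ?(ltW s0)// mean_ge0 ?sparsity_le1.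
apply: ler_wpM2l; first by rewrite invr_ge0 ltW.
apply: le_trans (mean_powR_le2 _ _ _ _ _ _) _ => //; first exact: sparsity_le1.
by rewrite sqr_lnorm2 index_iotaE.
Qed.

End below_two.

Section above_two.
Hypothesis (r2 : 2 < r).
Let r0 : 0 < r. Proof. exact: lt_trans r2. Qed.
Let rn : r != 0. Proof. by rewrite gt_eqF. Qed.

(** Rosenthal's inequality divided by the sparsity s: with L the l_2-norm, the variance term becomes
    (s^(1/2 - 1/r) L)^r, where now r > 2 makes the factor at most 1. *)
Lemma mean_block_le : exists2 D : R, 0 <= D & forall m (b : nat -> R),
  (sparsity m)^-1 * mean (sparsity m) (k m) (fun v => `|lin (k m) b v| `^ r) <=
  D * (lnorm r (index_iota 0 (k m)) b `^ r +
       (K m `^ (- (a * (2^-1 - r^-1))) * lnorm 2 (index_iota 0 (k m)) b) `^ r).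
Proof.
have [D D0 hD] := @powR_parallelogram R r (ltW r2).
exists (expR D * D); first by rewrite mulr_ge0 ?expR_ge0.
move=> m b; have s0 := sparsity_gt0 m.
rewrite ler_pdivrMl//.
apply: le_trans (mean_powR_rosenthal _ (sparsity_le1 m) _ _ (ltW r2) D0 hD) _ => //.
rewrite [leRHS]mulrCA; apply: ler_wpM2l; first by rewrite mulr_ge0 ?expR_ge0.
rewrite mulrDr addrC lnorm_powR// !index_iotaE; apply: lerD => //.
have L0 := lnorm_ge0 2 (index_iota 0 (k m)) b.
rewrite -(index_iotaE (k m) (fun i => b i ^+ 2)) -sqr_lnorm2.
set L := lnorm 2 _ _ in L0 *.
have -> : (sparsity m * L ^+ 2) `^ (r / 2) = sparsity m `^ (r / 2) * L `^ r.
  rewrite powRM ?sqr_ge0 ?(ltW s0)// -(powR2 L0) -[(L `^ 2) `^ _]powRrM.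
  by rewrite [2 * (r / 2)]mulrCA divff// mulr1.
rewrite powRM ?powR_ge0// mulrA.
apply: ler_wpM2r; first exact: powR_ge0.
rewrite sparsityE -!powRrM -powRD ?(gt_eqF (K0 m)) ?implybT//.
rewrite le_eqVlt; apply/orP; left; apply/eqP; congr (_ `^ _); field.
by rewrite gt_eqF.
Qed.

(** The contributions of the blocks are summed in l_r. The factor of the l_2-part decreases with the
    block, so that of the first block serves for all, and an l_r-sum of l_2-norms is below their
    l_2-sum. *)
Lemma block_functional_norm2 : {homo k : m n / (m <= n)%N} ->
  exists2 D : R, 0 <= D & forall n N (b : nat * nat -> R),
  `|\sum_(j <- blocks k n N) b j *: x j.1 j.2| <=
  D * (lnorm r (blocks k n N) b +
       K n `^ (- (a * (2^-1 - r^-1))) * lnorm 2 (blocks k n N) b).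
Proof.
move=> khomo; have [D D0 hD] := mean_block_le.
exists (C * D `^ r^-1); first by rewrite mulr_ge0 ?powR_ge0.
move=> n N b.
apply: le_trans (norm_block_vectors r0 C0 eP k sparsity_gt0 sparsity_le1 n N b) _.
rewrite -mulrA; apply: ler_wpM2l => //.
set A := lnorm r _ _; set B := lnorm 2 _ _; set t := K n `^ _.
have A0 : 0 <= A := lnorm_ge0 _ _ _; have B0 : 0 <= B := lnorm_ge0 _ _ _.
have t0 : 0 <= t := powR_ge0 _ _.
have c0 : 0 < 2^-1 - r^-1 by rewrite subr_gt0 ltf_pV2 ?posrE.
apply: (powR_le_swap r0); first exact: powR_ge0.
  by rewrite mulr_ge0 ?powR_ge0// addr_ge0// mulr_ge0.
have sum0 : 0 <= \sum_(n <= m < N) (sparsity m)^-1 * mean (sparsity m) (k m)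
    (fun v => `|lin (k m) (fun i => b (m, i)) v| `^ r).
  apply: sumr_ge0 => m _; rewrite mulr_ge0 ?invr_ge0 ?(ltW (sparsity_gt0 m))//.
  by rewrite mean_ge0 ?sparsity_gt0 ?sparsity_le1.
rewrite (powRVK rn sum0) powRM ?powR_ge0//; last by rewrite addr_ge0// mulr_ge0.
rewrite (powRVK rn D0).
apply: le_trans (ler_sum _ (fun m _ => hD m _)) _.
rewrite -mulr_sumr; apply: ler_wpM2l => //.
apply: (@le_trans _ _ (A `^ r + (t * B) `^ r)); last first.
  (* Superadditivity of the r-th power, read off from the l_r- and l_1-norms of the pair (A, t
     B). *)
  have := @lnorm_anti R bool 1 r [:: true; false] (fun z => if z then A else t * B) ltr01.
  have r1 : 1 <= r by apply: ltW (lt_trans _ r2); rewrite ltr1n.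
  move=> /(_ r1); rewrite !lnormE !big_cons !big_nil !addr0 invr1.
  have tB0 : 0 <= t * B by rewrite mulr_ge0.
  rewrite !(ger0_norm A0) !(ger0_norm tB0) !powRr1 ?addr_ge0// => h.
  rewrite -[leLHS](@powRVK _ r) ?gt_eqF ?addr_ge0 ?powR_ge0//.
  by apply: le_powR => //; rewrite ?powR_ge0// ltW.
rewrite big_split /=; apply: lerD.
  rewrite /A lnorm_powR// big_blocks; apply: ler_sum => m _.
  by rewrite lnorm_powR.
apply: (@le_trans _ _ (\sum_(n <= m < N)
    (t * lnorm 2 (index_iota 0 (k m)) (fun i => b (m, i))) `^ r)).
  apply: ler_sum_nat => m /andP[nm _].
  apply: le_powR; rewrite ?mulr_ge0 ?powR_ge0 ?lnorm_ge0 ?(ltW r0)//.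
  apply: ler_wpM2r; first exact: lnorm_ge0.
  rewrite /t !powRN lef_pV2 ?posrE ?powR_gt0//.
  by apply: le_powR; rewrite ?mulr_ge0 ?(ltW c0) ?(ltW (K0 _))// ler_nat khomo.
pose L m := lnorm 2 (index_iota 0 (k m)) (fun i => b (m, i)).
have L0 m : 0 <= L m := lnorm_ge0 _ _ _.
have BE : B = lnorm 2 (index_iota n N) L.
  rewrite /B !lnormE big_blocks; congr (_ `^ _); apply: eq_bigr => m _.
  by rewrite (ger0_norm (L0 m)) lnorm_powR.
under eq_bigr => m _ do rewrite (powRM _ t0 (lnorm_ge0 _ _ _)).
rewrite -mulr_sumr powRM//; apply: ler_wpM2l; first exact: powR_ge0.
have := @lnorm_anti _ _ 2 r (index_iota n N) L _ (ltW r2).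
rewrite -BE => /(_ _) h.
have -> : \sum_(n <= m < N) L m `^ r = lnorm r (index_iota n N) L `^ r.
  by rewrite lnorm_powR//; apply: eq_bigr => m _; rewrite ger0_norm.
by apply: le_powR; rewrite ?lnorm_ge0 ?(ltW r0)// h.
Qed.

(** The condition on [a] says that the gain K^(-a(1/2 - 1/r)) absorbs the loss K^(1/2 - 1/q)
    incurred by [lnorm2_le] in a block of K variables. *)
Lemma block_functional_norm1 q : 2 < q -> q < r -> 2^-1 - q^-1 <= a * (2^-1 - r^-1) ->
  exists2 D : R, 0 <= D & forall n N (b : nat * nat -> R),
  `|\sum_(j <- blocks k n N) b j *: x j.1 j.2| <= D * lnorm q (blocks k n N) b.
Proof.
move=> q2 qr qa; have [D D0 hD] := mean_block_le; have q0 : 0 < q by lra.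
pose E := D * (1 + 2 `^ r); have E0 : 0 <= E by rewrite mulr_ge0 ?addr_ge0 ?powR_ge0.
exists (C * E `^ r^-1); first by rewrite mulr_ge0 ?powR_ge0.
move=> n N b.
apply: le_trans (norm_block_vectors r0 C0 eP k sparsity_gt0 sparsity_le1 n N b) _.
rewrite -mulrA; apply: ler_wpM2l => //.
pose L m := lnorm q (index_iota 0 (k m)) (fun i => b (m, i)).
have L0 m : 0 <= L m := lnorm_ge0 _ _ _.
set B := lnorm q _ _; have B0 : 0 <= B := lnorm_ge0 _ _ _.
have BE : B = lnorm q (index_iota n N) L.
  rewrite /B !lnormE big_blocks; congr (_ `^ _); apply: eq_bigr => m _.
  by rewrite (ger0_norm (L0 m)) lnorm_powR.
apply: (powR_le_swap r0); first exact: powR_ge0.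
  by rewrite mulr_ge0 ?powR_ge0.
have sum0 : 0 <= \sum_(n <= m < N) (sparsity m)^-1 * mean (sparsity m) (k m)
    (fun v => `|lin (k m) (fun i => b (m, i)) v| `^ r).
  apply: sumr_ge0 => m _; rewrite mulr_ge0 ?invr_ge0 ?(ltW (sparsity_gt0 m))//.
  by rewrite mean_ge0 ?sparsity_gt0 ?sparsity_le1.
rewrite (powRVK rn sum0) powRM ?powR_ge0// (powRVK rn E0).
apply: (@le_trans _ _ (\sum_(n <= m < N) E * L m `^ r)).
  apply: ler_sum => m _; apply: le_trans (hD m _) _; rewrite /E -mulrA; apply: ler_wpM2l => //.
  rewrite mulrDl mul1r; apply: lerD.
    by apply: le_powR; rewrite ?lnorm_ge0 ?(ltW r0)//; apply: lnorm_anti; rewrite ?(ltW qr).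
  rewrite -powRM//; apply: le_powR; rewrite ?mulr_ge0 ?powR_ge0 ?lnorm_ge0 ?(ltW r0)//.
  apply: le_trans (ler_wpM2l (powR_ge0 _ _) (lnorm2_le _ _ (ltW q2))) _.
  rewrite size_iota subn0 -/(L m) [2 * _]mulrC !mulrA -powRD ?(gt_eqF (K0 m)) ?implybT//.
  apply: ler_wpM2r => //; rewrite -[leRHS]mul1r; apply: ler_wpM2r => //.
  by rewrite -[leRHS](powRr0 (K m)); apply: ler_powR => //; rewrite addrC subr_le0.
rewrite -mulr_sumr; apply: ler_wpM2l => //.
have := @lnorm_anti _ _ q r (index_iota n N) L q0 (ltW qr); rewrite -BE => h.
have -> : \sum_(n <= m < N) L m `^ r = lnorm r (index_iota n N) L `^ r.
  by rewrite lnorm_powR//; apply: eq_bigr => m _; rewrite ger0_norm.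
by apply: le_powR; rewrite ?lnorm_ge0 ?(ltW r0).
Qed.

End above_two.
End block_estimates.

(** * Real and complex scalars *)

(* A common interface to the scalar fields [R] and [R[i]]: [emb] embeds the
   reals, [re] is the real part, and [x = re x + v re (u x)]; for [R[i]] one takes
   [v = 'i] and [u = - 'i]. *)
Record real_part (R : realType) (K : numFieldType) := RealPart {
  emb : {rmorphism R -> K};
  re : {additive K -> R};
  rp_u : K;
  rp_v : K;
  re_embM : forall r x, re (emb r * x) = r * re x;
  re_emb : forall r, re (emb r) = r;
  le_emb : forall r s, (emb r <= emb s) = (r <= s);
  emb_re : forall x, 0 <= x -> emb (re x) = x;
  re_le_norm : forall x, `|re x| <= re `|x|;
  norm_u : `|rp_u| = 1;
  norm_v : `|rp_v| <= 1;
  re_decomp : forall x, x = emb (re x) + rp_v * emb (re (rp_u * x)) }.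

Section real_part_real.
Variable R : realType.

Definition real_part_real : real_part R R.
Proof.
refine (@RealPart R R idfun idfun 1 0 _ _ _ _ _ _ _ _) => //=.
- by rewrite normr1.
- by rewrite normr0.
- by move=> x; rewrite mul0r addr0.
Defined.

Definition real_part_complex : real_part R (R[i] : numFieldType).
Proof.
refine (@RealPart R (R[i] : numFieldType) (real_complex R) (@complex.Re R) (- 'i%C) 'i%C _ _ _ _ _ _ _ _) => //=.
- by move=> r [a b] /=; rewrite mul0r subr0.
- by move=> r s; rewrite lecR.
- by move=> [a b]; rewrite lecE /= => /andP[/eqP -> _].
- by move=> x; have := normc_ge_Re x; rewrite lecE /= => /andP[].
- by rewrite normrN normc_def /= expr0n expr1n add0r sqrtr1.
- by rewrite normc_def /= expr0n expr1n add0r sqrtr1.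
- by move=> [a b] /=; apply/eqP; rewrite eq_complex /=; apply/andP; split; apply/eqP; ring.
Defined.

End real_part_real.

Section norms.
Context {R : realType} {K : numFieldType} {hK : nneg_sup_complete K}.
Variable rp : real_part R K.
Local Notation emb := (emb rp).
Local Notation re := (re rp).

(** Norms over [K] take values in [K]; this is the same number in [R], where the order is total and
    the estimates are carried out. *)
Definition nrm {V : normedZmodType K} (x : V) : R := re `|x|.

Section zmodule.
Variable V : normedZmodType K.
Implicit Types x y : V.

Lemma emb_nrm x : emb (nrm x) = `|x|.
Proof. exact: emb_re. Qed.

Lemma le_nrm x c : (nrm x <= c) = (`|x| <= emb c).
Proof. by rewrite -(le_emb rp) emb_nrm. Qed.

Lemma nrm_ge0 x : 0 <= nrm x.
Proof. by rewrite -(le_emb rp) emb_nrm rmorph0. Qed.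

Lemma nrmD x y : nrm (x + y) <= nrm x + nrm y.
Proof. by rewrite le_nrm rmorphD !emb_nrm ler_normD. Qed.

Lemma nrmN x : nrm (- x) = nrm x.
Proof. by rewrite /nrm normrN. Qed.

Lemma nrmB x y : nrm (x - y) <= nrm x + nrm y.
Proof. by rewrite -(nrmN y); exact: nrmD. Qed.

Lemma nrm0 : nrm (0 : V) = 0.
Proof. by rewrite /nrm normr0 raddf0. Qed.

Lemma nrm_eq0 x : (nrm x == 0) = (x == 0).
Proof.
apply/eqP/eqP => [h|->]; last exact: nrm0.
by apply/eqP; rewrite -normr_eq0 -emb_nrm h rmorph0.
Qed.

Lemma nrm_gt0 x : (0 < nrm x) = (x != 0).
Proof. by rewrite lt_neqAle eq_sym nrm_eq0 nrm_ge0 andbT. Qed.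

End zmodule.

Lemma nrmM (a b : K) : nrm (a * b) = nrm a * nrm b.
Proof. by rewrite /nrm normrM -[in LHS](emb_nrm a) re_embM. Qed.

Lemma nrmZ (V : normedModType K) (a : K) (x : V) : nrm (a *: x) = nrm a * nrm x.
Proof. by rewrite /nrm normrZ -[in LHS](emb_nrm a) re_embM. Qed.

Lemma nrm_emb r : nrm (emb r) = `|r|.
Proof.
rewrite /nrm; have [r0|r0] := leP 0 r.
  by rewrite !ger0_norm ?re_emb// -(rmorph0 emb) le_emb.
rewrite ler0_norm ?raddfN ?re_emb ?ltr0_norm//.
by rewrite -(rmorph0 emb) le_emb ltW.
Qed.

Lemma le_re_nrm a : `|re a| <= nrm a.
Proof. exact: re_le_norm. Qed.

Lemma nrm_le_re a : nrm a <= `|re a| + `|re (rp_u rp * a)|.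
Proof.
rewrite {1}(re_decomp rp a); apply: le_trans (nrmD _ _) _.
rewrite nrm_emb lerD2l nrmM nrm_emb ler_piMl//.
by rewrite le_nrm rmorph1 norm_v.
Qed.

Lemma nrm_op (V W : normedModType K) (T : op V W) x : nrm (T x) <= nrm T * nrm x.
Proof. by rewrite le_nrm rmorphM !emb_nrm; exact: opnorm_bound. Qed.

Lemma nrm_op_le (V W : normedModType K) (T : op V W) c :
  0 <= c -> (forall x, nrm (T x) <= c * nrm x) -> nrm T <= c.
Proof.
move=> c0 h; rewrite le_nrm; apply: opnorm_le => x x1.
rewrite -le_nrm; apply: le_trans (h x) _; rewrite ler_piMr//.
by rewrite le_nrm rmorph1.
Qed.

Lemma nrm_op_comp (U V W : normedModType K) (B : op V W) (A : op U V) :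
  nrm (op_comp B A) <= nrm B * nrm A.
Proof.
apply: nrm_op_le => [|x]; first by rewrite mulr_ge0 ?nrm_ge0.
rewrite -mulrA; apply: le_trans (nrm_op B (A x)) _.
by apply: ler_wpM2l; [exact: nrm_ge0|exact: nrm_op].
Qed.

Lemma op_of_bounded (V W : normedModType K) (f : V -> W) c :
  linear f -> (forall x, nrm (f x) <= c * nrm x) -> exists T : op V W, T =1 f.
Proof.
move=> lf fc.
pose F : {linear V -> W} := HB.pack f (GRing.isLinear.Build K V W *:%R f lf).
have cf : continuous f.
  apply: (@bounded_linear_continuous _ _ _ F).
  apply/bounded_funP => r; exists (emb (`|c| * `|re r|)) => x xr.
  rewrite -le_nrm; apply: le_trans (fc x) _.
  have x0 := nrm_ge0 x.
  apply: (@le_trans _ _ (`|c| * nrm x)); first by apply: ler_wpM2r => //; exact: ler_norm.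
  apply: ler_wpM2l => //; apply: le_trans (ler_norm (re r)).
  by rewrite le_nrm emb_re//; exact: le_trans xr.
have fP : f \in op_pred hK (X := V) (Y := W) by rewrite unfold_in; apply/asboolP.
by exists (Op fP).
Qed.

Lemma closed_nrm (V : normedModType K) (J : set V) :
  (forall x, (forall e : R, 0 < e -> exists2 y, J y & nrm (x - y) <= e) -> J x) ->
  closed J.
Proof.
move=> h x Jx; apply: h => e e0.
have e0' : 0 < emb e.
  by rewrite lt_neqAle eq_sym fmorph_eq0 gt_eqF// -(rmorph0 emb) le_emb ltW.
have [y [Jy xy]] := Jx _ (nbhsx_ballx x _ e0').
exists y => //; rewrite le_nrm; move: xy; rewrite -ball_normE /= => /ltW.
exact: id.
Qed.

End norms.

(** * Domination by square-summable functionals *)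

Section dominated.
Context {R : realType} {K : numFieldType} {hK : nneg_sup_complete K}.
Variable rp : real_part R K.
Local Notation emb := (emb rp).
Local Notation nrm := (nrm rp).

Definition square_summable (V : normedModType K) (I : eqType) (a : I -> dual V)
    (M : R) :=
  forall (x : V) (s : seq I), uniq s ->
    \sum_(i <- s) nrm (a i x) ^+ 2 <= M * nrm x ^+ 2.

(* These operators form a closed ideal contained in [FSS]. *)
Definition dominated (V W : normedModType K) (S : op V W) :=
  forall e : R, 0 < e -> exists (I : eqType) (a : I -> dual V) (M C : R),
    [/\ 0 <= C, square_summable a M & forall (x : V) (t : R), 0 <= t ->
      (forall i, nrm (a i x) <= t) -> nrm (S x) <= e * nrm x + C * t].

Lemma square_summable_le (V : normedModType K) (I : eqType) (a : I -> dual V) M i x :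
  square_summable a M -> nrm (a i x) <= 1 + M * nrm x ^+ 2.
Proof.
move=> /(_ x [:: i] isT); rewrite big_seq1 => h.
have := sqr_ge0 (nrm (a i x) - 2^-1); have n0 := nrm_ge0 rp (a i x).
rewrite sqrrB => h2; lra.
Qed.

Lemma opZ (V W : normedModType K) (c : K) (T : op V W) x : (c *: T) x = c *: T x.
Proof. by []. Qed.

Lemma opD (V W : normedModType K) (S T : op V W) x : (S + T) x = S x + T x.
Proof. by []. Qed.

Lemma dominated_comp (U V W Z : normedModType K) (B : op W Z) (S : op V W) (A : op U V) :
  dominated S -> dominated (op_comp B (op_comp S A)).
Proof.
move=> dS e e0; pose b := 1 + nrm B; pose c := 1 + nrm A.
have B0 := nrm_ge0 rp B; have A0 := nrm_ge0 rp A.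
have b0 : 0 < b by rewrite /b; lra.
have c0 : 0 < c by rewrite /c; lra.
have [I [a [M [C [C0 aM aC]]]]] := dS (e / (b * c)) ltac:(by rewrite divr_gt0// mulr_gt0).
exists I, (fun i => op_comp (a i) A), (`|M| * c ^+ 2), (b * C); split.
- by rewrite mulr_ge0// ltW.
- move=> x s us /=; apply: le_trans (aM _ _ us) _.
  apply: (@le_trans _ _ (`|M| * nrm (A x) ^+ 2)).
    by apply: ler_wpM2r; [exact: sqr_ge0|exact: ler_norm].
  rewrite -mulrA -exprMn; apply: ler_wpM2l => //.
  have x0 := nrm_ge0 rp x.
  rewrite lerXn2r ?nnegrE ?nrm_ge0 ?mulr_ge0 ?(ltW c0)//.
  apply: le_trans (nrm_op rp A x) _; apply: ler_wpM2r => //; rewrite /c; lra.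
move=> x t t0 h /=; have x0 := nrm_ge0 rp x.
apply: le_trans (nrm_op rp B _) _.
apply: (@le_trans _ _ (b * (e / (b * c) * nrm (A x) + C * t))).
  apply: ler_pM; rewrite ?nrm_ge0//; first by rewrite /b; lra.
  exact: aC.
rewrite mulrDr [b * (C * t)]mulrA lerD2r mulrA.
have -> : b * (e / (b * c)) = e / c by field; rewrite !gt_eqF.
rewrite mulrAC ler_pdivrMr// -mulrA; apply: ler_wpM2l; first exact: ltW.
apply: le_trans (nrm_op rp A x) _; rewrite mulrC; apply: ler_wpM2l => //; rewrite /c; lra.
Qed.

Lemma dominatedD (V W : normedModType K) (S T : op V W) :
  dominated S -> dominated T -> dominated (S + T).
Proof.
move=> dS dT e e0; have e2 : 0 < e / 2 by rewrite divr_gt0.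
have [I [a [M [C [C0 aM aC]]]]] := dS _ e2.
have [J [b [N [D [D0 bN bD]]]]] := dT _ e2.
(* The disjoint union of the two families; a finite sum over it splits into its left and right
   parts. *)
exists (I + J)%type, (fun z => match z with inl i => a i | inr j => b j end), (M + N), (C + D).
split; first exact: addr_ge0.
  move=> x s us.
  pose s1 := pmap (fun z : I + J => if z is inl i then Some i else None) s.
  pose s2 := pmap (fun z : I + J => if z is inr i then Some i else None) s.
  have -> : \sum_(i <- s) nrm (match i with inl i => a i | inr j => b j end x) ^+ 2 =
      \sum_(i <- s1) nrm (a i x) ^+ 2 + \sum_(i <- s2) nrm (b i x) ^+ 2.
    rewrite /s1 /s2; elim: s {us s1 s2} => [|[i|j] s IH] /=.
    - by rewrite !big_nil addr0.
    - by rewrite !big_cons IH addrA.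
    - by rewrite !big_cons IH addrCA.
  rewrite mulrDl; apply: lerD.
    by apply: aM; apply: (@pmap_uniq _ _ _ inl) us => -[].
  by apply: bN; apply: (@pmap_uniq _ _ _ inr) us => -[].
move=> x t t0 h; rewrite opD.
have h1 := aC x t t0 (fun i => h (inl i)); have h2 := bD x t t0 (fun i => h (inr i)).
by have := nrmD rp (S x) (T x); lra.
Qed.

Lemma dominatedZ (V W : normedModType K) c (S : op V W) :
  dominated S -> dominated (c *: S).
Proof.
move=> dS e e0; have n0 := nrm_ge0 rp c.
have e2 : 0 < e / (1 + nrm c) by rewrite divr_gt0//; lra.
have [I [a [M [C [C0 aM aC]]]]] := dS _ e2.
exists I, a, M, (nrm c * C); split=> //; first by rewrite mulr_ge0.
move=> x t t0 h; rewrite opZ nrmZ.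
apply: le_trans (ler_wpM2l n0 (aC x t t0 h)) _.
rewrite mulrDr [nrm c * (C * t)]mulrA lerD2r mulrA; apply: ler_wpM2r; first exact: nrm_ge0.
rewrite mulrA ler_pdivrMr; last by lra.
by rewrite mulrC ler_pM2l//; lra.
Qed.

Lemma dominated0 (V W : normedModType K) : dominated (0 : op V W).
Proof.
move=> e e0; exists void, (fun=> 0), 0, 0; split=> //.
  by move=> x [|[]//] _; rewrite big_nil mul0r.
move=> x t t0 _; rewrite (_ : (0 : op V W) x = 0)// nrm0 mul0r addr0.
by rewrite mulr_ge0 ?nrm_ge0// ltW.
Qed.

Lemma dominated_approx (V W : normedModType K) (S : op V W) :
  (forall e : R, 0 < e -> exists2 T, dominated T & nrm (S - T) <= e) -> dominated S.
Proof.
move=> h e e0; have e2 : 0 < e / 2 by rewrite divr_gt0.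
have [T dT ST] := h _ e2; have [I [a [M [C [C0 aM aC]]]]] := dT _ e2.
exists I, a, M, C; split=> // x t t0 hx.
have h1 := aC x t t0 hx.
have : nrm (S x) <= nrm ((S - T) x) + nrm (T x).
  by rewrite -[S x](subrK (T x)); exact: nrmD.
have : nrm ((S - T) x) <= e / 2 * nrm x.
  by apply: le_trans (nrm_op rp _ _) _; apply: ler_wpM2r => //; exact: nrm_ge0.
lra.
Qed.

(* Flat vectors: among the vectors at which all functionals have modulus at most
   [1], one makes more and more functionals of modulus at least [1/2], moving
   along a vector that the functionals already chosen annihilate. *)
Lemma flat_vector (V : normedModType K) n (E : set V) (I : eqType)
    (a : I -> dual V) (M : R) k :
  has_dim n E -> square_summable a M -> (k <= n)%N ->
  (exists x, [/\ E x, x != 0 & forall i, a i x = 0]) \/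
  (exists (x : V) (s : seq I), [/\ E x, uniq s, size s = k,
     forall i, nrm (a i x) <= 1 & forall i, i \in s -> 2^-1 <= nrm (a i x)]).
Proof.
move=> [e [eI ->]] aM; elim: k => [|k IH] kn.
  right; exists 0, [::]; split=> //.
    by exists (fun=> 0) => //; rewrite big1// => i _; rewrite scale0r.
  by move=> i; rewrite linear0 nrm0.
have [|[x [s [[c _ xE] us sk x1 xs]]]] := IH (ltnW kn); first by left.
(* The [k] functionals chosen so far impose k < n linear conditions, so the n by k matrix of their
   values on the basis has a nonzero left kernel. *)
have [v v0 vs] : exists2 v : 'I_n -> K, (exists l, v l != 0) &
    forall i, i \in s -> a i (\sum_l v l *: e l) = 0.
  pose A : 'M[K]_(n, k) := \matrix_(l, g) a (tnth (Tuple (introT eqP sk)) g) (e l).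
  have kA : kermx A != 0.
    rewrite -mxrank_eq0 mxrank_ker subn_eq0 -ltnNge.
    exact: leq_ltn_trans (rank_leq_col A) kn.
  have /rowV0Pn[v /sub_kermxP vA v0] := kA.
  exists (fun l => v 0 l).
    by have /rV0Pn[l vl] := v0; exists l.
  move=> i /(tnthP (Tuple (introT eqP sk)))[g ->].
  move/matrixP/(_ 0 g): vA; rewrite !mxE => <-; rewrite linear_sum.
  by apply: eq_bigr => l _; rewrite linearZ mxE.
set y := \sum_l v l *: e l in vs.
have y0 : y != 0.
  by apply/eqP => /eI h; have [l] := v0; rewrite h eqxx.
have Ey : exists2 c, True & \sum_l c l *: e l = y by exists v.
have [ya|/existsNP[j /eqP yj]] := pselect (forall i, a i y = 0).
  by left; exists y; split=> //; exists v.
(* [x] is moved along [y] as far as all functionals stay at most 1. This set is bounded since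
   [a j y] is nonzero, and it contains its supremum since the functionals are uniformly bounded at
   [y]. *)
right; pose A : set R := [set t | 0 <= t /\ forall i, nrm (a i (x + emb t *: y)) <= 1].
have aE i t : a i (x + emb t *: y) = a i x + emb t * a i y.
  by rewrite linearD linearZ.
have yj0 : 0 < nrm (a j y) by rewrite nrm_gt0.
have supA : has_sup A.
  split; first by exists 0; split=> // i; rewrite rmorph0 scale0r addr0.
  exists (2 / nrm (a j y)) => t [t0 /(_ j)]; rewrite aE => h.
  rewrite ler_pdivlMr//.
  have -> : t * nrm (a j y) = nrm (emb t * a j y) by rewrite nrmM nrm_emb ger0_norm.
  have := nrmB rp (a j x + emb t * a j y) (a j x).
  by rewrite addrAC subrr add0r; have := x1 j; lra.
pose t := sup A; pose B := 1 + `|M * nrm y ^+ 2|.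
have B1 : 1 <= B by rewrite lerDl.
have aB i : nrm (a i y) <= B.
  apply: le_trans (square_summable_le _ _ aM) _; rewrite lerD2l; exact: ler_norm.
have near_t i h t' : `|t - t'| <= h -> nrm (a i (x + emb t *: y)) <=
    nrm (a i (x + emb t' *: y)) + h * B.
  move=> tt'; rewrite !aE.
  have -> : a i x + emb t * a i y = (a i x + emb t' * a i y) + emb (t - t') * a i y.
    by rewrite rmorphB mulrBl -addrA [emb t' * _ + _]addrC subrK.
  apply: le_trans (nrmD _ _ _) _; rewrite lerD2l nrmM nrm_emb.
  by apply: ler_pM => //; exact: nrm_ge0.
have t1 i : nrm (a i (x + emb t *: y)) <= 1.
  apply/ler_addgt0Pr => h h0; have hB : 0 < h / B by rewrite divr_gt0//; lra.
  have [t' [t'0 At'] tt'] := sup_adherent hB supA.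
  have t't : t' <= t by apply: sup_upper_bound.
  apply: le_trans (near_t i (h / B) t' _) _; first by rewrite ger0_norm; rewrite /t in t't *; lra.
  by rewrite divfK ?gt_eqF//; [rewrite lerD2r|lra].
have t0 : 0 <= t.
  apply: sup_upper_bound => //; split=> // i; first by rewrite rmorph0 scale0r addr0.
(* A further step [h] changes every functional by at most 1/2 and makes some functional exceed 1.
   That one has modulus at least 1/2 already at [t], and it is new because the chosen ones are
   constant along [y]. *)
pose h := (2 * B)^-1; have h0 : 0 < h by rewrite invr_gt0; lra.
have /existsNP[i /negP] : ~ forall i, nrm (a i (x + emb (t + h) *: y)) <= 1.
  move=> H; suff : t + h <= t by lra.
  by apply: sup_upper_bound => //; split=> //; rewrite addr_ge0// ltW.
rewrite -ltNge => hi.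
have is_ : i \notin s.
  apply/negP => iS; move: hi; rewrite aE vs// mulr0 addr0 => hi.
  by have := x1 i; lra.
exists (x + emb t *: y), (i :: s); split=> //.
- exists (fun l => c l + emb t * v l) => //.
  rewrite -xE /y scaler_sumr -big_split /=.
  by apply: eq_bigr => l _; rewrite scalerDl scalerA.
- by rewrite /= is_ us.
- by rewrite /= sk.
move=> i'; rewrite inE => /predU1P[->|i's]; last first.
  by rewrite aE vs// mulr0 addr0; exact: xs.
have := nrmD rp (a i (x + emb t *: y)) (emb h * a i y).
have -> : a i (x + emb t *: y) + emb h * a i y = a i (x + emb (t + h) *: y).
  by rewrite !aE rmorphD mulrDl addrA.
rewrite nrmM nrm_emb (gtr0_norm h0).
have : h * nrm (a i y) <= 2^-1.
  apply: le_trans (ler_wpM2l (ltW h0) (aB i)) _.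
  by rewrite /h invfM mulfVK// gt_eqF//; lra.
by move: hi; lra.
Qed.

(** In high dimension [flat_vector] gives either a vector annihilated by all functionals, or one
    where they are at most 1 while many are at least 1/2. In the second case square-summability
    forces the norm to be large, so the constant term of the domination is negligible. *)
Lemma dominated_FSS (V W : normedModType K) (S : op V W) : dominated S -> FSS S.
Proof.
move=> dS eps eps0; pose e := re rp eps.
have eE : emb e = eps by rewrite emb_re// ltW.
have e0 : 0 < e.
  rewrite lt_neqAle -(le_emb rp) eE rmorph0 (ltW eps0) andbT.
  by apply/eqP => h; move: eps0; rewrite -eE -h rmorph0 ltxx.
have lt_e (x : W) (y : V) : nrm x < e * nrm y -> `|x| < eps * `|y|.
  move=> h; rewrite -eE -!(emb_nrm rp) -rmorphM lt_neqAle le_emb (ltW h) andbT.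
  by rewrite (inj_eq (fmorph_inj emb)) lt_eqF.
have e3 : 0 < e / 3 by rewrite divr_gt0.
have [I [a [M [C [C0 aM aC]]]]] := dS _ e3.
(* A norm above [D] makes 3 C smaller than e times the norm; [n] is taken so that n/4 exceeds |M|
   D^2. *)
pose D := 1 + 3 * C / e; have D0 : 0 < D.
  by rewrite /D; have : 0 <= 3 * C / e by [rewrite divr_ge0 ?mulr_ge0// ltW]; lra.
pose n := (Num.truncn (4 * `|M| * D ^+ 2)).+1.
exists n => // E En.
have [[x [Ex x0 ax]]|[x [s [Ex us sn x1 xs]]]] := flat_vector En aM (leqnn n).
  exists x; split=> //; apply: lt_e.
  have := aC x 0 (lexx 0); rewrite mulr0 addr0 => h.
  apply: le_lt_trans (h _) _ => [i|]; first by rewrite ax nrm0.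
  have : 0 < nrm x by rewrite nrm_gt0.
  by move=> xp; rewrite ltr_pM2r//; lra.
have nx : n%:R <= 4 * `|M| * nrm x ^+ 2.
  have := aM x s us => h.
  have : \sum_(i <- s) (4^-1 : R) <= \sum_(i <- s) nrm (a i x) ^+ 2.
    rewrite big_seq [leRHS]big_seq; apply: ler_sum => i /xs h2.
    have -> : (4^-1 : R) = 2^-1 ^+ 2 by field.
    by rewrite lerXn2r ?nnegrE ?nrm_ge0.
  rewrite big_const_seq count_predT sn iter_addr_0 -mulr_natl => h2.
  have h3 : M * nrm x ^+ 2 <= `|M| * nrm x ^+ 2.
    by apply: ler_wpM2r; [exact: sqr_ge0|exact: ler_norm].
  rewrite -mulrA mulrC -ler_pdivrMr//; lra.
have nD : 4 * `|M| * D ^+ 2 < n%:R by apply: truncnS_gt; rewrite !mulr_ge0 ?sqr_ge0.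
have xD : D < nrm x.
  rewrite ltNge; apply/negP => xD; move: (lt_le_trans nD nx); rewrite ltNge => /negP; apply.
  apply: ler_wpM2l; first by rewrite mulr_ge0.
  by rewrite lerXn2r ?nnegrE ?nrm_ge0 ?(ltW D0).
exists x; split=> //; first by rewrite -(nrm_gt0 rp); exact: lt_trans D0 xD.
apply: lt_e; apply: le_lt_trans (aC x 1 ler01 x1) _; rewrite mulr1.
have : 3 * C < e * nrm x.
  by rewrite [e * _]mulrC -ltr_pdivrMr//; apply: lt_trans xD; rewrite /D; lra.
have : 0 < e * nrm x by rewrite mulr_gt0//; exact: lt_trans D0 xD.
lra.
Qed.

End dominated.

(** * Diagonals of bilinear forms *)

Section signs.
Context {R : realType}.

(** The signs are chosen one at a time, each making the sum of the cross terms between the new index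
    and the earlier ones nonnegative. *)
Lemma exists_signs (s : seq nat) (F : nat -> nat -> R) : uniq s ->
  exists e : nat -> R, (forall i, `|e i| = 1) /\
  \sum_(i <- s) F i i <= \sum_(i <- s) \sum_(l <- s) e i * e l * F i l.
Proof.
elim: s => [|a s IH] /=; first by exists (fun=> 1); rewrite normr1 !big_nil.
case/andP => as_ us; have [e [e1 he]] := IH us.
pose c := \sum_(l <- s) e l * (F a l + F l a).
pose s0 : R := if 0 <= c then 1 else - 1.
have s01 : `|s0| = 1 by rewrite /s0; case: ifP; rewrite ?normrN normr1.
have sc : 0 <= s0 * c.
  by rewrite /s0; case: ifP => [|/negbT]; rewrite ?mul1r// -ltNge mulN1r oppr_ge0; exact: ltW.
exists (fun i => if i == a then s0 else e i); split=> [i|]; first by case: ifP.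
rewrite !big_cons eqxx.
have E (G : nat -> R -> R) : \sum_(i <- s) G i (if i == a then s0 else e i) =
    \sum_(i <- s) G i (e i).
  by apply: eq_big_seq => i is_; case: eqP => // ia; move: as_; rewrite -ia is_.
rewrite (E (fun l z => s0 * z * F a l)).
under [X in _ <= _ + X]eq_bigr => i _.
  rewrite big_cons eqxx (E (fun l z => _ * z * F i l)); over.
rewrite (E (fun i z => z * s0 * F i a + \sum_(l <- s) z * e l * F i l)).
rewrite big_split /=.
have s02 : s0 * s0 = 1 by rewrite -expr2 -real_normK ?num_real// s01 expr1n.
have -> : s0 * s0 * F a a = F a a by rewrite s02 mul1r.
have cE : s0 * c = \sum_(l <- s) s0 * e l * F a l + \sum_(i <- s) e i * s0 * F i a.
  by rewrite /c mulr_sumr -big_split; apply: eq_bigr => l _ /=; ring.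
by lra.
Qed.

(** This is why the block sizes are factorials: all blocks before the n-th one have together at most
    2 n!/n elements, negligible against n!. *)
Lemma sum_factorials n : (n * \sum_(0 <= m < n) m`! <= 2 * n`!)%N.
Proof.
case: n => [|[|n]]; [by []|by rewrite big_nat1|].
elim: n => [|n IH]; first by rewrite !big_nat_recr//= big_geq.
rewrite big_nat_recr//= mulnDr factS.
have h : (\sum_(0 <= m < n.+2) m`! <= n.+2`!)%N.
  rewrite -(leq_pmul2l (ltn0Sn n.+1)); apply: leq_trans IH _.
  by rewrite leq_pmul2r ?fact_gt0.
apply: (@leq_trans (n.+3 * n.+2`! + n.+3 * n.+2`!)%N).
  by rewrite leq_add2r leq_pmul2l.
by rewrite factS mul2n addnn.
Qed.

End signs.

(** * Diagonal sums of a matrix along an arbitrary assignment [j] of functionals to vectors *)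

Section trace.
Context {R : realType}.
Variables (p P c al al' : R).
Hypotheses (p0 : 0 < p) (pE : p^-1 = 2^-1 + c) (P0 : 2 < P) (PE : P^-1 = 2^-1 - c)
  (c0 : 0 < c) (al0 : 0 <= al) (al1 : al < 1) (alal' : al < al').
Variables (L n : nat) (Lam : R) (Psi : nat * nat -> nat -> R) (j : nat -> nat * nat).
Hypotheses (L0 : (0 < L)%N) (Lam0 : 0 <= Lam).
Hypothesis jP : forall i, ((j i).2 < (j i).1`!)%N.
Let k : nat := n`!.
Let s := index_iota 0 k.
Let K : R := k%:R.
Hypothesis single : forall v (eta : nat -> R), (v.2 < v.1`!)%N ->
  `|\sum_(l <- s) eta l * Psi v l| <= Lam * lnorm p s eta.
Hypothesis double : forall N (b : nat * nat -> R) (eta : nat -> R),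
  `|\sum_(v <- blocks factorial n N) \sum_(l <- s) b v * eta l * Psi v l| <=
  Lam * (lnorm P (blocks factorial n N) b +
         K `^ (- (al' * c)) * lnorm 2 (blocks factorial n N) b) *
    (K `^ (al * c) * lnorm 2 s eta).

Let mult (v : nat * nat) : R := \sum_(l <- s) (j l == v)%:R.

Let sum_s1 : \sum_(i <- s) (1 : R) = K.
Proof. by rewrite big_const_seq count_predT size_iota subn0 iter_addr_0. Qed.

Let sum_sub1 (A : pred nat) : \sum_(i <- s | A i) (1 : R) <= K.
Proof.
rewrite -sum_s1 big_mkcond /=; apply: ler_sum => i _.
by case: (A i); rewrite ?ler01.
Qed.

Lemma lnorm_bool_le (r : seq nat) (q : R) (A : pred nat) (eta : nat -> R) :
  0 < q -> (forall i, `|eta i| <= (A i)%:R) ->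
  lnorm q r eta <= (\sum_(i <- r) (A i)%:R) `^ q^-1.
Proof.
move=> q0 h; rewrite lnormE; apply: le_powR; rewrite ?invr_ge0 ?(ltW q0) ?sum_powR_ge0//.
apply: ler_sum => i _; apply: le_trans (le_powR (ltW q0) _ (h i)) _ => //.
by case: (A i); rewrite ?powR1// powR0 ?gt_eqF.
Qed.

(** [single] is applied to the signs of the entries on the class of [v]; this family has l_p-norm at
    most the p-th root of the size of the class. *)
Lemma trace_class v : (v.2 < v.1`!)%N ->
  \sum_(i <- s | j i == v) `|Psi v i| <= Lam * mult v `^ p^-1.
Proof.
move=> vP; pose eta i : R := (j i == v)%:R * Num.sg (Psi v i).
have -> : \sum_(i <- s | j i == v) `|Psi v i| = \sum_(i <- s) eta i * Psi v i.
  rewrite big_mkcond; apply: eq_bigr => i _; rewrite /eta.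
  by case: ifP => _; rewrite ?mul1r -?normrEsg// !mul0r.
apply: le_trans (ler_norm _) _; apply: le_trans (single _ vP) _.
apply: ler_wpM2l => //; apply: lnorm_bool_le => // i.
by rewrite normrM normr_nat ler_piMr ?ler0n// normr_sg; case: (_ != 0).
Qed.

Lemma trace_entry i : i \in s -> `|Psi (j i) i| <= Lam.
Proof.
move=> is_; pose eta l : R := (l == i)%:R.
have us : uniq s := iota_uniq _ _.
have E : \sum_(l <- s) eta l * Psi (j i) l = Psi (j i) i.
  rewrite (bigD1_seq i) //= /eta eqxx mul1r big1 ?addr0// => l /negbTE ->.
  by rewrite mul0r.
have := single eta (jP i); rewrite E => /le_trans; apply.
rewrite -[leRHS]mulr1; apply: ler_wpM2l => //.
apply: le_trans (@lnorm_bool_le _ _ (pred1 i) _ p0 _) _.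
  by move=> l; rewrite /eta normr_nat.
have -> : \sum_(l <- s) (pred1 i l)%:R = 1 :> R.
  by rewrite (bigD1_seq i) //= eqxx big1 ?addr0// => l /negbTE ->.
by rewrite powR1.
Qed.

Let big_i i := (L%:R : R) < mult (j i).

(* The indices [i] sharing one functional [j i] are tested together. *)
Lemma trace_big : \sum_(i <- s | big_i i) `|Psi (j i) i| <=
  Lam * L%:R `^ (- P^-1) * K.
Proof.
have LR : 0 < L%:R :> R by rewrite ltr0n.
(* Each entry is spread evenly over its class, which leaves the total unchanged. By [trace_class]
   the average over a class is at most Lam mult^(1/p - 1), and 1/p - 1 = - 1/P. *)
have -> : \sum_(i <- s | big_i i) `|Psi (j i) i| = \sum_(i <- s | big_i i)
    \sum_(l <- s | j l == j i) `|Psi (j i) l| / mult (j i).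
  rewrite (exchange_big_dep big_i) /=; last first.
    by move=> i l + /eqP jl; rewrite /big_i jl.
  apply: eq_bigr => l lb; have m0 : 0 < mult (j l) := lt_trans LR lb.
  transitivity (\sum_(i <- s | j i == j l) `|Psi (j l) l| / mult (j l)).
    rewrite big_mkcond /= (eq_bigr (fun i => (j i == j l)%:R * (`|Psi (j l) l| / mult (j l)))).
      by rewrite -mulr_suml mulrCA mulfV ?gt_eqF// mulr1.
    by move=> i _; case: ifP => _; rewrite ?mul1r ?mul0r.
  apply: eq_big => [i|i /eqP ->//]; rewrite [j l == j i]eq_sym.
  by case: eqP => [h|_]; rewrite ?andbF// /big_i h -/(big_i l) lb.
apply: (@le_trans _ _ (\sum_(i <- s | big_i i) Lam * L%:R `^ (- P^-1))).
  apply: ler_sum => i ib; have m0 : 0 < mult (j i) := lt_trans LR ib.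
  rewrite -mulr_suml ler_pdivrMr//; apply: le_trans (trace_class (jP i)) _.
  rewrite -mulrA; apply: ler_wpM2l => //.
  have -> : p^-1 = - P^-1 + 1 by rewrite pE PE; field.
  rewrite powRD ?(gt_eqF m0) ?implybT// powRr1 ?(ltW m0)//.
  apply: ler_wpM2r; first exact: ltW.
  rewrite !powRN lef_pV2 ?posrE ?powR_gt0//.
  apply: le_powR; rewrite ?ler0n ?(ltW ib)// invr_ge0 ltW//; exact: lt_trans P0.
under eq_bigr do rewrite -[_ * _]mulr1.
rewrite -mulr_sumr; apply: ler_wpM2l; last exact: sum_sub1.
by rewrite mulr_ge0 ?powR_ge0.
Qed.

(** Every entry is at most [Lam], and each functional of the blocks before [n] is assigned to at
    most [L] of the remaining indices. *)
Lemma trace_low : \sum_(i <- s | ~~ big_i i && ((j i).1 < n)%N) `|Psi (j i) i| <=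
  Lam * (L%:R * (\sum_(0 <= m < n) m`!)%:R).
Proof.
apply: (@le_trans _ _ (\sum_(i <- s | ~~ big_i i && ((j i).1 < n)%N) Lam * 1)).
  rewrite big_seq_cond [leRHS]big_seq_cond; apply: ler_sum => i /andP[is_ _].
  by rewrite mulr1 trace_entry.
rewrite -mulr_sumr; apply: ler_wpM2l => //.
pose A i := ~~ big_i i && ((j i).1 < n)%N.
apply: (@le_trans _ _ (\sum_(i <- s | A i)
    \sum_(v <- blocks factorial 0 n) (j i == v)%:R)).
  apply: ler_sum => i /andP[_ jn].
  have jb : j i \in blocks factorial 0 n by rewrite mem_blocks jn jP.
  rewrite (bigD1_seq (j i) jb (uniq_blocks _ _ _)) /= eqxx lerDl.
  by apply: sumr_ge0 => v _; rewrite ler0n.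
rewrite exchange_big /=.
have -> : L%:R * (\sum_(0 <= m < n) m`!)%:R =
    \sum_(v <- blocks factorial 0 n) L%:R :> R.
  rewrite big_blocks natr_sum mulr_sumr; apply: eq_bigr => m _.
  by rewrite big_const_nat subn0 iter_addr_0 mulr_natr.
apply: ler_sum => v _.
have [Lv|vL] := ltP (L%:R : R) (mult v).
  rewrite big1 ?ler0n// => i /andP[+ _]; rewrite /big_i.
  by case: eqP => // ->; rewrite Lv.
apply: le_trans vL; rewrite big_mkcond /mult; apply: ler_sum => i _.
by case: ifP => _ //; rewrite ler0n.
Qed.

(* A choice of signs turns the diagonal sum into the bilinear pairing [double]. *)
Lemma trace_high : \sum_(i <- s | ~~ big_i i && (n <= (j i).1)%N) `|Psi (j i) i| <=
  Lam * L%:R * (K `^ (1 - c * (1 - al)) + K `^ (1 - c * (al' - al))).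
Proof.
pose A i := ~~ big_i i && (n <= (j i).1)%N.
rewrite -(big_filter s A); set r := [seq i <- s | A i].
have ur : uniq r by rewrite filter_uniq// iota_uniq.
pose sg i : R := Num.sg (Psi (j i) i).
have [e [e1 he]] := @exists_signs R r (fun i l => sg i * Psi (j i) l) ur.
have -> : \sum_(i <- r) `|Psi (j i) i| = \sum_(i <- r) sg i * Psi (j i) i.
  by apply: eq_bigr => i _; rewrite normrEsg.
apply: le_trans he _.
have LR : 0 < L%:R :> R by rewrite ltr0n.
have LR1 : 1 <= L%:R :> R by rewrite ler1n.
have K0 : 0 < K by rewrite ltr0n fact_gt0.
pose N := (\max_(i <- r) (j i).1).+1.
have jN i : i \in r -> j i \in blocks factorial n N.
  move=> ir; rewrite mem_blocks jP andbT ltnS.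
  move: (ir); rewrite mem_filter => /andP[/andP[_ ->] _] /=.
  exact: leq_bigmax_seq.
(* The signs of all indices assigned to [v] are collected in one coefficient, so that every
   functional occurs once, as in [double]. *)
pose b (v : nat * nat) : R := \sum_(i <- r | j i == v) e i * sg i.
pose eta l : R := (l \in r)%:R * e l.
have -> : \sum_(i <- r) \sum_(l <- r) e i * e l * (sg i * Psi (j i) l) =
    \sum_(v <- blocks factorial n N) \sum_(l <- s) b v * eta l * Psi v l.
  have inner v : \sum_(l <- s) eta l * Psi v l = \sum_(l <- r) e l * Psi v l.
    rewrite [RHS]big_filter [RHS]big_mkcond; apply: eq_big_seq => l ls.
    by rewrite /eta mem_filter ls andbT; case: ifP => _; rewrite ?mul1r// !mul0r.
  under [RHS]eq_bigr => v _.
    under eq_bigr do rewrite -mulrA.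
    rewrite -mulr_sumr inner /b mulr_suml; over.
  rewrite [RHS](exchange_big_dep xpredT) //=.
  apply: eq_big_seq => i ir.
  rewrite [RHS]big_mkcond /= (bigD1_seq (j i) (jN i ir) (uniq_blocks _ _ _)) /= eqxx.
  rewrite [X in _ = _ + X]big1 => [|v /negbTE h]; last by rewrite eq_sym h.
  by rewrite addr0 mulr_sumr; apply: eq_bigr => l _; ring.
apply: le_trans (ler_norm _) _; apply: le_trans (double N b eta) _.
pose cnt v : R := \sum_(i <- r) (j i == v)%:R.
have sg1 i : `|e i * sg i| <= 1.
  by rewrite normrM e1 mul1r normr_sg; case: (_ != 0).
have cntK : \sum_(v <- blocks factorial n N) cnt v <= K.
  rewrite /cnt exchange_big /=; apply: le_trans (sum_sub1 A).
  have -> : \sum_(i <- s | A i) (1 : R) = \sum_(i <- r) 1 by rewrite big_filter.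
  rewrite big_seq [leRHS]big_seq; apply: ler_sum => i ir.
  rewrite (bigD1_seq (j i) (jN i ir) (uniq_blocks _ _ _)) /= eqxx big1 ?addr0//.
  by move=> v; rewrite eq_sym => /negbTE ->.
(* The coefficients are at most [L] in modulus, because big classes are excluded, and at most [K] of
   them are nonzero. *)
have b_le (q : R) : 0 < q -> lnorm q (blocks factorial n N) b <= L%:R * K `^ q^-1.
  move=> q0; apply: lnorm_le_powR; rewrite ?mulr_ge0 ?powR_ge0 ?(ltW LR)//.
  rewrite powRM ?powR_ge0 ?(ltW LR)// (powRVK (lt0r_neq0 q0) (ltW K0)).
  apply: (@le_trans _ _ (\sum_(v <- blocks factorial n N) L%:R `^ q * cnt v)); last first.
    by rewrite -mulr_sumr; apply: ler_wpM2l; rewrite ?powR_ge0.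
  apply: ler_sum => v _.
  have [/hasP[i ir /eqP jv]|/hasPn nv] := boolP (has (fun i => j i == v) r); last first.
    rewrite /b big_seq_cond big1 ?normr0 ?powR0 ?gt_eqF//; last first.
      by move=> i /andP[/nv/negbTE ->].
    by rewrite mulr_ge0 ?powR_ge0 ?sumr_ge0.
  have cnt1 : 1 <= cnt v.
    rewrite /cnt (bigD1_seq i ir ur) /= jv eqxx lerDl.
    by apply: sumr_ge0 => l _; rewrite ler0n.
  rewrite -[leLHS]mulr1; apply: ler_pM; rewrite ?powR_ge0//.
  apply: le_powR; rewrite ?(ltW q0)//.
  apply: le_trans (ler_norm_sum _ _ _) _.
  apply: (@le_trans _ _ (\sum_(l <- r | j l == v) 1)); first by apply: ler_sum.
  move: ir; rewrite mem_filter => /andP[/andP[+ _] _].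
  rewrite /big_i -leNgt jv; apply: le_trans.
  rewrite /r big_filter_cond big_mkcond /mult; apply: ler_sum => l _.
  by case: (j l == v); rewrite ?andbF// andbT; case: (A l); rewrite ?ler01.
have eta_le : lnorm 2 s eta <= K `^ 2^-1.
  apply: lnorm_le_powR; rewrite ?powR_ge0//.
  rewrite (powRVK _ (ltW K0))// -sum_s1; apply: ler_sum => l _.
  apply: (@le_trans _ _ (1 `^ 2)); last by rewrite powR1.
  apply: le_powR => //.
  by rewrite /eta normrM e1 mulr1 normr_nat; case: (_ \in _).
have Kc0 : 0 <= K `^ (- (al' * c)) := powR_ge0 _ _.
have Kd0 : 0 <= K `^ (al * c) := powR_ge0 _ _.
have P1 : 0 < P by exact: lt_trans P0.
apply: (@le_trans _ _ (Lam * (L%:R * K `^ P^-1 + K `^ (- (al' * c)) * (L%:R * K `^ 2^-1)) *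
    (K `^ (al * c) * K `^ 2^-1))).
  apply: ler_pM.
  - by rewrite mulr_ge0// addr_ge0 ?lnorm_ge0// mulr_ge0 ?lnorm_ge0.
  - by rewrite mulr_ge0 ?lnorm_ge0.
  - apply: ler_wpM2l => //; apply: lerD; first exact: b_le.
    by apply: ler_wpM2l => //; exact: b_le.
  - exact: ler_wpM2l.
rewrite le_eqVlt; apply/orP; left; apply/eqP.
have KD (x y : R) : K `^ (x + y) = K `^ x * K `^ y by rewrite powRD// (gt_eqF K0) implybT.
have -> : 1 - c * (1 - al) = P^-1 + (al * c + 2^-1) by rewrite PE; field.
have -> : 1 - c * (al' - al) = - (al' * c) + 2^-1 + (al * c + 2^-1) by field.
by rewrite !KD; ring.
Qed.

Lemma trace_le : \sum_(i <- s) `|Psi (j i) i| <=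
  Lam * L%:R `^ (- P^-1) * K + Lam * (L%:R * (\sum_(0 <= m < n) m`!)%:R) +
  Lam * L%:R * (K `^ (1 - c * (1 - al)) + K `^ (1 - c * (al' - al))).
Proof.
rewrite (bigID big_i) /= -addrA; apply: lerD; first exact: trace_big.
rewrite (bigID (fun i => (j i).1 < n)%N) /=; apply: lerD; first exact: trace_low.
under eq_bigl => i do rewrite -leqNgt.
exact: trace_high.
Qed.

End trace.

Section trace_limit.
Context {R : realType}.

Lemma powR_fact_ge (mu B : R) : 0 < mu ->
  exists n0, forall n, (n0 <= n)%N -> B <= (n`!)%:R `^ mu.
Proof.
move=> mu0; pose b := `|B| `^ mu^-1; exists (Num.truncn b).+1 => n hn.
have b0 : 0 <= b := powR_ge0 _ _.
have bn : b <= (n`!)%:R.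
  apply: (@le_trans _ _ (Num.truncn b).+1%:R); first exact: ltW (truncnS_gt _).
  by rewrite ler_nat; apply: leq_trans hn (fact_geq n).
apply: le_trans (ler_norm B) _.
rewrite -[`|B|](@powRVK _ mu) ?gt_eqF// -/b.
by apply: le_powR => //; exact: ltW.
Qed.

(** First [L] is fixed so large that the big classes contribute at most a quarter of the bound; then
    [n] is taken large, depending on [L], for the low blocks and for the two powers with exponent
    below 1. *)
Lemma trace_small (p P c al al' Lam delta : R) : 0 < p -> p^-1 = 2^-1 + c ->
  2 < P -> P^-1 = 2^-1 - c -> 0 < c -> 0 <= al -> al < 1 -> al < al' ->
  0 <= Lam -> 0 < delta ->
  exists n0, forall n, (n0 <= n)%N -> forall (Psi : nat * nat -> nat -> R) j,
  (forall i, ((j i).2 < (j i).1`!)%N) ->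
  (forall v (eta : nat -> R), (v.2 < v.1`!)%N ->
    `|\sum_(0 <= l < n`!) eta l * Psi v l| <= Lam * lnorm p (index_iota 0 n`!) eta) ->
  (forall N (b : nat * nat -> R) (eta : nat -> R),
  `|\sum_(v <- blocks factorial n N) \sum_(0 <= l < n`!) b v * eta l * Psi v l| <=
  Lam * (lnorm P (blocks factorial n N) b +
         (n`!)%:R `^ (- (al' * c)) * lnorm 2 (blocks factorial n N) b) *
    ((n`!)%:R `^ (al * c) * lnorm 2 (index_iota 0 n`!) eta)) ->
  \sum_(0 <= i < n`!) `|Psi (j i) i| <= delta * (n`!)%:R.
Proof.
move=> p0 pE P0 PE c0 al0 al1 alal' Lam0 d0.
have P1 : 0 < P := lt_trans (ltr0n _ 2) P0.
pose d := delta / 4; have dp : 0 < d by rewrite divr_gt0.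
pose L := (Num.truncn ((Lam / d) `^ P)).+1.
have LR : 0 < L%:R :> R by rewrite ltr0n.
have hL : Lam * L%:R `^ (- P^-1) <= d.
  rewrite powRN ler_pdivrMr ?powR_gt0// mulrC -ler_pdivrMr//.
  have Ld : 0 <= Lam / d by rewrite divr_ge0// ltW.
  rewrite -[leLHS](powRKV (lt0r_neq0 P1) Ld); apply: le_powR; rewrite ?powR_ge0//.
    by rewrite invr_ge0 ltW.
  exact: ltW (truncnS_gt _).
have mu1 : 0 < c * (1 - al) by rewrite mulr_gt0// subr_gt0.
have mu2 : 0 < c * (al' - al) by rewrite mulr_gt0// subr_gt0.
have [n1 h1] := powR_fact_ge (Lam * L%:R / d) mu1.
have [n2 h2] := powR_fact_ge (Lam * L%:R / d) mu2.
pose n3 := (Num.truncn (Lam * L%:R * 2 / d)).+1.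
exists (maxn n1 (maxn n2 n3)) => n; rewrite !geq_max => /and3P[hn1 hn2 hn3] Psi j jP sg db.
apply: le_trans (trace_le p0 pE P0 PE (L := L) (ltn0Sn _) Lam0 jP sg db) _.
set K : R := (n`!)%:R; have K0 : 0 < K by rewrite ltr0n fact_gt0.
have -> : delta * K = d * K + d * K + (d * K + d * K) by rewrite /d; field.
have powK mu : 0 < mu -> Lam * L%:R / d <= K `^ mu -> Lam * L%:R * K `^ (1 - mu) <= d * K.
  move=> m0 h; rewrite powRD ?(gt_eqF K0) ?implybT// powRr1 ?(ltW K0)// powRN.
  rewrite mulrCA mulrC; apply: ler_wpM2r; first exact: ltW.
  by rewrite ler_pdivrMr ?powR_gt0// [d * _]mulrC -ler_pdivrMr.
apply: lerD; last by rewrite mulrDr; apply: lerD; apply: powK; rewrite ?h1 ?h2.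
apply: lerD; first by apply: ler_wpM2r => //; exact: ltW.
have n0 : 0 < n%:R :> R by rewrite ltr0n; exact: leq_trans hn3.
have hn : Lam * L%:R * 2 / d <= n%:R.
  apply: (@le_trans _ _ n3%:R); first exact: ltW (truncnS_gt _).
  by rewrite ler_nat.
have hD : (\sum_(0 <= m < n) m`!)%:R <= 2 * K / n%:R.
  by rewrite ler_pdivlMr// /K -!natrM ler_nat mulnC sum_factorials.
rewrite mulrA; apply: le_trans (ler_wpM2l _ hD) _; first by rewrite mulr_ge0// ltW.
rewrite [_ * (_ / _)]mulrA ler_pdivrMr//.
have -> : Lam * L%:R * (2 * K) = Lam * L%:R * 2 * K by ring.
rewrite [d * K * _]mulrAC; apply: ler_wpM2r; first exact: ltW.
by rewrite [d * _]mulrC -ler_pdivrMr.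
Qed.

End trace_limit.

(** * Chains of closed ideals *)

Section chain.
Context {R : realType} {K : numFieldType} {hK : nneg_sup_complete K}.
Variable rp : real_part R K.
Local Notation nrm := (nrm rp).

Lemma op_id_subproof (W : normedModType K) : id \in op_pred hK (X := W) (Y := W).
Proof.
rewrite unfold_in; apply/asboolP; split; first by move=> a x y.
by move=> x; exact: cvg_id.
Qed.

Definition op_id (W : normedModType K) : op W W := Op (op_id_subproof W).

Definition nrm_closed (V : normedModType K) (J : set V) :=
  forall x, (forall e : R, 0 < e -> exists2 y, J y & nrm (x - y) <= e) -> J x.

Definition closed_subspace (V : normedModType K) (J : set V) :=
  [/\ nrm_closed J, J 0 & forall (a : K) x y, J x -> J y -> J (a *: x + y)].

Lemma op_comp_lin (W : normedModType K) (A B S T : op W W) (a : K) :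
  op_comp B (op_comp (a *: S + T) A) =
  a *: op_comp B (op_comp S A) + op_comp B (op_comp T A).
Proof. by apply/val_inj/funext => x /=; rewrite op_linear. Qed.

Lemma op_comp_sub (W : normedModType K) (A B S T : op W W) :
  op_comp B (op_comp S A) - op_comp B (op_comp T A) = op_comp B (op_comp (S - T) A).
Proof.
apply/val_inj/funext => x /=.
by rewrite -[RHS]/(B (S (A x) - T (A x))) linearB.
Qed.

(* The operator [T t] lies in the ideal with index [t'] exactly when [t' < t]. *)
Lemma continuum_chain (W : normedModType K) (I D : set (op W W)) (T : R -> op W W)
    (Z : R -> set (op W W)) :
  D `<=` I -> closed_subspace D ->
  (forall A B S, D S -> D (op_comp B (op_comp S A))) ->
  (forall t, closed_subspace (Z t)) ->
  (forall t, D (T t)) -> (forall t, ~ Z t (T t)) ->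
  (forall t t' A B, t < t' -> Z t (op_comp B (op_comp (T t') A))) ->
  admits_continuum_chain R W I.
Proof.
move=> DI [Dcl D0 Dlin] Dideal Zsub DT ZT ZT'.
(* Each [Z t] is a closed subspace; the quantification over [A] and [B] makes [J t] an ideal, and
   that over t' <= t makes the family decreasing. *)
pose J t : set (op W W) :=
  [set S | D S /\ forall t' A B, t' <= t -> Z t' (op_comp B (op_comp S A))].
have Jideal t : closed_ideal (J t).
  split.
  - apply: (closed_nrm (rp := rp)) => S h; split.
      by apply: Dcl => e /h[T' [DT' _] ST']; exists T'.
    move=> t' A B t't; have [Zcl _ _] := Zsub t'; apply: Zcl => e e0.
    pose c := 1 + nrm B * nrm A.
    have BA0 : 0 <= nrm B * nrm A by rewrite mulr_ge0 ?nrm_ge0.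
    have c0 : 0 < c by rewrite /c; lra.
    have [T' [_ hT'] ST'] := h (e / c) (divr_gt0 e0 c0).
    exists (op_comp B (op_comp T' A)); first exact: hT'.
    rewrite op_comp_sub.
    apply: le_trans (nrm_op_comp rp B _) _.
    apply: (@le_trans _ _ (nrm B * (e / c * nrm A))).
      apply: ler_wpM2l; first exact: nrm_ge0.
      apply: le_trans (nrm_op_comp rp _ _) _.
      by apply: ler_wpM2r => //; exact: nrm_ge0.
    have -> : nrm B * (e / c * nrm A) = e * (nrm B * nrm A) / c by ring.
    by rewrite ler_pdivrMr// ler_pM2l// /c; lra.
  - split=> // t' A B _; have [_ Z0 _] := Zsub t'.
    rewrite (_ : op_comp _ _ = 0)//; apply/val_inj/funext => x /=.
    by rewrite -[RHS]/(0 : W) -[LHS]/(B 0) linear0.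
  - move=> a S T' [DS hS] [DT' hT']; split; first exact: Dlin.
    move=> t' A B t't; rewrite op_comp_lin.
    by have [_ _ Zlin] := Zsub t'; apply: Zlin; [exact: hS|exact: hT'].
  - move=> A B S [DS hS]; split; first exact: Dideal.
    move=> t' A' B' t't.
    have -> : op_comp B' (op_comp (op_comp B (op_comp S A)) A') =
      op_comp (op_comp B' B) (op_comp S (op_comp A A')) by apply/val_inj/funext.
    exact: hS.
have JT t t' : J t (T t') <-> t < t'.
  split=> [[_ h]|tt']; last first.
    by split=> // s A B st; apply: ZT'; exact: le_lt_trans tt'.
  rewrite ltNge; apply/negP => t't; apply: (ZT t').
  have := h t' (op_id W) (op_id W) t't.
  by rewrite (_ : op_comp _ _ = T t')//; apply/val_inj/funext.
exists (range J); split.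
- move=> _ _ [s _ <-] [t _ <-].
  wlog st : s t / s <= t.
    move=> H; have [/H//|/ltW/H[]] := leP s t; [by right|by left].
  by right => S [DS hS]; split=> // t' A B t's; apply: hS; exact: le_trans st.
- apply: inj_card_eq => s t _ _ Jst.
  have [st|ts|//] := ltgtP s t.
  + by have := JT s t; rewrite Jst => /proj2/(_ st)/JT; rewrite ltxx.
  + by have := JT t s; rewrite -Jst => /proj2/(_ ts)/JT; rewrite ltxx.
- move=> _ [t _ <-]; split; first exact: Jideal.
  by move=> S [/DI].
Qed.

End chain.

(** * Comparison of finite sums and tails of bounded series *)

Section real_lemmas.
Context {R : realType}.

Lemma lnorm_mono (I : eqType) (p : R) (r : seq I) (u v : I -> R) : 0 < p ->
  (forall i, `|u i| <= `|v i|) -> lnorm p r u <= lnorm p r v.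
Proof.
move=> p0 uv; rewrite !lnormE; apply: le_powR; rewrite ?invr_ge0 ?(ltW p0) ?sum_powR_ge0//.
by apply: ler_sum => i _; apply: le_powR => //; exact: ltW.
Qed.

(** A non-sharp triangle inequality: |w| is at most twice the maximum of |u| and |v|, and the p-th
    power of the maximum is at most the sum of the p-th powers. *)
Lemma lnorm_quasi (I : eqType) (p : R) (r : seq I) (u v w : I -> R) A : 1 <= p ->
  0 <= A -> (forall i, `|w i| <= `|u i| + `|v i|) -> lnorm p r u <= A ->
  lnorm p r v <= A -> lnorm p r w <= 4 * A.
Proof.
move=> p1 A0 h uA vA; have p0 : 0 < p by lra.
apply: lnorm_le_powR => //; first by rewrite mulr_ge0.
apply: (@le_trans _ _ (\sum_(i <- r) 2 `^ p * (`|u i| `^ p + `|v i| `^ p))).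
  apply: ler_sum => i _; set m := Num.max `|u i| `|v i|.
  have um : `|u i| <= m by rewrite le_max lexx.
  have vm : `|v i| <= m by rewrite le_max lexx orbT.
  have m0 : 0 <= m by exact: le_trans um.
  apply: (@le_trans _ _ ((2 * m) `^ p)).
    by apply: le_powR; rewrite ?(ltW p0)//; have := h i; lra.
  rewrite powRM//; apply: ler_wpM2l; first exact: powR_ge0.
  by rewrite /m; case: (leP `|u i| `|v i|) => _; rewrite ?lerDl ?lerDr powR_ge0.
rewrite -mulr_sumr big_split /= -!(lnorm_powR _ _ p0).
have hu : lnorm p r u `^ p <= A `^ p by apply: le_powR; rewrite ?(ltW p0) ?lnorm_ge0.
have hv : lnorm p r v `^ p <= A `^ p by apply: le_powR; rewrite ?(ltW p0) ?lnorm_ge0.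
have -> : 4 * A = 2 * (2 * A) by ring.
rewrite powRM ?mulr_ge0//; apply: ler_wpM2l; first exact: powR_ge0.
rewrite powRM//; apply: le_trans (lerD hu hv) _.
have -> : A `^ p + A `^ p = 2 * A `^ p by ring.
apply: ler_wpM2r; first exact: powR_ge0.
by apply: le1r_powR => //; rewrite ler1n.
Qed.

(** A partial sum within [e] of the supremum of all partial sums leaves at most [e] for any later
    segment. *)
Lemma bounded_series_tail (u : nat -> R) (B : R) : (forall m, 0 <= u m) ->
  (forall N, \sum_(0 <= m < N) u m <= B) ->
  forall e, 0 < e -> exists M, forall M' N, (M <= M')%N -> \sum_(M' <= m < N) u m <= e.
Proof.
move=> u0 uB e e0; pose S := [set \sum_(0 <= m < N) u m | N in [set: nat]].
have hS : has_sup S.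
  split; first by exists (\sum_(0 <= m < 0) u m), 0%N.
  by exists B => _ [N _ <-].
have [_ [M _ <-] hM] := sup_adherent e0 hS; exists M => M' N MM'.
have [NM|MN] := leqP N M'; first by rewrite big_geq// ltW.
have : \sum_(0 <= m < N) u m <= sup S by apply: sup_upper_bound => //; exists N.
rewrite (@big_cat_nat _ _ _ M) //=; last exact: leq_trans MM' (ltnW MN).
rewrite (@big_cat_nat _ _ _ M' M) //=; last exact: ltnW.
have : 0 <= \sum_(M <= m < M') u m by apply: sumr_ge0.
lra.
Qed.

Lemma sum_subset_le (I : eqType) (s r : seq I) (F : I -> R) : uniq s -> uniq r ->
  (forall i, 0 <= F i) -> (forall i, i \in s -> i \in r \/ F i = 0) ->
  \sum_(i <- s) F i <= \sum_(i <- r) F i.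
Proof.
move=> us ur F0 sr.
have -> : \sum_(i <- s) F i = \sum_(i <- s | i \in r) F i.
  rewrite big_seq_cond [RHS]big_mkcond [LHS]big_mkcond; apply: eq_big_seq => i is_ /=.
  by rewrite is_; case: ifPn => // ir; have [h|//] := sr i is_; rewrite h in ir.
have -> : \sum_(i <- s | i \in r) F i = \sum_(i <- r | i \in s) F i.
  rewrite -[LHS]big_filter -[RHS]big_filter; apply: perm_big; apply: uniq_perm.
  - by rewrite filter_uniq.
  - by rewrite filter_uniq.
  - by move=> i; rewrite !mem_filter andbC.
by rewrite big_mkcond; apply: ler_sum => i _; case: ifP => // _.
Qed.

End real_lemmas.

(** * From real coefficients to coefficients in [K] *)

Section scalar_extension.
Context {R : realType} {K : numFieldType} {hK : nneg_sup_complete K}.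
Variable rp : real_part R K.
Local Notation nrm := (nrm rp).
Local Notation emb := (emb rp).
Local Notation re := (re rp).
Variables (V : normedModType K) (I : eqType) (r : seq I) (e : I -> V) (p D : R).
Hypotheses (p0 : 0 < p) (D0 : 0 <= D).
Hypothesis eD : forall b : I -> R,
  nrm (\sum_(v <- r) emb (b v) *: e v) <= D * lnorm p r b.

Lemma re_unit_le a : `|re (rp_u rp * a)| <= nrm a.
Proof.
apply: le_trans (le_re_nrm _ _) _; rewrite nrmM ler_piMl ?nrm_ge0//.
by rewrite le_nrm rmorph1 norm_u.
Qed.

(** [re_decomp] splits the coefficients into two real families dominated by their moduli; this costs
    the factor 2. *)
Lemma nrm_combination (a : I -> K) :
  nrm (\sum_(v <- r) a v *: e v) <= 2 * (D * lnorm p r (fun v => nrm (a v))).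
Proof.
have -> : \sum_(v <- r) a v *: e v = \sum_(v <- r) emb (re (a v)) *: e v +
    rp_v rp *: \sum_(v <- r) emb (re (rp_u rp * a v)) *: e v.
  rewrite scaler_sumr -big_split; apply: eq_bigr => v _ /=.
  by rewrite scalerA -scalerDl -re_decomp.
apply: le_trans (nrmD _ _ _) _; rewrite [2 * _]mulr_natl mulr2n.
have L0 b := lnorm_ge0 p r b.
apply: lerD.
  apply: le_trans (eD _) _; apply: ler_wpM2l => //; apply: lnorm_mono => // i.
  by apply: le_trans (le_re_nrm _ _) (ler_norm _).
rewrite nrmZ; apply: le_trans (_ : nrm (\sum_(v <- r) emb (re (rp_u rp * a v)) *: e v) <= _).
  by rewrite ler_piMl ?nrm_ge0// le_nrm rmorph1 norm_v.
apply: le_trans (eD _) _; apply: ler_wpM2l => //; apply: lnorm_mono => // i.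
by apply: le_trans (re_unit_le _) (ler_norm _).
Qed.

(** The dual of the upper l_p-estimate [eD]. [lnorm_dual] treats the real parts of the values of [f]
    and of their multiples by [rp_u], and [lnorm_quasi] recombines them. *)
Lemma lnorm_functional (q : R) (f : dual V) : 1 < q -> p^-1 + q^-1 = 1 ->
  lnorm q r (fun v => nrm (f (e v))) <= 4 * (D * nrm f).
Proof.
move=> q1 pq; have n0 := nrm_ge0 rp f.
have re_le (w : K) : nrm w <= 1 -> lnorm q r (fun v => re (w * f (e v))) <= D * nrm f.
  move=> w1; apply: (lnorm_dual p0 q1 pq); first by rewrite mulr_ge0.
  move=> b; have -> : \sum_(v <- r) b v * re (w * f (e v)) =
      re (w * f (\sum_(v <- r) emb (b v) *: e v)).
    rewrite linear_sum mulr_sumr raddf_sum; apply: eq_bigr => v _.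
    by rewrite linearZ -re_embM /= mulrCA.
  apply: le_trans (ler_norm _) _; apply: le_trans (le_re_nrm _ _) _.
  rewrite nrmM; apply: (@le_trans _ _ (nrm (f (\sum_(v <- r) emb (b v) *: e v)))).
    by rewrite ler_piMl ?nrm_ge0.
  apply: le_trans (nrm_op rp f _) _; rewrite mulrC [D * _ * _]mulrAC.
  exact: ler_wpM2r.
apply: (lnorm_quasi (u := fun v => re (1 * f (e v)))
  (v := fun v => re (rp_u rp * f (e v)))); rewrite ?(ltW q1) ?mulr_ge0//.
- by move=> v; rewrite mul1r (ger0_norm (nrm_ge0 rp _)); exact: nrm_le_re.
- by apply: re_le; rewrite le_nrm normr1 rmorph1.
- by apply: re_le; rewrite le_nrm norm_u rmorph1.
Qed.

End scalar_extension.

(** * Frames, their operators and the biduals of these *)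

Section bidual.
Context {R : realType} {K : numFieldType} {hK : nneg_sup_complete K}.
Variable rp : real_part R K.
Local Notation nrm := (nrm rp).

(** The canonical map into the bidual and its contractivity; it lets the estimates for biduals be
    used at vectors. *)
Lemma evaluation_exists (V : normedModType K) (x : V) :
  exists E : dual (dual V), E =1 (fun f : dual V => f x) /\ nrm E <= nrm x.
Proof.
have lE : linear (fun f : dual V => f x : K^o) by [].
have bE (f : dual V) : nrm (f x : K^o) <= nrm x * nrm f.
  by rewrite mulrC; exact: nrm_op.
have [E EE] := op_of_bounded lE bE; exists E; split=> //.
by apply: nrm_op_le => [|f]; rewrite ?nrm_ge0// EE.
Qed.

Lemma op_sumE (V W : normedModType K) (I : Type) (r : seq I) (F : I -> op V W) x :
  (\sum_(i <- r) F i) x = \sum_(i <- r) F i x.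
Proof.
elim: r => [|i r IH]; first by rewrite !big_nil.
by rewrite !big_cons -IH.
Qed.

Lemma adjointD (V W : normedModType K) (a : K) (S T : op V W) :
  adjoint (a *: S + T) = a *: adjoint S + adjoint T.
Proof.
apply/val_inj/funext => f; apply/val_inj/funext => x /=.
by rewrite op_linear.
Qed.

Lemma adjoint_comp (U V W : normedModType K) (B : op V W) (A : op U V) :
  adjoint (op_comp B A) = op_comp (adjoint A) (adjoint B).
Proof. by apply/val_inj/funext => f; apply/val_inj/funext. Qed.

Lemma nrm_adjoint (V W : normedModType K) (T : op V W) : nrm (adjoint T) <= nrm T.
Proof.
apply: nrm_op_le => [|f]; first exact: nrm_ge0.
apply: nrm_op_le => [|x]; first by rewrite mulr_ge0 ?nrm_ge0.
apply: le_trans (nrm_op rp f (T x)) _.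
rewrite [nrm T * _]mulrC -mulrA; apply: ler_wpM2l; first exact: nrm_ge0.
exact: nrm_op.
Qed.

Lemma dominated_subspace (V W : normedModType K) :
  closed_subspace rp [set S : op V W | dominated rp S].
Proof.
split; first by move=> S h; apply: dominated_approx => e /h.
  exact: dominated0.
by move=> a S T dS dT; apply: dominatedD => //; exact: dominatedZ.
Qed.

Lemma adjoint_dominated_subspace (V W : normedModType K) :
  closed_subspace rp [set S : op V W | dominated rp (adjoint S)].
Proof.
have adj0 : adjoint (0 : op V W) = 0.
  by have := adjointD 1 (0 : op V W) 0; rewrite !scale1r addr0 => /esym/(canRL (addrK _)) ->; rewrite subrr.
split.
- move=> S h; apply: dominated_approx => e /h[T dT ST]; exists (adjoint T) => //.
  apply: le_trans ST; apply: le_trans (nrm_adjoint _).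
  have := adjointD (-1) T S; rewrite !scaleN1r [- T + S]addrC [- _ + _]addrC => ->.
  exact: lexx.
- by rewrite /= adj0; exact: dominated0.
- move=> a S T dS dT; rewrite /= adjointD.
  by apply: dominatedD => //; exact: dominatedZ.
Qed.

End bidual.

Section frames.
Context {R : realType} {K : numFieldType} {hK : nneg_sup_complete K}.
Variable rp : real_part R K.
Local Notation nrm := (nrm rp).
Local Notation emb := (emb rp).
Variables (p P q0 q Q c : R).
Hypotheses (p0 : 0 < p) (pE : p^-1 = 2^-1 + c) (P2 : 2 < P) (PE : P^-1 = 2^-1 - c)
  (c0 : 0 < c) (q01 : 1 < q0) (q02 : q0 < 2) (q0q : q0 < q) (Q1 : 1 < Q)
  (q0Q : q0^-1 + Q^-1 = 1).
Variable W : normedModType K.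
Variables (z : nat * nat -> W) (Cz : R).
Hypothesis Cz0 : 0 <= Cz.
Hypothesis zP : forall M N (b : nat * nat -> R),
  nrm (\sum_(v <- blocks factorial M N) emb (b v) *: z v) <=
  Cz * lnorm q (blocks factorial M N) b.

(* [x n i] is the [i]-th normalized symmetric variable of the block [n], which has
   [n!] variables vanishing with probability [1 - (n!)^(- al)], and [a (n, i)] is
   biorthogonal to it; [2^-1 + c] and [2^-1 - c] are [p^-1] and the inverse of the
   conjugate exponent [P]. *)
Record frame (al C : R) (x : nat -> nat -> W) (a : nat * nat -> dual W)
    (T : op W W) : Prop := Frame {
  frame_ge0 : 0 <= C;
  frame_x : forall n (b : nat -> R),
    nrm (\sum_(0 <= i < n`!) emb (b i) *: x n i) <= C * lnorm p (index_iota 0 n`!) b;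
  frame_x2 : forall n (b : nat -> R),
    nrm (\sum_(0 <= i < n`!) emb (b i) *: x n i) <=
    C * ((n`!)%:R `^ (al * c) * lnorm 2 (index_iota 0 n`!) b);
  frame_a : forall M N (b : nat * nat -> R),
    nrm (\sum_(v <- blocks factorial M N) emb (b v) *: a v) <=
    C * lnorm Q (blocks factorial M N) b;
  frame_a2 : forall n N (b : nat * nat -> R),
    nrm (\sum_(v <- blocks factorial n N) emb (b v) *: a v) <=
    C * (lnorm P (blocks factorial n N) b +
         (n`!)%:R `^ (- (al * c)) * lnorm 2 (blocks factorial n N) b);
  frame_Tx : forall n i, (i < n`!)%N -> T (x n i) = z (n, i);
  frame_T : forall (w : W) (e : R), 0 < e -> exists M, forall N, (M <= N)%N ->
    nrm (T w - \sum_(v <- blocks factorial 0 N) a v w *: z v) <= e }.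

Section one_frame.
Variables (al C : R) (x : nat -> nat -> W) (a : nat * nat -> dual W) (T : op W W).
Hypothesis fr : frame al C x a T.
Let C0 : 0 <= C := frame_ge0 fr.

Lemma frame_bidual M N (beta : dual (dual W)) :
  lnorm q0 (blocks factorial M N) (fun v => nrm (beta (a v))) <= 4 * (C * nrm beta).
Proof.
apply: (lnorm_functional (p := Q)) => //.
- exact: lt_trans ltr01 Q1.
- exact: (frame_a fr M N).
- by rewrite addrC.
Qed.

Lemma frame_dual M N (w : W) :
  lnorm q0 (blocks factorial M N) (fun v => nrm (a v w)) <= 4 * (C * nrm w).
Proof.
have [E [EE En]] := evaluation_exists rp w.
have := frame_bidual M N E.
have -> : (fun v => nrm (E (a v))) = (fun v => nrm (a v w)).
  by apply/funext => v; rewrite EE.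
move=> /le_trans; apply; apply: ler_wpM2l => //; exact: ler_wpM2l.
Qed.

(** A family bounded in l_q0 with a small supremum is small in l_q, since q0 < q, and the [z v]
    satisfy an upper l_q-estimate. *)
Lemma combination_interpolate (e : R) : 0 < e -> exists2 D : R, 0 <= D &
  forall N (g : nat * nat -> K) (A t : R),
  lnorm q0 (blocks factorial 0 N) (fun v => nrm (g v)) <= A -> 0 <= t ->
  (forall v, (v.2 < v.1`!)%N -> nrm (g v) <= t) ->
  nrm (\sum_(v <- blocks factorial 0 N) g v *: z v) <= e * A + D * t.
Proof.
move=> e0; have Cz0' := Cz0; have d0 : 0 < e / (2 * Cz + 1) by rewrite divr_gt0//; lra.
have q00 : 0 < q0 by exact: lt_trans ltr01 q01.
have [D D0 hD] := @lnorm_interpolate R (nat * nat)%type _ _ _ q00 q0q d0.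
exists (2 * Cz * D) => [|N g A t gA t0 gt]; first by rewrite !mulr_ge0.
have A0 : 0 <= A := le_trans (lnorm_ge0 _ _ _) gA.
apply: le_trans (nrm_combination (lt_trans q00 q0q) Cz0 (zP 0 N) g) _.
have gt' i : i \in blocks factorial 0 N -> `|nrm (g i)| <= t.
  by rewrite mem_blocks => /andP[_ iv]; rewrite ger0_norm ?nrm_ge0// gt.
have h := hD _ (fun v => nrm (g v)) _ _ gA t0 gt'; rewrite mulrA.
apply: le_trans (ler_wpM2l _ h) _; first by rewrite mulr_ge0.
rewrite mulrDr [2 * Cz * (D * t)]mulrA lerD2r mulrA.
apply: ler_wpM2r => //; rewrite mulrA ler_pdivrMr; last lra.
by rewrite mulrC ler_pM2l//; lra.
Qed.

(** The frame says nothing about [a (m, i)] with i >= m!; these are replaced by 0 to obtain a family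
    over all pairs. *)
Definition masked v : dual W := if (v.2 < v.1`!)%N then a v else 0.

Lemma masked_summable (U : normedModType K) (g : nat * nat -> dual U) :
  (forall v, ~~ (v.2 < v.1`!)%N -> g v = 0) ->
  (forall N (w : U), lnorm q0 (blocks factorial 0 N) (fun v => nrm (g v w)) <=
    4 * (C * nrm w)) ->
  square_summable rp g ((4 * C) ^+ 2).
Proof.
move=> g0 gq w s us; pose N := (\max_(v <- s) v.1).+1.
have h : \sum_(v <- s) nrm (g v w) ^+ 2 <= \sum_(v <- blocks factorial 0 N) nrm (g v w) ^+ 2.
  apply: sum_subset_le => //; first exact: uniq_blocks.
    by move=> v; exact: sqr_ge0.
  move=> v vs; have [v2|/g0 v2] := boolP (v.2 < v.1`!)%N; [left|right].
    by rewrite mem_blocks v2 andbT /= ltnS; exact: leq_bigmax_seq.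
  by rewrite v2 nrm0 expr0n.
apply: le_trans h _; rewrite -sqr_lnorm2 -exprMn.
rewrite lerXn2r ?nnegrE ?lnorm_ge0 ?mulr_ge0 ?nrm_ge0//.
apply: le_trans (lnorm_anti _ _ (lt_trans ltr01 q01) (ltW q02)) _.
by rewrite -mulrA; exact: gq.
Qed.

Let off_block (s : R) N (g g' : nat * nat -> R) :
  (forall v, (v.2 < v.1`!)%N -> g v = g' v) ->
  lnorm s (blocks factorial 0 N) g = lnorm s (blocks factorial 0 N) g'.
Proof.
move=> gg; rewrite !lnormE; congr (_ `^ _); apply: eq_big_seq => v.
by rewrite mem_blocks => /andP[_ v2]; rewrite gg.
Qed.

(** [combination_interpolate] applies to the partial sums of the series of [T w], whose coefficients
    are bounded in l_q0 by [frame_dual]; then the sums converge. *)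
Lemma frame_bound (e : R) : 0 < e -> exists2 D : R, 0 <= D &
  forall (w : W) (t : R), 0 <= t -> (forall v, nrm (masked v w) <= t) ->
  nrm (T w) <= e * nrm w + D * t.
Proof.
move=> e0; have C0' := C0; have d0 : 0 < e / (4 * C + 1) by rewrite divr_gt0//; lra.
have [D D0 hD] := combination_interpolate d0; exists D => // w t t0 ht.
apply/ler_addgt0Pr => h h0; have [M /(_ M (leqnn M)) hM] := frame_T fr w h0.
have := hD M (fun v => a v w) (4 * (C * nrm w)) t (frame_dual 0 M w) t0.
have av v : (v.2 < v.1`!)%N -> nrm (a v w) <= t.
  by move=> v2; have := ht v; rewrite /masked v2.
move=> /(_ av); set S := \sum_(v <- _) _ in hM * => hS.
have : nrm (T w) <= nrm (T w - S) + nrm S by rewrite -[T w](subrK S) addrK; exact: nrmD.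
have : e / (4 * C + 1) * (4 * (C * nrm w)) <= e * nrm w.
  rewrite !mulrA; apply: ler_wpM2r; first exact: nrm_ge0.
  rewrite -mulrA mulrAC ler_pdivrMr; last lra.
  by rewrite ler_pM2l//; lra.
lra.
Qed.

Lemma frame_dominated : dominated rp T.
Proof.
move=> e e0; have [D D0 hD] := frame_bound e0.
exists (nat * nat)%type, masked, ((4 * C) ^+ 2), D; split=> //.
apply: masked_summable => [v /negbTE v2|N w]; first by rewrite /masked v2.
rewrite (off_block _ _ (g' := fun v => nrm (a v w))); first exact: frame_dual.
by move=> v v2; rewrite /masked v2.
Qed.

(** The series of the adjoint converges in norm at [h]: as q0 < q, the [z v] also satisfy an upper
    l_q0-estimate, so the values [h (z v)] form a family in l_Q, and the [a v] satisfy an upper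
    l_Q-estimate. *)
Lemma frame_adjoint_tail (h : dual W) (e : R) : 0 < e ->
  exists N, nrm (op_comp h T - \sum_(v <- blocks factorial 0 N) h (z v) *: a v) <= e.
Proof.
move=> e0; have C0' := C0; have q00 : 0 < q0 by exact: lt_trans ltr01 q01.
have Q0 : 0 < Q by exact: lt_trans ltr01 Q1.
have zq0 M N (b : nat * nat -> R) :
    nrm (\sum_(v <- blocks factorial M N) emb (b v) *: z v) <=
    Cz * lnorm q0 (blocks factorial M N) b.
  apply: le_trans (zP _ _ _) _; apply: ler_wpM2l => //.
  by apply: lnorm_anti => //; exact: ltW.
have hz N := lnorm_functional q00 Cz0 (zq0 0%N N) h Q1 q0Q.
pose u m : R := \sum_(0 <= i < m`!) nrm (h (z (m, i))) `^ Q.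
have u0 m : 0 <= u m by apply: sumr_ge0 => i _; exact: powR_ge0.
have uE M N : \sum_(M <= m < N) u m =
    lnorm Q (blocks factorial M N) (fun v => nrm (h (z v))) `^ Q.
  rewrite lnorm_powR// big_blocks; apply: eq_bigr => m _; apply: eq_bigr => i _.
  by rewrite ger0_norm ?nrm_ge0.
have uB N : \sum_(0 <= m < N) u m <= (4 * (Cz * nrm h)) `^ Q.
  by rewrite uE; apply: le_powR; rewrite ?lnorm_ge0 ?(ltW Q0).
pose d := e / (2 * C + 1); have d0 : 0 < d by rewrite divr_gt0//; lra.
have [M hM] := bounded_series_tail u0 uB (powR_gt0 Q d0).
exists M; apply: nrm_op_le => [|w]; first exact: ltW.
have tail N : (M <= N)%N ->
    nrm (\sum_(v <- blocks factorial M N) h (z v) *: a v) <= e.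
  move=> MN; apply: le_trans (nrm_combination Q0 C0 (frame_a fr M N) _) _.
  have : lnorm Q (blocks factorial M N) (fun v => nrm (h (z v))) <= d.
    apply: (powR_le_swap Q0); rewrite ?lnorm_ge0 ?(ltW d0)//.
    by rewrite -uE hM.
  move=> /(ler_wpM2l C0) h1.
  have : 2 * (C * d) <= e.
    rewrite /d !mulrA ler_pdivrMr; last lra.
    by rewrite mulrC ler_pM2l//; lra.
  lra.
apply/ler_addgt0Pr => t t0; have n0 := nrm_ge0 rp h.
have d1 : 0 < t / (nrm h + 1) by rewrite divr_gt0//; lra.
have [M' hM'] := frame_T fr w d1; pose N := maxn M M'.
have MN : (M <= N)%N by exact: leq_maxl.
have := hM' N (leq_maxr _ _); set S := \sum_(v <- _) _ => hS.
have -> : (op_comp h T - \sum_(v <- blocks factorial 0 M) h (z v) *: a v) w =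
    h (T w - S) + (\sum_(v <- blocks factorial M N) h (z v) *: a v) w.
  rewrite -[LHS]/(h (T w) - (\sum_(v <- blocks factorial 0 M) h (z v) *: a v) w).
  have hSE : h S = \sum_(v <- blocks factorial 0 N) h (z v) * a v w.
    by rewrite /S linear_sum; apply: eq_bigr => v _; rewrite linearZ /= mulrC.
  have -> : h (T w - S) = h (T w) - h S by rewrite linearB.
  rewrite !op_sumE hSE !big_blocks (@big_cat_nat _ _ _ M 0 N) //=.
  by rewrite opprD -!addrA addNr addr0.
apply: le_trans (nrmD _ _ _) _; rewrite addrC; apply: lerD.
  by apply: le_trans (nrm_op rp _ _) _; apply: ler_wpM2r; [exact: nrm_ge0|exact: tail].
apply: le_trans (nrm_op rp _ _) _; apply: le_trans (ler_wpM2l n0 hS) _.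
rewrite mulrA ler_pdivrMr; last lra.
by rewrite mulrC ler_pM2l//; lra.
Qed.

(** By [frame_adjoint_tail], the value at [h] is approximated by [h] of the combination of the [z v]
    with coefficients [beta (a v)]. These coefficients are bounded in l_q0, and the argument of
    [frame_bound] applies. *)
Lemma frame_adjoint_bound (e : R) : 0 < e -> exists2 D : R, 0 <= D &
  forall (beta : dual (dual W)) (t : R), 0 <= t -> (forall v, nrm (beta (masked v)) <= t) ->
  nrm (adjoint (adjoint T) beta) <= e * nrm beta + D * t.
Proof.
move=> e0; have C0' := C0; have d0 : 0 < e / (4 * C + 1) by rewrite divr_gt0//; lra.
have [D D0 hD] := combination_interpolate d0; exists D => // beta t t0 ht.
have b0 := nrm_ge0 rp beta.
apply: nrm_op_le => [|h]; first by rewrite addr_ge0 ?mulr_ge0// ltW.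
have h0 := nrm_ge0 rp h.
rewrite -[adjoint _ _ _]/(beta (op_comp h T)).
apply/ler_addgt0Pr => r r0.
have d1 : 0 < r / (nrm beta + 1) by rewrite divr_gt0//; lra.
have [N hN] := frame_adjoint_tail h d1.
set S := \sum_(v <- _) _ in hN.
have bv v : (v.2 < v.1`!)%N -> nrm (beta (a v)) <= t.
  by move=> v2; have := ht v; rewrite /masked v2.
have hS := hD N (fun v => beta (a v)) _ t (frame_bidual 0 N beta) t0 bv.
have bS : beta S = h (\sum_(v <- blocks factorial 0 N) beta (a v) *: z v).
  transitivity (\sum_(v <- blocks factorial 0 N) h (z v) * beta (a v)).
    by rewrite /S linear_sum; apply: eq_bigr => v _; rewrite linearZ.
  by rewrite linear_sum; apply: eq_bigr => v _; rewrite linearZ /= mulrC.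
have -> : beta (op_comp h T) = beta (op_comp h T - S) + beta S.
  by rewrite linearB subrK.
apply: le_trans (nrmD _ _ _) _; rewrite addrC; apply: lerD; last first.
  apply: le_trans (nrm_op rp _ _) _; apply: le_trans (ler_wpM2l b0 hN) _.
  rewrite mulrA ler_pdivrMr; last lra.
  by rewrite mulrC ler_pM2l//; lra.
rewrite bS; apply: le_trans (nrm_op rp _ _) _; rewrite mulrC; apply: ler_wpM2r => //.
apply: le_trans hS _; rewrite lerD2r !mulrA; apply: ler_wpM2r => //.
rewrite -mulrA mulrAC ler_pdivrMr; last lra.
by rewrite ler_pM2l//; lra.
Qed.

Lemma frame_adjoint_dominated : dominated rp (adjoint (adjoint T)).
Proof.
move=> e e0; have [D D0 hD] := frame_adjoint_bound e0.
(* The dominating functionals on the bidual are the evaluations at the masked functionals. *)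
have [E hE] := choice (fun v => evaluation_exists rp (masked v)).
exists (nat * nat)%type, E, ((4 * C) ^+ 2), D; split=> //; last first.
  by move=> beta t t0 h; apply: hD => // v; have := h v; rewrite (hE v).1.
apply: masked_summable => [v /negbTE v2|N beta].
  by apply/val_inj/funext => g /=; rewrite (hE v).1 /masked v2 linear0.
have -> : (fun v => nrm (E v beta)) = (fun v => nrm (beta (masked v))).
  by apply/funext => v; rewrite (hE v).1.
rewrite (off_block _ _ (g' := fun v => nrm (beta (a v)))); first exact: frame_bidual.
by move=> v v2; rewrite /masked v2.
Qed.

End one_frame.
End frames.

Section delta.
Context {R : realType}.

Lemma lnorm_delta (I : eqType) (p : R) (r : seq I) i : 0 < p -> uniq r -> i \in r ->
  lnorm p r (fun l => (l == i)%:R) = 1.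
Proof.
move=> p0 ur ir; rewrite lnormE (bigD1_seq i) //= eqxx normr1 powR1.
rewrite big1 ?addr0 ?powR1// => l /negbTE ->.
by rewrite normr0 powR0 ?gt_eqF.
Qed.

Lemma sum_delta (S : pzRingType) (V : lmodType S) (g : {rmorphism R -> S}) (I : eqType)
    (r : seq I) (e : I -> V) i :
  uniq r -> i \in r -> \sum_(l <- r) g (l == i)%:R *: e l = e i.
Proof.
move=> ur ir; rewrite (bigD1_seq i) //= eqxx rmorph1 scale1r.
by rewrite big1 ?addr0// => l /negbTE ->; rewrite rmorph0 scale0r.
Qed.

End delta.

(** * Averages over blocks that tend to zero *)

Section vanishing.
Context {R : realType} {K : numFieldType} {hK : nneg_sup_complete K}.

Variable rp : real_part R K.
Local Notation nrm := (nrm rp).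

Definition small_average (g : nat -> nat -> R) := forall d : R, 0 < d ->
  exists n0, forall n, (n0 <= n)%N -> \sum_(0 <= i < n`!) g n i <= d * (n`!)%:R.

(** The uniform bound [M] on the functionals makes the condition stable under limits in norm. *)
Lemma small_average_subspace (V : normedModType K) (F : nat -> nat -> V -> K^o) (M : R) :
  0 <= M -> (forall n i a x y, F n i (a *: x + y) = a *: F n i x + F n i y) ->
  (forall n i x, (i < n`!)%N -> nrm (F n i x) <= M * nrm x) ->
  closed_subspace rp [set x | small_average (fun n i => nrm (F n i x))].
Proof.
move=> M0 Flin FM.
have FD n i x y : nrm (F n i (x + y)) <= nrm (F n i x) + nrm (F n i y).
  by rewrite -[x in x + y]scale1r Flin scale1r nrmD.
have F0 n i : F n i 0 = 0.
  by have := Flin n i 1 0 0; rewrite !scale1r addr0 => /esym/(canRL (addrK _)); rewrite subrr.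
have sumC n (d : R) : \sum_(0 <= i < n`!) d = d * (n`!)%:R.
  by rewrite big_const_nat subn0 iter_addr_0 mulr_natr.
split.
- move=> x h d d0; have d2 : 0 < d / 2 by rewrite divr_gt0.
  have dM : 0 < d / 2 / (M + 1) by rewrite divr_gt0//; lra.
  have [y /(_ _ d2)[n0 hn] xy] := h _ dM; exists n0 => n /hn {}hn.
  apply: (@le_trans _ _ (\sum_(0 <= i < n`!) (d / 2 + nrm (F n i y)))).
    apply: ler_sum_nat => i /andP[_ ik].
    rewrite -{1}(subrK y x); apply: le_trans (FD _ _ _ _) _; rewrite lerD2r.
    apply: le_trans (FM _ _ _ ik) _; apply: le_trans (ler_wpM2l M0 xy) _.
    rewrite mulrA ler_pdivrMr; last lra.
    by rewrite mulrC ler_pM2l//; lra.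
  by rewrite big_split /= sumC; lra.
- move=> d d0; exists 0%N => n _; rewrite big1 ?mulr_ge0 ?ler0n ?(ltW d0)// => i _.
  by rewrite F0 nrm0.
- move=> a x y hx hy d d0; have a0 := nrm_ge0 rp a.
  have d1 : 0 < d / 2 / (nrm a + 1) by rewrite !divr_gt0//; lra.
  have d2 : 0 < d / 2 by rewrite divr_gt0.
  have [n1 h1] := hx _ d1; have [n2 h2] := hy _ d2.
  exists (maxn n1 n2) => n; rewrite geq_max => /andP[/h1 {}h1 /h2 {}h2].
  apply: (@le_trans _ _ (\sum_(0 <= i < n`!) (nrm a * nrm (F n i x) + nrm (F n i y)))).
    by apply: ler_sum => i _; rewrite Flin -nrmZ nrmD.
  rewrite big_split /= -mulr_sumr.
  have : nrm a * (\sum_(0 <= i < n`!) nrm (F n i x)) <= d / 2 * (n`!)%:R.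
    apply: le_trans (ler_wpM2l a0 h1) _; rewrite mulrA; apply: ler_wpM2r; rewrite ?ler0n//.
    rewrite mulrA ler_pdivrMr; last lra.
    by rewrite mulrC ler_pM2l//; lra.
  by lra.
Qed.

End vanishing.

(** * Composing frames with different exponents *)

Section two_frames.
Context {R : realType} {K : numFieldType} {hK : nneg_sup_complete K}.
Variable rp : real_part R K.
Local Notation nrm := (nrm rp).
Local Notation emb := (emb rp).
Local Notation re := (re rp).
Variables (p P q0 q Q c : R).
Hypotheses (p0 : 0 < p) (pE : p^-1 = 2^-1 + c) (P2 : 2 < P) (PE : P^-1 = 2^-1 - c)
  (c0 : 0 < c) (q01 : 1 < q0) (q02 : q0 < 2) (q0q : q0 < q) (Q1 : 1 < Q)
  (q0Q : q0^-1 + Q^-1 = 1).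
Variable W : normedModType K.
Variables (z : nat * nat -> W) (Cz : R).
Hypothesis Cz0 : 0 <= Cz.
Hypothesis zP : forall M N (b : nat * nat -> R),
  nrm (\sum_(v <- blocks factorial M N) emb (b v) *: z v) <=
  Cz * lnorm q (blocks factorial M N) b.
Local Notation frame := (frame rp p P Q c z).

Lemma frame_x_le al C x a T n i : frame al C x a T -> (i < n`!)%N -> nrm (x n i) <= C.
Proof.
move=> fr ik; have ir : i \in index_iota 0 n`! by rewrite mem_index_iota.
have := frame_x fr n (fun l => (l == i)%:R).
by rewrite (sum_delta _ _ (iota_uniq _ _) ir) (lnorm_delta p0 (iota_uniq _ _) ir) mulr1.
Qed.

Lemma frame_a_le al C x a T v : frame al C x a T -> (v.2 < v.1`!)%N -> nrm (a v) <= C.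
Proof.
move=> fr v2; have ir : v \in blocks factorial v.1 v.1.+1.
  by rewrite mem_blocks leqnn ltnSn v2.
have := frame_a fr v.1 v.1.+1 (fun l => (l == v)%:R).
have Q0 : 0 < Q := lt_trans ltr01 Q1.
by rewrite (sum_delta _ _ (uniq_blocks _ _ _) ir) (lnorm_delta Q0 (uniq_blocks _ _ _) ir) mulr1.
Qed.

Variables (al C : R) (x : nat -> nat -> W) (a : nat * nat -> dual W) (T : op W W).
Variables (al' C' : R) (x' : nat -> nat -> W) (a' : nat * nat -> dual W) (T' : op W W).
Hypotheses (fr : frame al C x a T) (fr' : frame al' C' x' a' T').
Hypotheses (al0 : 0 <= al) (al1 : al < 1) (alal' : al < al').

(** [trace_small] is applied to the real parts of the values multiplied by 1 and by [rp_u]. As [B]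
    acts on the dual, it can be the adjoint of a factor on [W] or a factor on the dual itself. *)
Lemma frame_trace (B : op (dual W) (dual W)) (d : R) : 0 < d ->
  exists n0, forall n, (n0 <= n)%N -> forall j : nat -> nat * nat,
  (forall i, ((j i).2 < (j i).1`!)%N) ->
  \sum_(0 <= i < n`!) nrm (B (a' (j i)) (x n i)) <= d * (n`!)%:R.
Proof.
move=> d0; have C0 := frame_ge0 fr; have C'0 := frame_ge0 fr'.
have B0 := nrm_ge0 rp B.
pose Lam := nrm B * C' * C; have Lam0 : 0 <= Lam by rewrite !mulr_ge0.
have d2 : 0 < d / 2 by rewrite divr_gt0.
have [n0 h] := trace_small p0 pE P2 PE c0 al0 al1 alal' Lam0 d2.
exists n0 => n /h {}h j jP.
have part (w : K) : nrm w <= 1 ->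
    \sum_(0 <= i < n`!) `|re (w * B (a' (j i)) (x n i))| <= d / 2 * (n`!)%:R.
  move=> w1; pose Psi v l : R := re (w * B (a' v) (x n l)).
  have re_le (k : K) : `|re (w * k)| <= nrm k.
    by apply: le_trans (le_re_nrm _ _) _; rewrite nrmM ler_piMl ?nrm_ge0.
  have PsiE v (eta : nat -> R) : \sum_(0 <= l < n`!) eta l * Psi v l =
      re (w * B (a' v) (\sum_(0 <= l < n`!) emb (eta l) *: x n l)).
    rewrite linear_sum mulr_sumr raddf_sum; apply: eq_bigr => l _.
    by rewrite linearZ -re_embM /= mulrCA.
  apply: (h Psi j jP).
    move=> v eta v2; rewrite PsiE; apply: le_trans (re_le _) _.
    apply: le_trans (nrm_op rp _ _) _; rewrite /Lam -mulrA.
    apply: ler_pM; rewrite ?nrm_ge0//; last exact: frame_x fr _ _.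
    apply: le_trans (nrm_op rp _ _) _; apply: ler_wpM2l => //; exact: frame_a_le fr' _.
  move=> N b eta; set r := blocks factorial n N.
  have -> : \sum_(v <- r) \sum_(0 <= l < n`!) b v * eta l * Psi v l =
      re (w * B (\sum_(v <- r) emb (b v) *: a' v)
        (\sum_(0 <= l < n`!) emb (eta l) *: x n l)).
    have Bsum (y : W) : B (\sum_(v <- r) emb (b v) *: a' v) y =
        \sum_(v <- r) emb (b v) * B (a' v) y.
      by rewrite linear_sum op_sumE; apply: eq_bigr => v _; rewrite linearZ.
    rewrite Bsum.
    rewrite mulr_sumr raddf_sum; apply: eq_bigr => v _.
    rewrite mulrCA re_embM -PsiE mulr_sumr.
    by apply: eq_bigr => l _; rewrite mulrA.
  apply: le_trans (re_le _) _; apply: le_trans (nrm_op rp _ _) _.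
  apply: le_trans (ler_pM (nrm_ge0 _ _) (nrm_ge0 _ _) (nrm_op rp B _) (frame_x2 fr _ _)) _.
  have -> : Lam = nrm B * C' * C by [].
  have -> (s t : R) : nrm B * C' * C * s * t = nrm B * (C' * s) * (C * t) by ring.
  apply: ler_wpM2r; first by rewrite mulr_ge0// mulr_ge0 ?powR_ge0 ?lnorm_ge0.
  by apply: ler_wpM2l => //; exact: (frame_a2 fr').
have w1 := part 1 ltac:(by rewrite le_nrm normr1 rmorph1).
have wu := part (rp_u rp) ltac:(by rewrite le_nrm norm_u rmorph1).
apply: (@le_trans _ _ (\sum_(0 <= i < n`!) (`|re (1 * B (a' (j i)) (x n i))| +
    `|re (rp_u rp * B (a' (j i)) (x n i))|))).
  by apply: ler_sum => i _; rewrite mul1r; exact: nrm_le_re.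
by rewrite big_split /=; lra.
Qed.

(** For every [i] an index [v] is chosen at which the masked functionals nearly attain their
    supremum. This defines an assignment [j] as in [frame_trace], and the domination of [g] does the
    rest. *)
Lemma frame_average (B : op (dual W) (dual W)) (g : nat -> nat -> R) (H : R) : 0 <= H ->
  (forall e : R, 0 < e -> exists2 D : R, 0 <= D & forall n i t, (i < n`!)%N -> 0 <= t ->
    (forall v, nrm (B (masked a' v) (x n i)) <= t) -> g n i <= e * H + D * t) ->
  small_average g.
Proof.
move=> H0 gH d d0.
have e0 : 0 < d / 2 / (H + 1) by rewrite !divr_gt0//; lra.
have [D D0 hD] := gH _ e0.
have d1 : 0 < d / 4 / (D + 1) by rewrite !divr_gt0//; lra.
have [n0 hn] := frame_trace B d1; exists n0 => n /hn {}hn.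
have sup_ex i : exists vt : (nat * nat) * R, [/\ (vt.1.2 < vt.1.1`!)%N, 0 <= vt.2,
    forall v, nrm (B (masked a' v) (x n i)) <= vt.2 &
    vt.2 <= nrm (B (a' vt.1) (x n i)) + d / 4 / (D + 1)].
  pose S := range (fun v => nrm (B (masked a' v) (x n i))).
  have hS : has_sup S.
    split; first by exists (nrm (B (masked a' (0, 0)) (x n i))%N), (0, 0)%N.
    exists (nrm B * C' * nrm (x n i)) => _ [v _ <-].
    apply: le_trans (nrm_op rp _ _) _; apply: ler_wpM2r; first exact: nrm_ge0.
    apply: le_trans (nrm_op rp _ _) _; apply: ler_wpM2l; first exact: nrm_ge0.
    rewrite /masked; case: ifP => v2; first exact: frame_a_le fr' v2.
    by rewrite nrm0 (frame_ge0 fr').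
  have [_ [v _ <-] hv] := sup_adherent d1 hS.
  have ub v' : nrm (B (masked a' v') (x n i)) <= sup S.
    by apply: sup_upper_bound => //; exists v'.
  have S0 : 0 <= sup S := le_trans (nrm_ge0 _ _) (ub v).
  have [v2|v2] := boolP (v.2 < v.1`!)%N.
    exists (v, sup S); split=> //=; move: hv; rewrite /masked v2; lra.
  (* If the near-maximizer is masked, the supremum is itself below the tolerance and any legal index
     serves; (0, 0) is legal because 0! = 1. *)
  exists ((0, 0)%N, sup S); split=> //=.
  move: hv; rewrite /masked (negbTE v2) linear0.
  rewrite (_ : (0 : dual W) (x n i) = 0)// nrm0.
  by have := nrm_ge0 rp (B (a' (0, 0)%N) (x n i)); lra.
have [vt hvt] := choice sup_ex.
have jP i : ((vt i).1.2 < (vt i).1.1`!)%N by case: (hvt i).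
have := hn (fun i => (vt i).1) jP; set S := \sum_(0 <= i < n`!) nrm (B (a' (vt i).1) (x n i)) => hS.
have sumC (k : R) : \sum_(0 <= i < n`!) k = k * (n`!)%:R.
  by rewrite big_const_nat subn0 iter_addr_0 mulr_natr.
apply: (@le_trans _ _ (\sum_(0 <= i < n`!) (d / 2 + D * (nrm (B (a' (vt i).1) (x n i)) +
    d / 4 / (D + 1))))).
  apply: ler_sum_nat => i /andP[_ ik]; have [_ t0 tub tle] := hvt i.
  apply: le_trans (hD _ _ _ ik t0 tub) _; apply: lerD; last exact: ler_wpM2l.
  by rewrite mulrAC ler_pdivrMr; [rewrite ler_pM2l//; lra|lra].
rewrite big_split /= sumC -mulr_sumr big_split /= sumC -/S.
have K0 : 0 <= (n`!)%:R :> R by rewrite ler0n.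
have hDd : D * (d / 4 / (D + 1)) <= d / 4.
  by rewrite mulrA ler_pdivrMr; [rewrite mulrC ler_pM2l//; lra|lra].
have h1 := ler_wpM2l D0 hS; have h2 := ler_wpM2r K0 hDd.
rewrite mulrA in h1; lra.
Qed.

Variables (f : nat * nat -> dual W) (Cf : R).
Hypotheses (Cf0 : 0 <= Cf) (f_le : forall v, nrm (f v) <= Cf).

(** [frame_average] is used with the adjoint of [A], whose values pair the functionals with
    [A (x n i)]; [frame_bound] supplies the domination. *)
Lemma frame_vanishing (A B : op W W) :
  small_average (fun n i => nrm (f (n, i) (op_comp B (op_comp T' A) (x n i)))).
Proof.
have A0 := nrm_ge0 rp A; have B0 := nrm_ge0 rp B; have C0 := frame_ge0 fr.
pose H := Cf * nrm B * (nrm A * C).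
have H0 : 0 <= H by rewrite !mulr_ge0.
apply: (@frame_average (adjoint A) _ H H0) => e e0.
have [D D0 hD] := frame_bound q01 q0q Q1 q0Q Cz0 zP fr' e0.
exists (Cf * nrm B * D) => [|n i t ik t0 ht]; first by rewrite !mulr_ge0.
apply: le_trans (nrm_op rp (f (n, i)) _) _.
have h := hD (A (x n i)) t t0 ht.
apply: (@le_trans _ _ (Cf * (nrm B * (e * (nrm A * C) + D * t)))).
  apply: ler_pM; rewrite ?nrm_ge0//; apply: le_trans (nrm_op rp B (T' (A (x n i)))) _.
  apply: ler_wpM2l => //; apply: le_trans h _; rewrite lerD2r; apply: ler_wpM2l; first exact: ltW.
  apply: le_trans (nrm_op rp A (x n i)) _; apply: ler_wpM2l => //.
  exact: frame_x_le fr ik.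
by rewrite /H le_eqVlt; apply/orP; left; apply/eqP; ring.
Qed.

(** The quantity is the second adjoint of [T'], taken at the evaluation at [x n i] composed with [B]
    and applied to [A (f (n, i))]; [frame_adjoint_bound] supplies the domination. *)
Lemma frame_adjoint_vanishing (A B : op (dual W) (dual W)) :
  small_average (fun n i => nrm (op_comp B (op_comp (adjoint T') A) (f (n, i)) (x n i))).
Proof.
have A0 := nrm_ge0 rp A; have B0 := nrm_ge0 rp B; have C0 := frame_ge0 fr.
pose H := nrm B * C * (nrm A * Cf).
have H0 : 0 <= H by rewrite !mulr_ge0.
apply: (@frame_average B _ H H0) => e e0.
have [D D0 hD] := frame_adjoint_bound q01 q0q Q1 q0Q Cz0 zP fr' e0.
exists (D * (nrm A * Cf)) => [|n i t ik t0 ht]; first by rewrite !mulr_ge0.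
have [E [EE En]] := evaluation_exists rp (x n i).
have h : nrm (adjoint (adjoint T') (op_comp E B)) <= e * nrm (op_comp E B) + D * t.
  by apply: hD => // v /=; rewrite EE.
have -> : op_comp B (op_comp (adjoint T') A) (f (n, i)) (x n i) =
    adjoint (adjoint T') (op_comp E B) (A (f (n, i))) by rewrite /= EE.
apply: le_trans (nrm_op rp _ _) _.
apply: (@le_trans _ _ ((e * (C * nrm B) + D * t) * (nrm A * Cf))).
  apply: ler_pM; rewrite ?nrm_ge0//.
    apply: le_trans h _; rewrite lerD2r; apply: ler_wpM2l; first exact: ltW.
    apply: le_trans (nrm_op_comp rp _ _) _; apply: ler_wpM2r => //.
    by apply: le_trans En _; exact: frame_x_le fr ik.
  by apply: le_trans (nrm_op rp _ _) _; exact: ler_wpM2l.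
by rewrite /H le_eqVlt; apply/orP; left; apply/eqP; ring.
Qed.

End two_frames.

(** * The two chains obtained from a family of frames *)

Section frames_chain.
Context {R : realType} {K : numFieldType} {hK : nneg_sup_complete K}.
Variable rp : real_part R K.
Local Notation nrm := (nrm rp).
Local Notation emb := (emb rp).
Variables (p P q0 q Q c : R).
Hypotheses (p0 : 0 < p) (pE : p^-1 = 2^-1 + c) (P2 : 2 < P) (PE : P^-1 = 2^-1 - c)
  (c0 : 0 < c) (q01 : 1 < q0) (q02 : q0 < 2) (q0q : q0 < q) (Q1 : 1 < Q)
  (q0Q : q0^-1 + Q^-1 = 1).
Variable W : normedModType K.
Variables (z : nat * nat -> W) (Cz : R).
Hypothesis Cz0 : 0 <= Cz.
Hypothesis zP : forall M N (b : nat * nat -> R),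
  nrm (\sum_(v <- blocks factorial M N) emb (b v) *: z v) <=
  Cz * lnorm q (blocks factorial M N) b.
Variables (f : nat * nat -> dual W) (Cf : R).
Hypotheses (f_le : forall v, nrm (f v) <= Cf) (fz : forall v, f v (z v) = 1).
Variables (al C : R -> R) (x : R -> nat -> nat -> W) (a : R -> nat * nat -> dual W)
  (T : R -> op W W).
Hypotheses (fr : forall t, frame rp p P Q c z (al t) (C t) (x t) (a t) (T t)).
Hypotheses (al0 : forall t, 0 <= al t) (al1 : forall t, al t < 1)
  (al_lt : forall t t', t < t' -> al t < al t').

Let Cf0 : 0 <= Cf. Proof. exact: le_trans (nrm_ge0 rp _) (f_le (0, 0)%N). Qed.

Let not_small_average (g : nat -> nat -> R) :
  (forall n i, (i < n`!)%N -> g n i = 1) -> ~ small_average g.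
Proof.
move=> g1 /(_ _ (divr_gt0 ltr01 (ltr0n _ 2)))[n /(_ n (leqnn n))].
have -> : \sum_(0 <= i < n`!) g n i = (n`!)%:R.
  rewrite (eq_big_nat _ _ (F2 := fun=> 1)); last by move=> i /andP[_ /g1].
  by rewrite big_const_nat subn0 iter_addr_0.
have : 0 < (n`!)%:R :> R by rewrite ltr0n fact_gt0.
lra.
Qed.

Lemma frames_chain_FSS : admits_continuum_chain R W FSS.
Proof.
apply: (@continuum_chain _ _ _ rp W _ [set S | dominated rp S] T
  (fun t => [set S | small_average (fun n i => nrm (f (n, i) (S (x t n i))))])).
- by move=> S; exact: dominated_FSS.
- exact: dominated_subspace.
- by move=> A B S; exact: dominated_comp.
- move=> t; apply: (@small_average_subspace R K rp (op W W)
    (fun n i S => f (n, i) (S (x t n i))) (Cf * C t)).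
  + by rewrite mulr_ge0// (frame_ge0 (fr t)).
  + by move=> n i k S S'; rewrite opD opZ linearP.
  + move=> n i S ik; apply: le_trans (nrm_op rp (f (n, i)) _) _.
    rewrite -mulrA; apply: ler_pM; rewrite ?nrm_ge0//.
    apply: le_trans (nrm_op rp S _) _; rewrite mulrC; apply: ler_wpM2r; first exact: nrm_ge0.
    exact: (frame_x_le p0 (fr t) ik).
- by move=> t; exact: (frame_dominated q01 q02 q0q Q1 q0Q Cz0 zP (fr t)).
(* [T t] sends [x t n i] to [z (n, i)], where [f (n, i)] equals 1, so all averages are 1. *)
- move=> t; apply: not_small_average => n i ik.
  by rewrite (frame_Tx (fr t) ik) fz /nrm normr1 -(rmorph1 emb) re_emb.
- move=> t t' A B tt'.
  exact: (frame_vanishing p0 pE P2 PE c0 q01 q0q Q1 q0Q Cz0 zP (fr t) (fr t')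
    (al0 t) (al1 t) (al_lt tt') Cf0 f_le).
Qed.

Lemma frames_chain_SSCS : admits_continuum_chain R (dual W) SSCS.
Proof.
apply: (@continuum_chain _ _ _ rp (dual W) _
  [set S | dominated rp (adjoint S)] (fun t => adjoint (T t))
  (fun t => [set S : op (dual W) (dual W) |
    small_average (fun n i => nrm (S (f (n, i)) (x t n i)))])).
- by move=> S /= dS; exact: (dominated_FSS dS).
- exact: adjoint_dominated_subspace.
- move=> A B S dS /=.
  have -> : adjoint (op_comp B (op_comp S A)) =
    op_comp (adjoint A) (op_comp (adjoint S) (adjoint B)) by rewrite !adjoint_comp; exact/val_inj.
  exact: dominated_comp.
- move=> t; apply: (@small_average_subspace R K rp (op (dual W) (dual W))
    (fun n i S => S (f (n, i)) (x t n i)) (Cf * C t)).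
  + by rewrite mulr_ge0// (frame_ge0 (fr t)).
  + by move=> n i k S S'; rewrite opD opZ.
  + move=> n i S ik; apply: le_trans (nrm_op rp (S (f (n, i))) _) _.
    rewrite mulrAC; apply: ler_pM; rewrite ?nrm_ge0//; last first.
      exact: (frame_x_le p0 (fr t) ik).
    by apply: le_trans (nrm_op rp S _) _; rewrite mulrC; apply: ler_wpM2r; rewrite ?nrm_ge0.
- by move=> t; exact: (frame_adjoint_dominated q01 q02 q0q Q1 q0Q Cz0 zP (fr t)).
- move=> t; apply: not_small_average => n i ik.
  by rewrite /= (frame_Tx (fr t) ik) fz /nrm normr1 -(rmorph1 emb) re_emb.
- move=> t t' A B tt'.
  exact: (frame_adjoint_vanishing p0 pE P2 PE c0 q01 q0q Q1 q0Q Cz0 zP (fr t) (fr t')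
    (al0 t) (al1 t) (al_lt tt') Cf0 f_le).
Qed.

End frames_chain.

(** * Copies of sequence spaces *)

Section hahn_banach.
Context {R : realType}.
Variable X : normedModType R.

(** Linear functionals on subspaces, dominated by the norm, as relations; single-valuedness follows
    from the last condition, applied to differences. This form suits Zorn's lemma, where unions of
    chains are taken. *)
Definition functional_graph (G : set (X * R)) :=
  [/\ G (0, 0), forall a u r v s, G (u, r) -> G (v, s) -> G (a *: u + v, a * r + s) &
      forall u r, G (u, r) -> r <= `|u|].

(** The value at [y] must lie above all r - |u - y| and below all |u + y| - r. By the triangle
    inequality every lower bound is below every upper one, so the supremum of the lower bounds is
    admissible. *)
Lemma extend_graph G y : functional_graph G -> exists H,
  [/\ functional_graph H, G `<=` H & exists c, H (y, c)].
Proof.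
move=> [G0 Glin Gle].
pose S := [set w.2 - `|w.1 - y| | w in G].
have S_ub u r : G (u, r) -> ubound S (`|u + y| - r).
  move=> Gu _ [[v s] Gv <-] /=.
  have := Gle _ _ (Glin 1 _ _ _ _ Gu Gv); rewrite scale1r mul1r => h.
  have : `|u + v| <= `|u + y| + `|v - y|.
    by apply: le_trans (ler_normD _ _); rewrite addrACA subrr addr0.
  lra.
have hS : has_sup S.
  by split; [exists (0 - `|0 - y|), (0, 0)|exists (`|0 + y| - 0); exact: S_ub].
pose c := sup S.
have c_ge u r : G (u, r) -> r - `|u - y| <= c.
  by move=> Gu; apply: sup_upper_bound => //; exists (u, r).
have c_le u r : G (u, r) -> c <= `|u + y| - r.
  by move=> Gu; apply: ge_sup; [exact: hS.1|exact: S_ub].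
have Gscale a u r : G (u, r) -> G (a *: u, a * r).
  by move=> /(Glin a _ _ _ _)/(_ G0); rewrite !addr0.
exists [set w | exists u r t, [/\ G (u, r), w.1 = u + t *: y & w.2 = r + t * c]].
split; last first.
- by exists c, 0, 0, 1; rewrite scale1r mul1r !add0r.
- by move=> [u r] Gu; exists u, r, 0; rewrite scale0r mul0r !addr0.
split.
- by exists 0, 0, 0; rewrite scale0r mul0r !addr0.
- move=> a u r v s [u1 [r1 [t1 /= [G1 -> ->]]]] [u2 [r2 [t2 /= [G2 -> ->]]]].
  exists (a *: u1 + u2), (a * r1 + r2), (a * t1 + t2) => /=; split.
  + exact: Glin.
  + by rewrite scalerDr scalerDl scalerA addrACA.
  + by ring.
move=> u r [v [s [t /= [Gv -> ->]]]].
have [t0|t0|->] := ltgtP t 0; last by rewrite scale0r mul0r !addr0 Gle.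
- pose k := - t; have k0 : 0 < k by rewrite oppr_gt0.
  have := c_ge _ _ (Gscale k^-1 _ _ Gv).
  have -> : v + t *: y = k *: (k^-1 *: v - y).
    by rewrite scalerBr scalerA mulfV ?gt_eqF// scale1r /k scaleNr opprK.
  rewrite normrZ gtr0_norm// => h; have := ler_wpM2l (ltW k0) h.
  rewrite mulrBr mulrA mulfV ?gt_eqF// mul1r /k; lra.
- have := c_le _ _ (Gscale t^-1 _ _ Gv).
  have -> : v + t *: y = t *: (t^-1 *: v + y).
    by rewrite scalerDr scalerA mulfV ?gt_eqF// scale1r.
  rewrite normrZ gtr0_norm// => h; have := ler_wpM2l (ltW t0) h.
  rewrite mulrBr mulrA mulfV ?gt_eqF// mul1r; lra.
Qed.

Lemma norming_functional (x : X) : exists f : dual X, f x = `|x| /\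
  forall y, `|f y| <= `|y|.
Proof.
pose T := {G : set (X * R) | functional_graph G /\ G (x, `|x|)}.
pose le (G H : T) := `[< sval G `<=` sval H >].
pose G0 : set (X * R) := [set w | exists t, w = (t *: x, t * `|x|)].
have G0P : functional_graph G0 /\ G0 (x, `|x|).
  split; last by exists 1; rewrite scale1r mul1r.
  split.
  - by exists 0; rewrite scale0r mul0r.
  - move=> a u r v s [t [-> ->]] [t' [-> ->]]; exists (a * t + t').
    by rewrite scalerA scalerDl mulrDl mulrA.
  - by move=> u r [t [-> ->]]; rewrite normrZ; apply: ler_wpM2r => //; exact: ler_norm.
have [M Mmax] : exists t, forall s, le t s -> s = t.
  apply: Zorn.
  - by move=> G; apply/asboolP.
  - by move=> G H I /asboolP GH /asboolP HI; apply/asboolP; exact: subset_trans HI.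
  - move=> [G gG] [H gH] /asboolP /= GH /asboolP HG.
    by apply: eq_exist; rewrite eqEsubset.
  move=> A tot; have [[H AH]|nA] := pselect (exists H, A H); last first.
    by exists (exist _ G0 G0P) => H AH; case: nA; exists H.
  pose U : set (X * R) := [set w | exists2 G, A G & sval G w].
  have UP : functional_graph U /\ U (x, `|x|).
    split; last by exists H => //; have [] := svalP H.
    split.
    - by exists H => //; have [[]] := svalP H.
    - move=> a u r v s [G AG Gu] [I AI Iv].
      have [/asboolP GI|/asboolP IG] := tot _ _ AG AI.
        by exists I => //; have [[_ Il _] _] := svalP I; apply: Il => //; exact: GI.
      by exists G => //; have [[_ Gl _] _] := svalP G; apply: Gl => //; exact: IG.
    - by move=> u r [G _ Gu]; have [[_ _ Gle] _] := svalP G; exact: Gle.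
  by exists (exist _ U UP) => G AG; apply/asboolP => w Gw; exists G.
case: M Mmax => M [gM Mx] Mmax.
(* The extension of the maximal graph to [y] coincides with it, so its domain is the whole space. *)
have Mtot y : exists r, M (y, r).
  have [H [gH MH [c Hc]]] := extend_graph y gM; exists c.
  have HP : functional_graph H /\ H (x, `|x|) by split=> //; exact: MH.
  have := Mmax (exist _ H HP); rewrite /le /= => /(_ _)/(congr1 sval) /= <- //.
  exact/asboolP.
have [M0 Mlin Mle] := gM.
have Mfun y r s : M (y, r) -> M (y, s) -> r = s.
  have key r1 s1 : M (y, r1) -> M (y, s1) -> s1 <= r1.
    move=> h1 h2; have := Mle _ _ (Mlin (-1) _ _ _ _ h1 h2).
    by rewrite scaleN1r addNr normr0 mulN1r; lra.
  by move=> h1 h2; apply/eqP; rewrite eq_le !key.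
have [g gP] := choice Mtot.
have lg : linear (g : X -> R^o).
  by move=> a u v; apply: (Mfun (a *: u + v)) => //; exact: Mlin.
have gN y : `|g y| <= `|y|.
  rewrite ler_norml Mle// andbT lerNl.
  by have := Mlin (-1) _ _ _ _ (gP y) M0; rewrite !addr0 mulN1r scaleN1r => /Mle; rewrite normrN.
have gN' (y : X) : nrm (real_part_real R) (g y : R^o) <= 1 * nrm (real_part_real R) y.
  by rewrite mul1r; exact: gN.
have [f fE] := op_of_bounded lg gN'.
exists f; split=> [|y]; rewrite fE//.
exact: (Mfun x).
Qed.

End hahn_banach.

Section ell_basis.
Context {R : realType}.
Variables (p : R) (p1 : 1 <= p).
Let p0 : 0 < p. Proof. exact: lt_le_trans ltr01 p1. Qed.
Implicit Types (w : ell p1) (u : nat -> R) (s : seq nat).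

Lemma ell_valP (a : R) w w' k :
  ell_val (a *: w + w') k = a * ell_val w k + ell_val w' k.
Proof. by []. Qed.

Lemma ell_val_sum (I : Type) (s : seq I) (c : I -> R) (e : I -> ell p1) k :
  ell_val (\sum_(i <- s) c i *: e i) k = \sum_(i <- s) c i * ell_val (e i) k.
Proof.
elim: s => [|i s IH]; first by rewrite !big_nil.
by rewrite !big_cons ell_valP IH.
Qed.

Lemma finite_eseries (f : nat -> R) N : (forall k, 0 <= f k) ->
  (forall k, (N <= k)%N -> f k = 0) ->
  (\sum_(k <oo) (f k)%:E = (\sum_(0 <= k < N) f k)%:E)%E.
Proof.
move=> f0 fN; rewrite (nneseries_split 0%N N); last by move=> k _; rewrite lee_fin.
rewrite add0n sumEFin eseries0 ?adde0// => k Nk _.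
by rewrite fN.
Qed.

Lemma ell_norm_finite w N : (forall k, (N <= k)%N -> ell_val w k = 0) ->
  `|w| = lnorm p (index_iota 0 N) (ell_val w).
Proof.
move=> wN; apply: EFin_inj; rewrite -[LHS]/((ell_norm w)%:E) ell_normE.
rewrite (@finite_eseries (fun k => `|ell_val w k| `^ p) N).
- by rewrite poweR_EFin lnormE.
- by move=> k; exact: powR_ge0.
- by move=> k /wN ->; rewrite normr0 powR0// gt_eqF.
Qed.

Lemma lnorm_le_ell_norm w s : uniq s -> lnorm p s (ell_val w) <= `|w|.
Proof.
move=> us; pose N := (\max_(j <- s) j).+1.
apply: (@le_trans _ _ (lnorm p (index_iota 0 N) (ell_val w))).
  rewrite !lnormE; apply: le_powR; rewrite ?invr_ge0 ?(ltW p0) ?sum_powR_ge0//.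
  apply: sum_subset_le => //; first exact: iota_uniq.
  by move=> i is_; left; rewrite mem_index_iota ltnS; exact: leq_bigmax_seq.
rewrite -lee_fin -[`|w|]/(ell_norm w) ell_normE lnormE -poweR_EFin.
apply: gt0_ler_poweR; rewrite ?invr_ge0 ?(ltW p0)//.
- by rewrite in_itv /= leey andbT lee_fin sum_powR_ge0.
- rewrite in_itv /= leey andbT; apply: nneseries_ge0 => k _ _.
  by rewrite lee_fin powR_ge0.
- rewrite -sumEFin; apply: nneseries_lim_ge => k _.
  by rewrite lee_fin powR_ge0.
Qed.

Lemma ell_unit_exists j : exists w, forall k, ell_val w k = (k == j)%:R.
Proof.
pose f : nat -> R := fun k => (k == j)%:R.
have fP : f \in Lfun (@counting nat R) p%:E.
  apply/andP; split.
    by rewrite inE /= => _ Y mY.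
  rewrite inE /= /finite_norm Lnorm_counting//.
  have := @finite_eseries (fun k => `|f k| `^ p) j.+1.
  move=> -> //; first by rewrite poweR_EFin ltry.
  move=> k jk; have kj : (k == j) = false by rewrite gtn_eqF.
  by rewrite /f kj normr0 powR0// gt_eqF.
by exists (Lfun_Sub (lee1_fin p1) fP).
Qed.

Lemma ell_basis_exists : exists e : nat -> ell p1,
  (forall j k, ell_val (e j) k = (k == j)%:R) /\
  forall s u, uniq s -> `|\sum_(j <- s) u j *: e j| <= lnorm p s u.
Proof.
have [e eE] := choice ell_unit_exists; exists e; split=> // s u us.
pose w := \sum_(j <- s) u j *: e j.
have wE k : ell_val w k = if k \in s then u k else 0.
  rewrite /w ell_val_sum; case: ifPn => ks.
    rewrite (bigD1_seq k) //= eE eqxx mulr1 big1 ?addr0// => j jk.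
    by rewrite eE eq_sym (negbTE jk) mulr0.
  rewrite big_seq big1// => j js; rewrite eE (_ : (k == j) = false) ?mulr0//.
  by apply: contraNF ks => /eqP ->.
pose N := (\max_(j <- s) j).+1.
have wN k : (N <= k)%N -> ell_val w k = 0.
  move=> Nk; rewrite wE; case: ifPn => // ks.
  have : (k <= \max_(j <- s) j)%N by exact: leq_bigmax_seq.
  by rewrite leqNgt Nk.
rewrite -/w (ell_norm_finite wN) !lnormE.
apply: le_powR; rewrite ?invr_ge0 ?(ltW p0) ?sum_powR_ge0//.
apply: (@le_trans _ _ (\sum_(k <- s) `|ell_val w k| `^ p)).
  apply: sum_subset_le => //; first exact: iota_uniq.
  move=> i _; rewrite wE; case: ifPn => is_; [by left|right].
  by rewrite normr0 powR0// gt_eqF.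
rewrite big_seq [leRHS]big_seq; apply: ler_sum => i is_.
by rewrite wE is_.
Qed.

End ell_basis.

Section copies.
Context {R : realType}.

Lemma c0_basis_exists (q : R) : 0 < q -> exists e : nat -> c0 R,
  (forall j, `|e j| = 1) /\
  forall (s : seq nat) u, uniq s -> `|\sum_(j <- s) u j *: e j| <= lnorm q s u.
Proof.
move=> q0; have eP j : (fun k => (k == j)%:R : R) \in c0_pred (R := R).
  rewrite unfold_in; apply/asboolP.
  apply/cvgrPdist_lt => e e0; exists j.+1 => //= k jk.
  by rewrite gtn_eqF// subrr normr0.
pose e j : c0 R := C0 (eP j); exists e; split.
  move=> j; apply/eqP; rewrite eq_le; apply/andP; split.
    apply: c0_norm_le => k /=.
    by rewrite normr_nat; case: (k == j); rewrite ?ler01 ?lexx.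
  by apply: le_trans (c0_norm_ub (e j) j); rewrite /= eqxx normr1.
move=> s u us; apply: c0_norm_le => k.
have -> : (\sum_(j <- s) u j *: e j : c0 R) k = \sum_(j <- s) u j * (k == j)%:R.
  elim: s {us} => [|j s IH]; first by rewrite !big_nil.
  by rewrite !big_cons -IH.
have [ks|ks] := boolP (k \in s).
  rewrite (bigD1_seq k) //= eqxx mulr1 big1 ?addr0; last first.
    by move=> j; rewrite eq_sym => /negbTE ->; rewrite mulr0.
  exact: lnorm_ub.
rewrite big_seq big1 ?normr0 ?lnorm_ge0// => j js.
rewrite (_ : (k == j) = false) ?mulr0//.
by apply: contraNF ks => /eqP ->.
Qed.

(** Continuity of the inverse at 0 gives a radius [d]; the vector is scaled until its image has norm
    d/2, and homogeneity gives the constant 2/d. *)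
Lemma copy_bound (Z X : normedModType R) (F : set X) (J : op Z X) (g : X -> Z) :
  range J = F -> cancel J g -> {within F, continuous g} ->
  exists2 C : R, 0 < C & forall z, `|z| <= C * `|J z|.
Proof.
move=> JF gJ /subspace_continuousP gc.
have F0 : F 0 by rewrite -JF; exists 0 => //; rewrite linear0.
have g0 : g 0 = 0 by rewrite -[in LHS](linear0 J) gJ.
have : g @ within F (nbhs 0) --> g 0 := gc 0 F0.
rewrite g0 => /cvgrPdist_lt/(_ 1 ltr01).
rewrite /prop_near1 /within /= => /nbhs_normP[d /= d0 hd].
exists (2 / d) => [|z]; first by rewrite divr_gt0.
have [Jz|Jz] := eqVneq (J z) 0.
  by have -> : z = 0; [rewrite -[LHS]gJ Jz|rewrite linear0 !normr0 mulr0].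
have Jz0 : 0 < `|J z| by rewrite normr_gt0.
pose t := d / (2 * `|J z|); have t0 : 0 < t by rewrite divr_gt0// mulr_gt0.
have := hd (J (t *: z)); rewrite /ball_ /= sub0r normrN linearZ /= normrZ gtr0_norm//.
have -> : t * `|J z| = d / 2 by rewrite /t; field; rewrite gt_eqF.
have d2 : d / 2 < d by lra.
move=> /(_ d2); rewrite -JF => /(_ _); rewrite -linearZ gJ sub0r normrN normrZ gtr0_norm//.
have Ft : exists2 x : Z, True & J x = J (t *: z) by exists (t *: z).
move=> /(_ Ft) h.
have : `|z| < 1 / t by rewrite ltr_pdivlMr// mulrC.
have -> : 1 / t = 2 / d * `|J z| by rewrite /t; field; rewrite !gt_eqF.
exact: ltW.
Qed.

(** What a copy of l_q or c_0 provides: vectors with an upper l_q-estimate, normed uniformly from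
    below by bounded functionals. *)
Definition target_system (q : R) (X : normedModType R) :=
  exists (z : nat -> X) (f : nat -> dual X) (Cz Cf : R), [/\ 0 <= Cz,
    forall (s : seq nat) u, uniq s -> `|\sum_(j <- s) u j *: z j| <= Cz * lnorm q s u,
    forall j, f j (z j) = 1 & forall j, `|f j| <= Cf].

(** The functionals are norming functionals of the images [J (e j)], rescaled; [copy_bound] keeps
    these images away from 0 and thus bounds the functionals. *)
Lemma copy_target (q : R) (Z X : normedModType R) (e : nat -> Z) : 0 < q ->
  (forall j, `|e j| = 1) ->
  (forall (s : seq nat) u, uniq s -> `|\sum_(j <- s) u j *: e j| <= lnorm q s u) ->
  contains_copy Z X -> target_system q X.
Proof.
move=> q0 e1 eP [F [_ [J [g [JF gJ gc]]]]].
have [C C0 hC] := copy_bound JF gJ gc.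
have [h hP] := choice (fun j => norming_functional (J (e j))).
have J0 j : 0 < `|J (e j)|.
  by rewrite -(pmulr_rgt0 _ C0); apply: lt_le_trans (hC (e j)); rewrite e1.
exists (fun j => J (e j)), (fun j => `|J (e j)|^-1 *: h j), `|J|, C; split=> //.
- move=> s u us; have -> : \sum_(j <- s) u j *: J (e j) = J (\sum_(j <- s) u j *: e j).
    by rewrite linear_sum; apply: eq_bigr => j _; rewrite linearZ.
  apply: le_trans (opnorm_bound J _) _; apply: ler_wpM2l; first exact: opnorm_ge0.
  exact: eP.
- by move=> j; rewrite opZ (hP j).1; apply: mulVf; rewrite gt_eqF.
- move=> j; rewrite normrZ ger0_norm ?invr_ge0// ler_pdivrMl//.
  apply: (@le_trans _ _ 1).
    by apply: opnorm_le => x x1; apply: le_trans ((hP j).2 x) _.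
  by rewrite mulrC; apply: le_trans (hC (e j)); rewrite e1.
Qed.

(** Lowering the exponent weakens the upper estimate, and the unit vectors of c_0 satisfy it for
    every exponent; this permits an exponent below 2 later on. *)
Lemma contains_target (q q1 : R) (h : 1 <= q) (X : normedModType R) :
  0 < q1 -> q1 <= q ->
  contains_copy (ell h) X \/ contains_copy (c0 R) X -> target_system q1 X.
Proof.
move=> q10 q1q [Xl|Xc].
  have q0 : 0 < q by exact: lt_le_trans q1q.
  have [e [eE eP]] := ell_basis_exists h.
  apply: (copy_target (e := e)) Xl => // [j|s u us].
    rewrite (@ell_norm_finite _ _ _ _ j.+1).
      rewrite (_ : ell_val (e j) = fun k => (k == j)%:R); last by apply/funext.
      by rewrite lnorm_delta ?iota_uniq// mem_index_iota ltnSn.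
    by move=> k jk; rewrite eE gtn_eqF.
  by apply: le_trans (eP s u us) _; exact: lnorm_anti.
have [e [e1 eP]] := c0_basis_exists q10.
exact: (copy_target (e := e)) Xc.
Qed.

Definition source_system (p P : R) (X : normedModType R) :=
  exists (e : nat -> X) (e' : nat -> dual X) (C C' : R), [/\ 0 <= C, 0 <= C',
    forall i j, e' i (e j) = (j == i)%:R,
    forall (s : seq nat) u, uniq s -> `|\sum_(j <- s) u j *: e j| <= C * lnorm p s u &
    forall (s : seq nat) u, uniq s -> `|\sum_(j <- s) u j *: e' j| <= C' * lnorm P s u].

(** The projection followed by the inverse of the embedding is a bounded operator onto l_p. Its
    coordinates are the biorthogonal functionals, and Hoelder's inequality yields their upper
    l_P-estimate. *)
Lemma contains_source (p P : R) (h : 1 <= p) (X : normedModType R) :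
  0 < P -> p^-1 + P^-1 = 1 ->
  contains_complemented_copy (ell h) X -> source_system p P X.
Proof.
move=> P0 pP [F [_ [J [g [JF gJ gc]]]] [Pr PrPr PrF]].
have p0 : 0 < p by exact: (lt_le_trans ltr01 h).
have [C C0 hC] := copy_bound JF gJ gc.
have [e [eE eP]] := ell_basis_exists h.
have Jg x : J (g (Pr x)) = Pr x.
  have : range J (Pr x) by rewrite JF -PrF; exists x.
  by move=> [w _ <-]; rewrite gJ.
have PrJ w : Pr (J w) = J w.
  have : range Pr (J w) by rewrite PrF -JF; exists w.
  by move=> [x _ <-]; rewrite -[LHS]/(op_comp Pr Pr x) PrPr.
pose k x := g (Pr x).
have klin : linear k.
  move=> a x y; rewrite /k -[RHS]gJ; congr g.
  by rewrite !linearP /= !Jg.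
pose D := C * `|Pr|; have D0 : 0 <= D by rewrite mulr_ge0// ltW.
have kD x : `|k x| <= D * `|x|.
  apply: le_trans (hC _) _; rewrite Jg -mulrA; apply: ler_wpM2l; first exact: ltW.
  exact: opnorm_bound.
have e'_ex j : exists f : dual X, forall x, f x = ell_val (k x) j.
  have fl : linear (fun x => ell_val (k x) j : R^o) by move=> a x y; rewrite klin.
  have fD (x : X) : nrm (real_part_real R) (ell_val (k x) j : R^o) <=
      D * nrm (real_part_real R) x.
    apply: le_trans (kD x).
    apply: le_trans (lnorm_le_ell_norm (k x) (isT : uniq [:: j])).
    by apply: lnorm_ub; rewrite ?mem_seq1.
  by have [f fE] := op_of_bounded fl fD; exists f.
have [e' e'E] := choice e'_ex.
exists (fun j => J (e j)), e', `|J|, D; split=> //.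
- by move=> i j; rewrite e'E /k PrJ gJ eE eq_sym.
- move=> s u us; have -> : \sum_(j <- s) u j *: J (e j) = J (\sum_(j <- s) u j *: e j).
    by rewrite linear_sum; apply: eq_bigr => j _; rewrite linearZ.
  apply: le_trans (opnorm_bound J _) _; apply: ler_wpM2l; first exact: opnorm_ge0.
  exact: eP.
- move=> s u us; rewrite -[`|_|]/(nrm (real_part_real R) _).
  apply: nrm_op_le => [|x]; first by rewrite mulr_ge0 ?lnorm_ge0.
  rewrite op_sumE -[nrm _ _]/(`|_|).
  apply: le_trans (ler_norm_sum _ _ _) _.
  apply: (@le_trans _ _ (\sum_(j <- s) `|u j| * `|ell_val (k x) j|)).
    by apply: ler_sum => j _; rewrite -e'E -normrM.
  have Pp : P^-1 + p^-1 = 1 by rewrite addrC.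
  apply: le_trans (lnorm_hoelder _ _ _ P0 p0 Pp) _.
  rewrite [D * _]mulrC -mulrA; apply: ler_wpM2l; first exact: lnorm_ge0.
  by apply: le_trans (lnorm_le_ell_norm _ us) _; exact: kD.
Qed.

End copies.

(** * The frames in a real space *)

Section strong_limits.
Context {R : realType}.
Variable X : completeNormedModType R.
Variables (S : nat -> X -> X) (C : R).

Lemma strong_limit_unique (s : nat -> X) y y' :
  (forall e : R, 0 < e -> exists M, forall N, (M <= N)%N -> `|y - s N| <= e) ->
  (forall e : R, 0 < e -> exists M, forall N, (M <= N)%N -> `|y' - s N| <= e) ->
  y = y'.
Proof.
move=> hy hy'; apply/eqP; rewrite -subr_eq0 -normr_le0.
apply/ler_addgt0Pr => e e0; rewrite add0r.
have e2 : 0 < e / 2 by rewrite divr_gt0.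
have [M hM] := hy _ e2; have [M' hM'] := hy' _ e2.
have h1 := hM (maxn M M') (leq_maxl _ _); have h2 := hM' (maxn M M') (leq_maxr _ _).
have -> : y - y' = (y - s (maxn M M')) - (y' - s (maxn M M')).
  by rewrite opprB addrA subrK.
by apply: le_trans (ler_normB _ _) _; lra.
Qed.

Lemma strong_limit_exists (s : nat -> X) :
  (forall e : R, 0 < e -> exists M, forall N, (M <= N)%N -> `|s N - s M| <= e) ->
  exists y, forall e : R, 0 < e -> exists M, forall N, (M <= N)%N -> `|y - s N| <= e.
Proof.
move=> h; have cs : cvg (s @ \oo).
  apply: cauchy_cvg; apply/cauchy_exP => e e0.
  have e2 : 0 < e / 2 by rewrite divr_gt0.
  have [M hM] := h _ e2; exists (s M); exists M => // N /= /hM.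
  by rewrite -ball_normE /= distrC => /le_lt_trans; apply; lra.
exists (lim (s @ \oo)) => e e0.
by have /cvgrPdist_le/(_ e e0)[M _ hM] := cs; exists M => N /hM.
Qed.

Hypothesis S_linear : forall N, linear (S N).
Hypothesis S_bound : forall N x, `|S N x| <= C * `|x|.
Hypothesis S_cauchy : forall x (e : R), 0 < e ->
  exists M, forall N, (M <= N)%N -> `|S N x - S M x| <= e.

Lemma strong_limit_op : exists T : op X X, forall x (e : R), 0 < e ->
  exists M, forall N, (M <= N)%N -> `|T x - S N x| <= e.
Proof.
have [t tP] := choice (fun x => strong_limit_exists (S_cauchy x)).
have lt : linear t.
  move=> a x y; apply: (strong_limit_unique (s := fun N => S N (a *: x + y))); first exact: tP.
  move=> e e0; have a1 : 0 < `|a| + 1 by rewrite ltr_wpDl.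
  have d0 : 0 < e / 2 / (`|a| + 1) by rewrite !divr_gt0.
  have e2 : 0 < e / 2 by rewrite divr_gt0.
  have [M hM] := tP x _ d0; have [M' hM'] := tP y _ e2.
  exists (maxn M M') => N; rewrite geq_max => /andP[/hM h1 /hM' h2].
  rewrite S_linear opprD addrACA -scalerBr.
  apply: le_trans (ler_normD _ _) _; rewrite normrZ.
  have : `|a| * `|t x - S N x| <= e / 2.
    apply: le_trans (ler_wpM2l (normr_ge0 a) h1) _.
    by rewrite mulrA ler_pdivrMr// mulrC ler_pM2l// lerDl.
  lra.
have bt (x : X) : nrm (real_part_real R) (t x) <= C * nrm (real_part_real R) x.
  apply/ler_addgt0Pr => e e0; have [M /(_ M (leqnn M)) hM] := tP x _ e0.
  rewrite -(subrK (S M x) (t x)); apply: le_trans (nrmD _ _ _) _.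
  by rewrite [leRHS]addrC; apply: lerD; [exact: hM|exact: S_bound].
have [T TE] := op_of_bounded lt bt; exists T => x e e0.
by rewrite TE; exact: tP.
Qed.

End strong_limits.

Section real_frame.
Context {R : realType}.

(** The basis is relabelled by pairs through the injection [pickle], which preserves uniqueness of
    index lists and p-norms. *)
Lemma pair_index_bound (V : normedModType R) (e : nat -> V) (p C : R) :
  (forall (s : seq nat) u, uniq s -> `|\sum_(j <- s) u j *: e j| <= C * lnorm p s u) ->
  forall (t : seq (nat * nat)) (u : nat * nat -> R), uniq t ->
  `|\sum_(v <- t) u v *: e (pickle v)| <= C * lnorm p t u.
Proof.
move=> h t u ut; pose u' n : R := if unpickle n is Some v then u v else 0.
have u'E v : u' (pickle v) = u v by rewrite /u' pickleK.
have us : uniq [seq pickle v | v <- t] by rewrite (map_inj_uniq (pcan_inj pickleK)).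
have lE : lnorm p [seq pickle v | v <- t] u' = lnorm p t u.
  by rewrite !lnormE big_map; congr (_ `^ _); apply: eq_bigr => v _; rewrite u'E.
rewrite -lE; apply: le_trans (h _ u' us); rewrite big_map le_eqVlt; apply/orP; left.
by apply/eqP; congr (`|_|); apply: eq_bigr => v _; rewrite u'E.
Qed.

Variables (p P q q0 Q c al : R).
Hypotheses (p0 : 0 < p) (p2 : p < 2) (pE : p^-1 = 2^-1 + c) (P2 : 2 < P)
  (PE : P^-1 = 2^-1 - c) (q01 : 1 < q0) (q0q : q0 < q) (Q1 : 2 < Q) (QP : Q < P)
  (q0Q : q0^-1 + Q^-1 = 1) (al0 : 0 <= al) (alQ : 2^-1 - Q^-1 <= al * c).
Variable X : completeNormedModType R.
Variables (e : nat -> X) (e' : nat -> dual X) (C C' : R).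
Hypotheses (C0 : 0 <= C) (C'0 : 0 <= C')
  (ee' : forall i j, e' i (e j) = (j == i)%:R)
  (eP : forall (s : seq nat) u, uniq s ->
    `|\sum_(j <- s) u j *: e j| <= C * lnorm p s u)
  (e'P : forall (s : seq nat) u, uniq s ->
    `|\sum_(j <- s) u j *: e' j| <= C' * lnorm P s u).
Variables (z : nat -> X) (Cz : R).
Hypotheses (Cz0 : 0 <= Cz) (zP : forall (s : seq nat) u, uniq s ->
  `|\sum_(j <- s) u j *: z j| <= Cz * lnorm q s u).

Let sp m : R := (m`!)%:R `^ (- al).
Let eb (v : nat * nat) := e (pickle v).
Let eb' (v : nat * nat) : dual X := e' (pickle v).
Let zb (v : nat * nat) := z (pickle v).
Let x n i : X := block_vector p eb factorial sp n i.
Let a (v : nat * nat) : dual X := block_vector P eb' factorial sp v.1 v.2.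
Let spE m : sp m = (m`!)%:R `^ (- al). Proof. by []. Qed.
Let cE : 2^-1 - P^-1 = c. Proof. by rewrite PE; ring. Qed.
Let ebP := pair_index_bound eP.
Let eb'P := pair_index_bound e'P.
Let zbP := pair_index_bound zP.

Lemma frame_biorthogonal v n i : (v.2 < v.1`!)%N -> (i < n`!)%N ->
  a v (x n i) = (v == (n, i))%:R.
Proof.
case: v => m l /= lm il.
have s0 := sparsity_gt0 (fact_gt0) spE; have s1 := sparsity_le1 (fact_gt0) al0 spE.
have pP : P^-1 + p^-1 = 1 by rewrite pE PE; lra.
have -> : a (m, l) (x n i) = \sum_(0 <= l1 < size (points (sp m) m`!))
    \sum_(0 <= l0 < size (points (sp n) n`!))
      weight P (sp m) m`! l l1 * weight p (sp n) n`! i l0 * ((n, l0) == (m, l1))%:R.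
  rewrite /a /block_vector /= op_sumE; apply: eq_bigr => l1 _.
  rewrite opZ /x /block_vector linear_sum scaler_sumr; apply: eq_bigr => l0 _.
  rewrite linearZ /= /eb /eb' ee' (inj_eq (pcan_inj pickleK)).
  by rewrite -[LHS]/(_ * (_ * _)) mulrA.
have [mn|mn] := eqVneq m n; last first.
  rewrite xpair_eqE (negbTE mn) /= big1// => l1 _; rewrite big1// => l0 _.
  by rewrite xpair_eqE eq_sym (negbTE mn) mulr0.
rewrite mn in lm *; rewrite xpair_eqE eqxx /=.
rewrite -(weight_biorthogonal pP (s0 n) (s1 n) lm il).
apply: eq_big_nat => l1 l1k.
rewrite (bigD1_seq l1) ?iota_uniq ?mem_index_iota//= eqxx mulr1 big1 ?addr0// => l0 l01.
by rewrite xpair_eqE eqxx /= (negbTE l01) mulr0.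
Qed.

(** [T] is the strong limit of the partial sums of a_v(w) z_v. The lower bound [alQ] on [al]
    provides the upper l_Q-estimate of the functionals, hence coefficients in l_q0. *)
Lemma real_frame : exists (D : R) (T : op X X),
  frame (real_part_real R) p P Q c zb al D x a T.
Proof.
have hP2 := P2; have hQ1 := Q1; have hq01 := q01; have hq0q := q0q; have hC0 := C0.
have c0 : 0 < 2^-1 - P^-1 by rewrite subr_gt0 ltf_pV2// posrE; lra.
have alQ' : 2^-1 - Q^-1 <= al * (2^-1 - P^-1) by rewrite cE.
have fhomo : {homo factorial : m n / (m <= n)%N} := leq_fact.
have [D1 D10 hD1] := block_functional_norm1 C'0 eb'P fact_gt0 al0 spE P2 Q1 QP alQ'.
have [D2 D20 hD2] := block_functional_norm2 C'0 eb'P fact_gt0 al0 spE P2 fhomo.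
pose D := C + C * 2 `^ p^-1 + D1 + D2.
have C20 : 0 <= C * 2 `^ p^-1 by rewrite mulr_ge0 ?powR_ge0.
have D0 : 0 <= D by rewrite /D; lra.
have le_D (d s r : R) : 0 <= r -> s <= d * r -> d <= D -> s <= D * r.
  by move=> r0 h dD; apply: le_trans h _; exact: ler_wpM2r.
pose rp := real_part_real R.
have a_bound M N (b : nat * nat -> R) :
    nrm rp (\sum_(v <- blocks factorial M N) emb rp (b v) *: a v) <=
    D * lnorm Q (blocks factorial M N) b.
  apply: (le_D D1); [exact: lnorm_ge0|exact: hD1|rewrite /D; lra].
have z_bound M N (b : nat * nat -> R) :
    nrm rp (\sum_(v <- blocks factorial M N) emb rp (b v) *: zb v) <=
    Cz * lnorm q (blocks factorial M N) b.
  exact: (zbP _ (uniq_blocks _ _ _)).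
have Q0 : 0 < Q by lra.
have q00 : 0 < q by lra.
have Qq0 : Q^-1 + q0^-1 = 1 by rewrite addrC.
have aq0 M N (w : X) :
    lnorm q0 (blocks factorial M N) (fun v => a v w) <= 4 * (D * `|w|).
  have [E [EE En]] := evaluation_exists rp w.
  have := lnorm_functional Q0 D0 (a_bound M N) E q01 Qq0.
  have -> : lnorm q0 (blocks factorial M N) (fun v => nrm rp (E (a v))) =
      lnorm q0 (blocks factorial M N) (fun v => a v w).
    rewrite !lnormE; congr (_ `^ _); apply: eq_bigr => v _.
    by rewrite EE -[nrm rp _]/(`|a v w|) normr_id.
  move=> /le_trans; apply; apply: ler_wpM2l => //; exact: ler_wpM2l.
have aq M N (w : X) : lnorm q (blocks factorial M N) (fun v => a v w) <= 4 * (D * `|w|).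
  by apply: le_trans (aq0 M N w); apply: lnorm_anti; [lra|exact: ltW].
pose S N (w : X) := \sum_(v <- blocks factorial 0 N) a v w *: zb v.
have S_linear N : linear (S N).
  move=> k w w'; rewrite /S scaler_sumr -big_split; apply: eq_bigr => v _ /=.
  by rewrite linearP scalerDl scalerA.
have S_bound N (w : X) : `|S N w| <= Cz * (4 * D) * `|w|.
  apply: le_trans (zbP _ (uniq_blocks _ _ _)) _; rewrite -!mulrA; apply: ler_wpM2l => //.
have S_cauchy (w : X) (d : R) : 0 < d ->
    exists M, forall N, (M <= N)%N -> `|S N w - S M w| <= d.
  (* The q-th powers of the coefficients, summed over a block. Their total is bounded because q0 <
     q, so their tails are small and [zP] makes the partial sums Cauchy. *)
  move=> d0; pose u m : R := \sum_(0 <= i < m`!) `|a (m, i) w| `^ q.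
  have u0 m : 0 <= u m by apply: sumr_ge0 => i _; exact: powR_ge0.
  have uE M N : \sum_(M <= m < N) u m =
      lnorm q (blocks factorial M N) (fun v => a v w) `^ q.
    by rewrite lnorm_powR// big_blocks.
  have uB N : \sum_(0 <= m < N) u m <= (4 * (D * `|w|)) `^ q.
    by rewrite uE; apply: le_powR; rewrite ?lnorm_ge0 ?(ltW q00).
  have Cz1 : 0 < Cz + 1 by have := Cz0; lra.
  have d1 : 0 < d / (Cz + 1) by rewrite divr_gt0.
  have [M hM] := bounded_series_tail u0 uB (powR_gt0 q d1).
  exists M => N MN; have -> : S N w - S M w = \sum_(v <- blocks factorial M N) a v w *: zb v.
    rewrite /S !big_blocks (@big_cat_nat _ _ _ M 0 N) //=.
    by rewrite addrAC subrr add0r.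
  apply: le_trans (zbP _ (uniq_blocks _ _ _)) _.
  have : lnorm q (blocks factorial M N) (fun v => a v w) <= d / (Cz + 1).
    apply: (powR_le_swap q00); rewrite ?lnorm_ge0 ?(ltW d1)//.
    by rewrite -uE hM.
  move=> /(ler_wpM2l Cz0)/le_trans; apply.
  by rewrite mulrA ler_pdivrMr// mulrC ler_pM2l// lerDl.
have [T hT] := strong_limit_op S_linear S_bound S_cauchy.
exists D, T; split=> //.
- move=> n b; apply: (le_D C); first exact: lnorm_ge0.
    exact: (block_vector_norm1 C0 ebP fact_gt0 al0 spE p0 p2).
  by rewrite /D; lra.
- move=> n b; apply: (le_D (C * 2 `^ p^-1)).
  + by rewrite mulr_ge0 ?powR_ge0 ?lnorm_ge0.
  + have -> : c = p^-1 - 2^-1 by rewrite pE; ring.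
    exact: (block_vector_norm2 C0 ebP fact_gt0 al0 spE p0 p2).
  + by rewrite /D; lra.
- move=> n N b; apply: (le_D D2).
  + by rewrite addr_ge0 ?mulr_ge0 ?powR_ge0 ?lnorm_ge0.
  + by rewrite -cE; exact: hD2.
  + by rewrite /D; lra.
(* By biorthogonality the partial sums at [x n i] equal z_(n,i) as soon as they include block
   [n]. *)
- move=> n i ik; apply: (strong_limit_unique (s := fun N => S N (x n i))); first exact: hT.
  move=> d d0; exists n.+1 => N nN.
  have nb : (n, i) \in blocks factorial 0 N by rewrite mem_blocks nN ik.
  have -> : S N (x n i) = zb (n, i).
    rewrite /S (bigD1_seq (n, i)) ?uniq_blocks//= frame_biorthogonal// eqxx scale1r.
    rewrite big_seq_cond big1 ?addr0// => v /andP[+ vn].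
    rewrite mem_blocks => /andP[_ v2].
    by rewrite frame_biorthogonal// (negbTE vn) scale0r.
  by rewrite subrr normr0 ltW.
Qed.

End real_frame.

(** * Transfer to the complexification *)

Section transfer.
Context {R : realType} {K : numFieldType} {hK : nneg_sup_complete K}.
Variable rp : real_part R K.
Variables (X : normedModType R) (W : normedModType K).
Local Notation rpR := (real_part_real R).
Variables (E : X -> W) (E' : dual X -> dual W) (B : R).
Hypotheses (B1 : 1 <= B)
  (E_lin : forall r x y, E (r *: x + y) = emb rp r *: E x + E y)
  (E_le : forall x, nrm rp (E x) <= B * `|x|)
  (E'_lin : forall r f g, E' (r *: f + g) = emb rp r *: E' f + E' g)
  (E'_le : forall f, nrm rp (E' f) <= B * `|f|)
  (E'E : forall f x, E' f (E x) = emb rp (f x))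
  (E_decomp : forall w, exists x y, w = E x + rp_v rp *: E y).

Lemma transfer_sum (I : Type) (s : seq I) (b : I -> R) (g : I -> X) :
  \sum_(i <- s) emb rp (b i) *: E (g i) = E (\sum_(i <- s) b i *: g i).
Proof.
have E0 : E 0 = 0.
  by have := E_lin 1 0 0; rewrite rmorph1 !scale1r addr0 => /esym/(canRL (addrK _)); rewrite subrr.
elim: s => [|i s IH]; first by rewrite !big_nil E0.
by rewrite !big_cons E_lin IH.
Qed.

Lemma transfer_dual_sum (I : Type) (s : seq I) (b : I -> R) (g : I -> dual X) :
  \sum_(i <- s) emb rp (b i) *: E' (g i) = E' (\sum_(i <- s) b i *: g i).
Proof.
have E0 : E' 0 = 0.
  by have := E'_lin 1 0 0; rewrite rmorph1 !scale1r addr0 => /esym/(canRL (addrK _)); rewrite subrr.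
elim: s => [|i s IH]; first by rewrite !big_nil E0.
by rewrite !big_cons E'_lin IH.
Qed.

(** The estimates of a frame involve real coefficients only and pass through [E] and [E'] with the
    factor [B]. The convergence at a general vector follows from [E_decomp]. *)
Lemma transfer_frame (p P Q c al D : R) z x a (T : op X X) (T' : op W W) :
  (forall y, T' (E y) = E (T y)) ->
  frame rpR p P Q c z al D x a T ->
  frame rp p P Q c (E \o z) al (B * D) (fun n i => E (x n i)) (E' \o a) T'.
Proof.
move=> T'E fr; have D0 := frame_ge0 fr; have B0 : 0 <= B := le_trans ler01 B1.
have B1' := B1.
split.
- by rewrite mulr_ge0.
- move=> n b; rewrite transfer_sum; apply: le_trans (E_le _) _; rewrite -mulrA.
  by apply: ler_wpM2l => //; exact: (frame_x fr).
- move=> n b; rewrite transfer_sum; apply: le_trans (E_le _) _; rewrite -mulrA.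
  by apply: ler_wpM2l => //; exact: (frame_x2 fr).
- move=> M N b; rewrite transfer_dual_sum; apply: le_trans (E'_le _) _; rewrite -mulrA.
  by apply: ler_wpM2l => //; exact: (frame_a fr).
- move=> n N b; rewrite transfer_dual_sum; apply: le_trans (E'_le _) _; rewrite -mulrA.
  by apply: ler_wpM2l => //; exact: (frame_a2 fr).
- by move=> n i ik; rewrite T'E (frame_Tx fr ik).
move=> w e e0; have [y1 [y2 wE]] := E_decomp w.
have d0 : 0 < e / 2 / B by rewrite !divr_gt0//; lra.
have [M1 h1] := frame_T fr y1 d0; have [M2 h2] := frame_T fr y2 d0.
exists (maxn M1 M2) => N; rewrite geq_max => /andP[/h1 {}h1 /h2 {}h2].
set r := blocks factorial 0 N in h1 h2 *.
pose S y := \sum_(v <- r) a v y *: z v.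
have E_sub y y' : E (y - y') = E y - E y'.
  by rewrite addrC -scaleN1r E_lin rmorphN rmorph1 scaleN1r addrC.
have -> : T' w - \sum_(v <- r) (E' \o a) v w *: (E \o z) v =
    E (T y1 - S y1) + rp_v rp *: E (T y2 - S y2).
  have -> : \sum_(v <- r) (E' \o a) v w *: (E \o z) v = E (S y1) + rp_v rp *: E (S y2).
    rewrite /S -!transfer_sum scaler_sumr -big_split; apply: eq_bigr => v _ /=.
    by rewrite wE linearD linearZ /= !E'E scalerDl scalerA.
  rewrite !E_sub wE linearD linearZ /= !T'E scalerBr opprD.
  by rewrite addrACA.
apply: le_trans (nrmD _ _ _) _; rewrite nrmZ.
have EB y : nrm rpR (T y - S y) <= e / 2 / B -> nrm rp (E (T y - S y)) <= e / 2.
  move=> h; apply: le_trans (E_le _) _; apply: le_trans (ler_wpM2l B0 h) _.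
  by rewrite mulrC divfK// gt_eqF//; lra.
have v1 : nrm rp (rp_v rp) <= 1 by rewrite le_nrm rmorph1 norm_v.
have : nrm rp (rp_v rp) * nrm rp (E (T y2 - S y2)) <= nrm rp (E (T y2 - S y2)).
  by rewrite ler_piMl ?nrm_ge0.
have := EB _ h1; have := EB _ h2; lra.
Qed.

End transfer.

(** * Choice of the exponents *)

Section final_chain.
Context {R : realType}.
Variables (p q : R).

(** A logistic curve, which parametrizes the exponents between [al0] and 1 increasingly by the whole
    real line. *)
Definition exponent (al0 t : R) : R := 1 - (1 - al0) / (1 + expR t).

Lemma exponent_bounds al0 t : al0 < 1 -> al0 <= exponent al0 t < 1.
Proof.
move=> h; have e0 : 0 < expR t := expR_gt0 t.
have d0 : 0 < 1 + expR t by lra.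
have h1 : 0 < (1 - al0) / (1 + expR t) by rewrite divr_gt0// subr_gt0.
have h2 : (1 - al0) / (1 + expR t) <= 1 - al0.
  by rewrite ler_pdivrMr// ler_peMr; lra.
by rewrite /exponent; apply/andP; split; lra.
Qed.

Lemma exponent_lt al0 t t' : al0 < 1 -> t < t' -> exponent al0 t < exponent al0 t'.
Proof.
move=> h tt'; have e0 : 0 < expR t := expR_gt0 t.
have e1 : expR t < expR t' by rewrite ltr_expR.
rewrite /exponent ltrD2l ltrN2 ltr_pM2l ?subr_gt0// ltf_pV2 ?posrE; lra.
Qed.

Lemma admits_chain (X : completeNormedModType R) (K : numFieldType)
    (hK : nneg_sup_complete K) (rp : real_part R K) (W : normedModType K)
    (E : X -> W) (E' : dual X -> dual W) (E2 : op X X -> op W W) (B : R) :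
  1 < p -> p < 2 -> p < q ->
  (exists P, p^-1 + P^-1 = 1 /\ 0 < P /\ source_system p P X) ->
  (forall q1, p < q1 -> q1 <= q -> target_system q1 X) ->
  1 <= B ->
  (forall r x y, E (r *: x + y) = emb rp r *: E x + E y) ->
  (forall x, nrm rp (E x) <= B * `|x|) ->
  (forall r f g, E' (r *: f + g) = emb rp r *: E' f + E' g) ->
  (forall f, nrm rp (E' f) <= B * `|f|) ->
  (forall f x, E' f (E x) = emb rp (f x)) ->
  (forall w, exists x y, w = E x + rp_v rp *: E y) ->
  (forall T y, E2 T (E y) = E (T y)) ->
  admits_continuum_chain R W FSS /\ admits_continuum_chain R (dual W) SSCS.
Proof.
move=> p1 p2 pq [P [pP [P0 [e [e' [C [C' [C0 C'0 ee' eP e'P]]]]]]]] target B1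
  E_lin E_le E'_lin E'_le E'E E_decomp E2E.
have p0 : 0 < p by lra.
(* The target exponent is lowered below 2, still above [p]. *)
pose q1 := Num.min q ((p + 2) / 2).
have pq1 : p < q1 by rewrite lt_min pq /=; lra.
have q12 : q1 < 2 by rewrite gt_min; apply/orP; right; lra.
have q1q : q1 <= q by rewrite ge_min lexx.
have [z [f [Cz [Cf [Cz0 zP fz f_le]]]]] := target q1 pq1 q1q.
(* Strictly between [p] and [q1], so that its conjugate exponent [Q] lies strictly between 2 and
   [P]. *)
pose q0 := (p + q1) / 2.
have pq0 : p < q0 by rewrite /q0; lra.
have q0q1 : q0 < q1 by rewrite /q0; lra.
have q01 : 1 < q0 by lra.
have q02 : q0 < 2 by lra.
pose c := p^-1 - 2^-1.
have pE : p^-1 = 2^-1 + c by rewrite /c; ring.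
have PE : P^-1 = 2^-1 - c by rewrite /c; lra.
have half (r : R) : 0 < r -> r < 2 -> 2^-1 < r^-1.
  by move=> r0 r2; rewrite ltf_pV2// posrE.
have half_inv (r : R) : 0 < r -> r^-1 < 2^-1 -> 2 < r.
  by move=> r0; rewrite ltf_pV2// posrE.
have c0 : 0 < c by rewrite /c subr_gt0; exact: half.
have P2 : 2 < P by apply: half_inv => //; rewrite PE; lra.
pose Q := (1 - q0^-1)^-1.
have q0i1 : q0^-1 < 1 by rewrite invf_lt1//; lra.
have Q0 : 0 < Q by rewrite invr_gt0 subr_gt0.
have QE : Q^-1 = 1 - q0^-1 by rewrite /Q invrK.
have q0Q : q0^-1 + Q^-1 = 1 by rewrite QE; ring.
have Q2 : 2 < Q by apply: half_inv => //; rewrite QE; have := half q0 ltac:(lra) q02; lra.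
have q0p : q0^-1 < p^-1 by rewrite ltf_pV2// posrE; lra.
have QP : Q < P by rewrite -ltf_pV2 ?posrE// QE; lra.
(* The least exponent meeting the condition [alQ] of [real_frame]; it is below 1 because q0 > p. *)
pose a0 := (2^-1 - Q^-1) / c.
have a0c : a0 * c = 2^-1 - Q^-1 by rewrite /a0 divfK// gt_eqF.
have a01 : a0 < 1 by rewrite ltr_pdivrMr// mul1r QE /c; lra.
have a00 : 0 <= a0.
  by rewrite divr_ge0 ?(ltW c0)// QE; have := half q0 ltac:(lra) q02; lra.
pose al := exponent a0.
have al_ge t : a0 <= al t by have /andP[] := exponent_bounds t a01.
have al1 t : al t < 1 by have /andP[] := exponent_bounds t a01.
have al0 t : 0 <= al t by exact: le_trans a00 (al_ge t).
have alQ t : 2^-1 - Q^-1 <= al t * c.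
  by rewrite -a0c; apply: ler_wpM2r => //; exact: ltW.
have fr t := real_frame p0 p2 pE P2 PE q01 q0q1 Q2 QP q0Q (al0 t) (alQ t) C0 C'0 ee' eP e'P Cz0 zP.
have [D hD] := choice fr; have [T hT] := choice hD.
have fr' t := transfer_frame B1 E_lin E_le E'_lin E'_le E'E E_decomp (E2E (T t)) (hT t).
have BCz0 : 0 <= B * Cz by rewrite mulr_ge0//; lra.
have zP' M N (b : nat * nat -> R) :
    nrm rp (\sum_(v <- blocks factorial M N) emb rp (b v) *: (E \o (fun v => z (pickle v))) v) <=
    B * Cz * lnorm q1 (blocks factorial M N) b.
  rewrite (transfer_sum E_lin); apply: le_trans (E_le _) _; rewrite -mulrA.
  apply: ler_wpM2l; first by lra.
  exact: (pair_index_bound zP _ (uniq_blocks _ _ _)).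
have f_le' (v : nat * nat) : nrm rp (E' (f (pickle v))) <= B * Cf.
  by apply: le_trans (E'_le _) _; apply: ler_wpM2l => //; lra.
have fz' (v : nat * nat) : E' (f (pickle v)) (E (z (pickle v))) = 1.
  by rewrite E'E fz rmorph1.
have Q1 : 1 < Q by lra.
have al_lt t t' : t < t' -> al t < al t' by exact: exponent_lt.
split.
  exact: (frames_chain_FSS p0 pE P2 PE c0 q01 q02 q0q1 Q1 q0Q BCz0 zP' f_le' fz' fr' al0 al1 al_lt).
exact: (frames_chain_SSCS p0 pE P2 PE c0 q01 q02 q0q1 Q1 q0Q BCz0 zP' f_le' fz' fr' al0 al1 al_lt).
Qed.

End final_chain.

(** * Functionals and operators on the complexification *)

Section complexified_operators.
Context {R : realType}.
Variable X : normedModType R.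
Local Notation rp := (real_part_complex R).
Local Notation XC := (complexification X).

Lemma cre_le (z : XC) : `|cre z| <= nrm rp z.
Proof.
have c1 : (1 : R) ^+ 2 + 0 ^+ 2 = 1 by rewrite expr1n expr0n addr0.
by have := real_cnorm_ub z c1; rewrite scale1r scale0r addr0.
Qed.

Lemma cim_le (z : XC) : `|cim z| <= nrm rp z.
Proof.
have c1 : (0 : R) ^+ 2 + 1 ^+ 2 = 1 by rewrite expr1n expr0n add0r.
by have := real_cnorm_ub z c1; rewrite scale1r scale0r add0r.
Qed.

Lemma nrm_complexified_le (x y : X) : nrm rp (Complexified x y) <= `|x| + `|y|.
Proof.
apply: real_cnorm_le => c s cs; apply: le_trans (ler_normD _ _) _; rewrite !normrZ.
have sq1 (a b : R) : a ^+ 2 + b ^+ 2 = 1 -> `|a| <= 1.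
  move=> h; rewrite -(@expr_le1 _ 2)// real_normK ?num_real// -h lerDl; exact: sqr_ge0.
apply: lerD; rewrite ler_piMl//; first exact: sq1 cs.
by apply: (sq1 s c); rewrite addrC.
Qed.

Lemma complexified_eq (a : R[i]) (x y x' y' : X) :
  a *: Complexified x y + Complexified x' y' =
  Complexified (complex.Re a *: x - complex.Im a *: y + x')
               (complex.Re a *: y + complex.Im a *: x + y').
Proof. by []. Qed.

(** The complex-linear extension. Its real and imaginary parts are bounded separately, whence the
    factor 2. *)
Lemma complexify_dual_exists (f : dual X) : exists F : dual XC,
  (forall z : XC, F z = (f (cre z) +i* f (cim z))%C) /\ nrm rp F <= 2 * `|f|.
Proof.
pose g (z : XC) : (R[i] : numFieldType)^o := (f (cre z) +i* f (cim z))%C.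
have gl : linear g.
  move=> a [x y] [x' y']; rewrite complexified_eq /g /=.
  have -> : f (complex.Re a *: x - complex.Im a *: y + x') =
      complex.Re a * f x - complex.Im a * f y + f x' :> R.
    by rewrite linearD linearB !linearZ.
  have -> : f (complex.Re a *: y + complex.Im a *: x + y') =
      complex.Re a * f y + complex.Im a * f x + f y' :> R.
    by rewrite !linearD !linearZ.
  by case: a.
have gb (z : XC) : nrm rp (g z) <= 2 * `|f| * nrm rp z.
  have f0 : 0 <= `|f| := opnorm_ge0 f.
  apply: le_trans (nrm_le_re rp (g z)) _; rewrite /g.
  have -> : re rp (f (cre z) +i* f (cim z))%C = f (cre z) by [].
  have -> : re rp (rp_u rp * (f (cre z) +i* f (cim z))%C) = f (cim z).
    by rewrite /=; ring.
  have -> : 2 * `|f| * nrm rp z = `|f| * nrm rp z + `|f| * nrm rp z by ring.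
  apply: lerD; apply: le_trans (opnorm_bound f _) _; apply: ler_wpM2l => //.
    exact: cre_le.
  exact: cim_le.
have [F FE] := op_of_bounded gl gb; exists F; split=> [z|]; first exact: FE.
by apply: nrm_op_le => [|z]; [apply: mulr_ge0; rewrite ?opnorm_ge0|rewrite FE; exact: gb].
Qed.

Lemma complexify_op_exists (T : op X X) : exists S : op XC XC,
  forall z : XC, S z = Complexified (T (cre z)) (T (cim z)).
Proof.
pose g (z : XC) := Complexified (T (cre z)) (T (cim z)).
have gl : linear g.
  move=> a [x y] [x' y']; rewrite complexified_eq /g /=.
  have -> : T (complex.Re a *: x - complex.Im a *: y + x') =
      complex.Re a *: T x - complex.Im a *: T y + T x'.
    by rewrite linearD linearB !linearZ.
  have -> : T (complex.Re a *: y + complex.Im a *: x + y') =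
      complex.Re a *: T y + complex.Im a *: T x + T y'.
    by rewrite !linearD !linearZ.
  by [].
have gb (z : XC) : nrm rp (g z) <= 2 * `|T| * nrm rp z.
  have f0 : 0 <= `|T| := opnorm_ge0 T.
  apply: le_trans (nrm_complexified_le _ _) _.
  have -> : 2 * `|T| * nrm rp z = `|T| * nrm rp z + `|T| * nrm rp z by ring.
  apply: lerD; apply: le_trans (opnorm_bound T _) _; apply: ler_wpM2l => //.
    exact: cre_le.
  exact: cim_le.
have [S SE] := op_of_bounded gl gb; exists S => z; exact: SE.
Qed.

End complexified_operators.

Theorem theorem1p1 (R : realType) (p q : R) (p1 : 1 < p) (p2 : p < 2)
    (pq : p < q) (X : completeNormedModType R)
    (X_ellp : contains_complemented_copy (ell (ltW p1)) X)
    (X_ellq_c0 : contains_copy (ell (ltW (lt_trans p1 pq))) X \/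
                 contains_copy (c0 R) X) :
  [/\ admits_continuum_chain R X FSS,
      admits_continuum_chain R (complexification X) FSS,
      admits_continuum_chain R (dual X) SSCS &
      admits_continuum_chain R (dual (complexification X)) SSCS].
Proof.
have p0 : 0 < p := lt_trans ltr01 p1.
have source : exists P, p^-1 + P^-1 = 1 /\ 0 < P /\ source_system p P X.
  have P0 : 0 < (1 - p^-1)^-1 by rewrite invr_gt0 subr_gt0 invf_lt1.
  exists (1 - p^-1)^-1; rewrite invrK addrC subrK; split=> //; split=> //.
  by apply: contains_source X_ellp => //; rewrite invrK addrC subrK.
have target q1 : p < q1 -> q1 <= q -> target_system q1 X.
  move=> pq1 q1q; apply: contains_target q1q X_ellq_c0.
  exact: lt_trans p0 pq1.
have [real_FSS real_SSCS] : admits_continuum_chain R X FSS /\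
    admits_continuum_chain R (dual X) SSCS.
  (* For real scalars the transfer is the identity, with constant 1 and zero second component. *)
  apply: (@admits_chain R p q X R _ (real_part_real R) X id id id 1) => //.
  - by move=> x; rewrite mul1r.
  - by move=> f; rewrite mul1r.
  - by move=> w; exists w, 0; rewrite scaler0 addr0.
have [E' E'P] := choice (@complexify_dual_exists R X).
have E'E f := (E'P f).1.
have [E2 E2E] := choice (@complexify_op_exists R X).
pose E (x : X) : complexification X := Complexified x 0.
have [complex_FSS complex_SSCS] : admits_continuum_chain R (complexification X) FSS /\
    admits_continuum_chain R (dual (complexification X)) SSCS.
  (* Vectors are embedded as x + i0, functionals and operators are extended complex-linearly; the
     constant 2 is that of [complexify_dual_exists]. *)
  apply: (@admits_chain R p q X R[i] _ (real_part_complex R) (complexification X) E E' E2 2) => //.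
  - by rewrite ler1n.
  - by move=> r x y; rewrite complexified_eq /E /= !scaler0 subr0 scale0r !addr0.
  - move=> x; apply: le_trans (nrm_complexified_le _ _) _.
    by rewrite normr0 addr0 ler_peMl// ler1n.
  - move=> r f g; apply/val_inj/funext => z /=.
    rewrite [RHS]/(real_complex R r *: E' f z + E' g z) !E'E.
    by apply/eqP; rewrite eq_complex /=; apply/andP; split; apply/eqP; rewrite /= mul0r ?subr0 ?addr0.
  - by move=> f; have [] := E'P f.
  - by move=> f x; rewrite E'E /= linear0.
  - move=> [x y]; exists x, y.
    rewrite addrC [RHS]complexified_eq /= !scale0r !scale1r subr0 !add0r addr0.
    by [].
  - by move=> T y; rewrite E2E /E /= linear0.
by split.
Qed.
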